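(* Let $1\le l\le n-1$ and let $s\in C^2(\mathbb{R}^{B_{\mathbf 0}^r},\mathbb{R})$ be admissible. Suppose that there are adjacent $v_0,w_0\in\mathcal{M}_0$ with $v_0<w_0$ and, successively for $i=1,\dots,l$, that there are adjacent $v_i,w_i\in\mathcal{M}_i(v_{i-1},w_{i-1})$ with $v_i<w_i$. Then there is a configuration $U_{l+1}\in\mathcal{M}_{l+1}(v_l,w_l)$ which is a solution of the Euler–Lagrange equation. Moreover, $\mathcal{M}_{l+1}(v_l,w_l)$ is an ordered set, every element of it is a solution of the Euler–Lagrange equation, and every $U\in\mathcal{M}_{l+1}(v_l,w_l)$ is strictly $1$-monotone in $\mathbf{i}_1,\dots,\mathbf{i}_{l+1}$, i.e. $U<\tau^k_{-1}U$ for $1\le k\le l+1$.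
   Context: Fix integers $n\ge 2$, $r\ge 1$. For $\mathbf{i}\in\mathbb{Z}^n$ let $\|\mathbf{i}\|=\sum_k|\mathbf{i}_k|$, and $B_{\mathbf 0}^r=\{\mathbf{k}\in\mathbb{Z}^n:\|\mathbf{k}\|\le r\}$; $\mathbf{e}_1,\dots,\mathbf{e}_n$ are the standard unit vectors. A function $s\in C^2(\mathbb{R}^{B_{\mathbf 0}^r},\mathbb{R})$ is called admissible if: (S1) $s(u+1_{B_{\mathbf 0}^r})=s(u)$, with $1_{B_{\mathbf 0}^r}$ the constant function $1$; (S2) $s$ is bounded from below and $s(u)\to\infty$ as $|u(\mathbf{k})-u(\mathbf{j})|\to\infty$, for $\mathbf{k},\mathbf{j}\in B_{\mathbf 0}^r$ with $\|\mathbf{k}-\mathbf{j}\|=1$; (S3) $\partial_{\mathbf{k},\mathbf{j}}s\le 0$ for $\mathbf{k}\ne\mathbf{j}$ in $B_{\mathbf 0}^r$, and $\partial_{\mathbf{0},\mathbf{j}}s<0$ for $\|\mathbf{j}\|=1$. A configuration is a function $u:\mathbb{Z}^n\to\mathbb{R}$. Shifts: $(\tau^j_{-k}u)(\mathbf{i})=u(\mathbf{i}+k\mathbf{e}_j)$ for $k\in\mathbb{Z}$. Local potentials: $S_{\mathbf{j}}(u)=s\big((\tau^n_{-\mathbf{j}_n}\cdots\tau^1_{-\mathbf{j}_1}u)|_{B_{\mathbf 0}^r}\big)$. A solution of the Euler–Lagrange equation is a configuration $u$ with $\sum_{\mathbf{j}:\|\mathbf{j}-\mathbf{i}\|\le r}\partial_{\mathbf{i}}S_{\mathbf{j}}(u)=0$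 for all $\mathbf{i}\in\mathbb{Z}^n$, where $\partial_{\mathbf i}$ is the partial derivative with respect to $u(\mathbf i)$. Orders: $u\le v$ (resp. $u<v$) means $u(\mathbf{i})\le v(\mathbf{i})$ (resp. $u(\mathbf{i})<v(\mathbf{i})$) for all $\mathbf{i}$. A set of configurations is ordered if any two members $u,v$ satisfy $u<v$, $u=v$ or $u>v$. Members $v<w$ of a set $A$ of configurations are adjacent in $A$ if there is no $u\in A$ with $v\le u\le w$, $u\neq v$, $u\ne w$. For $E\subset\mathbb{Z}^n$, $\|u\|_E=\sum_{\mathbf{j}\in E}|u(\mathbf{j})|$. $\Gamma_0$ is the set of configurations with $u(\mathbf{i}+\mathbf{e}_k)=u(\mathbf{i})$ for all $1\le k\le n$ (i.e. constants), $J_0(u)=S_{\mathbf{0}}(u)$, $c_0=\inf_{\Gamma_0}J_0$, $\mathcal{M}_0=\{u\in\Gamma_0:J_0(u)=c_0\}$. Inductively for $m=1,\dots,n$: write $\mathcal{M}_{m-1}$ for $\mathcal{M}_0$ if $m=1$, and for $\mathcal{M}_{m-1}(v_{m-2},w_{m-2})$ if $m\ge2$ (where $v_{m-2}<w_{m-2}$ is the chosen adjacent pair at the previous level), and $c_{m-1}$ for the corresponding infimum. For $v<w$ in $\mathcal{M}_{m-1}$ let $\hat\Gamma_m(v,w)$ be the set of configurations $u$ with $v\le u\le w$ and $u(\mathbf{i}+\mathbf{e}_k)=u(\mathbf{i})$ for $m+1\le k\le n$. Put $E^m_i=\mathbb{Z}^{m-1}\times\{i\}\times\{0\}^{n-m}$.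 The functional $J_{m-1}$ is extended to $u\in\hat\Gamma_m(v,w)$ by the (absolutely convergent) formula $$J_{m-1}(u)=c_{m-1}+\sum_{\mathbf{j}\in E^m_0}[S_{\mathbf{j}}(u)-S_{\mathbf{j}}(v)]$$ (for $m=1$ this is just $J_0(u)=S_{\mathbf 0}(u)$). Then set $J_{m,i}(u)=J_{m-1}(\tau^m_{-i}u)-c_{m-1}$, $J_{m;p,q}(u)=\sum_{i=p}^qJ_{m,i}(u)$, $J_m(u)=\liminf_{p\to-\infty,\,q\to\infty}J_{m;p,q}(u)$, $$\Gamma_m(v,w)=\{u\in\hat\Gamma_m(v,w):\|u-v\|_{E^m_i}\to0\ (i\to-\infty),\ \|u-w\|_{E^m_i}\to0\ (i\to\infty)\},$$ $c_m=c_m(v_{m-1},w_{m-1})=\inf_{\Gamma_m(v_{m-1},w_{m-1})}J_m$, and $\mathcal{M}_m(v_{m-1},w_{m-1})=\{u\in\Gamma_m(v_{m-1},w_{m-1}):J_m(u)=c_m\}$. *)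

(* Defs.v *)
From mathcomp Require Export all_boot all_order all_algebra.
From mathcomp Require Export all_classical all_reals all_analysis.

Set Implicit Arguments.
Unset Strict Implicit.
Unset Printing Implicit Defensive.

Import Order.TTheory GRing.Theory Num.Theory.
Import numFieldNormedType.Exports.

Local Open Scope classical_set_scope.
Local Open Scope ring_scope.

Notation lattice n := 'rV[int]_n.

Notation config R n := (lattice n -> R) (only parsing).

Definition l1norm (n : nat) (i : lattice n) : nat :=
  (\sum_(k < n) `|i ord0 k|)%N.

(* The coordinates of Z^n are numbered from 1 to n, so that coordinate number k
   of i is [i ord0 j] for the [j : 'I_n] with j.+1 = k. *)
Definition unit_vec (n k : nat) : lattice n :=
  \row_(j < n) (j.+1 == k)%:R.
Arguments unit_vec : clear implicits.

Definition ball0 (n r : nat) : Type :=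
  {k : lattice n | (l1norm k <= r)%N}.

(* Partial derivative with respect to the variable u(k), for functions on R^T;
   T is either the finite set ball0 n r or the whole lattice. *)
Definition set_coord (R : realType) (T : eqType) (u : T -> R) (k : T) (t : R) :
  T -> R := fun j => if j == k then t else u j.

Definition partial (R : realType) (T : eqType) (k : T) (F : (T -> R) -> R)
  (u : T -> R) : R := derive1 (fun t : R => F (set_coord u k t)) (u k).

Definition has_partial (R : realType) (T : eqType) (k : T)
  (F : (T -> R) -> R) (u : T -> R) : Prop :=
  derivable (fun t : R => F (set_coord u k t)) (u k) 1.

(* Continuity is for the product topology, the Euclidean one as ball0 n r is
   finite. *)
Definition C0 (R : realType) (n r : nat) (F : (ball0 n r -> R) -> R) : Prop :=
  continuous (F : {ptws ball0 n r -> R} -> R).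

Definition C1 (R : realType) (n r : nat) (F : (ball0 n r -> R) -> R) : Prop :=
  C0 F /\ forall k : ball0 n r, (forall u, has_partial k F u) /\ C0 (partial k F).

Definition C2 (R : realType) (n r : nat) (F : (ball0 n r -> R) -> R) : Prop :=
  C1 F /\ forall k : ball0 n r, C1 (partial k F).

Record admissible (R : realType) (n r : nat) (s : (ball0 n r -> R) -> R) :
  Prop := Admissible {
  admissible_C2 : C2 s;
  admissible_S1 : forall u, s (fun k => u k + 1) = s u;
  admissible_S2_bounded : exists b : R, forall u, b <= s u;
  admissible_S2_coercive : forall k j : ball0 n r,
    l1norm (val k - val j) = 1%N ->
    forall A : R, exists D : R, forall u, D < `|u k - u j| -> A < s u;
  admissible_S3_le0 : forall (k j : ball0 n r) u, k != j ->
    partial k (partial j s) u <= 0;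
  admissible_S3_lt0 : forall (k j : ball0 n r) u, val k = 0 ->
    l1norm (val j) = 1%N -> partial k (partial j s) u < 0
}.

(* [translate j u] is tau^n_{-j_n} ... tau^1_{-j_1} u; in particular tau^m_{-i} u is
   [translate (i *: unit_vec n m) u], for i : int. *)
Definition translate (R : realType) (n : nat) (j : lattice n) (u : config R n) :
  config R n := fun i => u (i + j).

Definition tauN (R : realType) (n m : nat) (i : int) (u : config R n) :
  config R n := translate (i *: unit_vec n m) u.

Definition local_potential (R : realType) (n r : nat)
  (s : (ball0 n r -> R) -> R) (j : lattice n) (u : config R n) : R :=
  s (fun k => translate j u (val k)).

Definition euler_lagrange (R : realType) (n r : nat)
  (s : (ball0 n r -> R) -> R) (u : config R n) : Prop :=
  forall i : lattice n,
    \sum_(j \in [set j : lattice n | (l1norm (j - i) <= r)%N])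
       partial i (local_potential s j) u = 0.

Definition cle (R : realType) (n : nat) (u v : config R n) : Prop :=
  forall i, u i <= v i.

Definition clt (R : realType) (n : nat) (u v : config R n) : Prop :=
  forall i, u i < v i.

Definition ordered (R : realType) (n : nat) (A : set (config R n)) : Prop :=
  forall u v, A u -> A v -> [\/ clt u v, u = v | clt v u].

Definition adjacent (R : realType) (n : nat) (A : set (config R n))
  (v w : config R n) : Prop :=
  [/\ A v, A w, clt v w &
      ~ exists u, [/\ A u, cle v u, cle u w, u <> v & u <> w]].

(* E^m_i = Z^{m-1} x {i} x {0}^{n-m} *)
Definition slice (n m : nat) (i : int) : set (lattice n) :=
  [set j : lattice n | forall k : 'I_n,
     (k.+1 = m -> j ord0 k = i) /\ ((m < k.+1)%N -> j ord0 k = 0)].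

Definition l1norm_on (R : realType) (n : nat) (E : set (lattice n))
  (u : config R n) : \bar R := (\esum_(j in E) `|u j|%:E)%E.

(* Sum of an absolutely summable real family. *)
Definition asum (R : realType) (n : nat) (E : set (lattice n))
  (f : lattice n -> R) : \bar R :=
  (\esum_(j in E) (f^\+ j)%:E - \esum_(j in E) (f^\- j)%:E)%E.

Section Functionals.
Context (R : realType) (n r : nat) (s : (ball0 n r -> R) -> R).

Definition Gamma0 : set (config R n) :=
  [set u | forall k, (1 <= k <= n)%N -> forall i, u (i + unit_vec n k) = u i].

Definition J0 (u : config R n) : \bar R := (local_potential s 0 u)%:E.

Definition c0 : \bar R := ereal_inf [set J0 u | u in Gamma0].

Definition M0 : set (config R n) := [set u | Gamma0 u /\ J0 u = c0].

Definition GammaHat (m : nat) (v w : config R n) : set (config R n) :=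
  [set u | [/\ cle v u, cle u w &
     forall k, (m + 1 <= k <= n)%N -> forall i, u (i + unit_vec n k) = u i]].

Definition Gamma (m : nat) (v w : config R n) : set (config R n) :=
  [set u | [/\ GammaHat m v w u,
     (fun i : nat => l1norm_on (slice m (- i%:Z)) (fun j => u j - v j)) @ \oo
       --> 0%E &
     (fun i : nat => l1norm_on (slice m i%:Z) (fun j => u j - w j)) @ \oo
       --> 0%E]].

(* In the next four definitions, m >= 1 is the level, c is c_{m-1} and v is the
   lower member v_{m-1} of the pair chosen in M_{m-1}. *)

(* The extension of J_{m-1} to GammaHat m v w. *)
Definition Jext (m : nat) (c : \bar R) (v u : config R n) : \bar R :=
  (c + asum (slice m 0)
         (fun j => (local_potential s j u - local_potential s j v)%R))%E.

(* J_{m,i} *)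
Definition Jslice (m : nat) (c : \bar R) (v : config R n) (i : int)
  (u : config R n) : \bar R := (Jext m c v (tauN m i u) - c)%E.

(* J_{m;p,q}, for p <= q *)
Definition Jpartial (m : nat) (c : \bar R) (v : config R n) (p q : int)
  (u : config R n) : \bar R :=
  (\sum_(0 <= k < (absz (q - p)%R).+1) Jslice m c v (p + k%:Z)%R u)%E.

(* p = - a.1 and q = a.2 tend independently to -oo and +oo. *)
Definition J (m : nat) (c : \bar R) (v u : config R n) : \bar R :=
  limf_einf (fun a : nat * nat => Jpartial m c v (- a.1%:Z) a.2%:Z u)
    (filter_prod \oo \oo).

(* (v i, w i) is the pair chosen at level i; [c_ v w m] and [M v w m] only
   depend on the pairs of level < m. *)
Fixpoint c_ (v w : nat -> config R n) (m : nat) : \bar R :=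
  if m is m'.+1 then
    ereal_inf [set J m (c_ v w m') (v m') u | u in Gamma m (v m') (w m')]
  else c0.

Definition M (v w : nat -> config R n) (m : nat) : set (config R n) :=
  if m is m'.+1 then
    [set u | Gamma m (v m') (w m') u /\
             J m (c_ v w m') (v m') u = c_ v w m]
  else M0.

End Functionals.

(* Main.v *)
Require Import Defs.
From mathcomp Require Import zify lra.
Set Implicit Arguments.
Unset Strict Implicit.
Unset Printing Implicit Defensive.

Import Order.TTheory GRing.Theory Num.Theory.
Import numFieldNormedType.Exports.

Local Open Scope classical_set_scope.
Local Open Scope ring_scope.

(** The proof treats the levels one after the other, and each level as a variational problem on
the line.

Fix a level m = p + 1, and let v < w be the pair chosen at level p. What matters about the
pair is collected in [good_pair]: v and w depend on the first p coordinates only and solve the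
Euler-Lagrange equation, w - v is summable over the slice E^m_0, and a configuration between v
and w that depends on the first p coordinates has nonnegative energy relative to v, with
equality only for v and w. A configuration u between v and w that depends on m coordinates is
a sequence of slices, indexed by coordinate m. Slice a has the energy J_{m,a}(u), called
[energy a u], and J_m(u) is the lower limit of the energies of growing windows of slices.
Since w - v is summable, all sums converge absolutely, and energies are Lipschitz for the l1
distance of slices and continuous for pointwise convergence.

Lower bounds. The mixed second derivatives of s are nonpositive, hence s is submodular, so
that sorting finitely many configurations pointwise does not increase the sum of their
energies ([order_stats_energy]). Sorting the shifts of a configuration that is periodic in
direction m gives configurations that are constant in direction m, and these have nonnegative
energy; so a full period has nonnegative energy ([periodic_energy_ge0]). Closing up a window
periodically, one sees that its energy is negative at most by a multiple of the distance of
its ends from v, or from w ([window_lower_bound]). Hence J_m is bounded below, and on Gamma_m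
the lower limit is a limit ([central_almost_nondecreasing]).

Order. The maximum and the minimum of two minimisers are minimisers ([minimiser_max_min]).
Minimisers solve the Euler-Lagrange equation: where one of them touches v or w only one-sided
variations are allowed, and the missing inequality comes from comparison with the solutions v
and w ([grad_minimiser]). Two solutions u <= u' that touch at a point coincide
([strong_comparison]). Together this shows that minimisers are ordered, and with the
asymptotic conditions that they increase strictly in direction m ([minimiser_shift]).

Existence. An almost minimal configuration may be cut off to be equal to v far to the left and
to w far to the right. The order statistics of sufficiently many of its shifts are monotone in
direction m, and one of them has at most the same energy ([monotone_rearrangement]). After a
translation that fixes where a level between v and w is crossed, a sequence of such
configurations has a pointwise limit. The limit is monotone and its windows have bounded
energy; hence its limits in direction m have energy zero, and are v and w ([monotone_Gamma]).
The lower bounds for tails show that no energy is lost in the limit ([minimiser_exists]).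

Next level. Let v' < w' be adjacent minimisers. The shift of v' is a minimiser above v', so it
is above w', and the sum of w' - v' over E^{m+1}_0 telescopes to at most the sum of w - v over
E^m_0 ([gap_summable]). For u between v' and w', J_m(u) exceeds the minimum by the energy of u
relative to v' over E^{m+1}_0 ([gap_energy]). So the pair (v', w') is good at the next level
([next_good_pair]). *)

(** * Limits of real functions *)

Lemma cvg_sumr (R : realType) (I J : Type) (G : set_system J) (FG : Filter G)
    (r : seq I) (P : pred I) (F : J -> I -> R) (f : I -> R) :
  (forall i, P i -> F j i @[j --> G] --> f i) ->
  \sum_(i <- r | P i) F j i @[j --> G] --> \sum_(i <- r | P i) f i.
Proof.
move=> Ff; elim: r => [|i r IH].
  by rewrite big_nil; under eq_fun do rewrite big_nil; exact: cvg_cst.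
rewrite big_cons; under eq_fun do rewrite big_cons.
by case: ifPn => Pi //; apply: cvgD => //; exact: Ff.
Qed.

Section Limits.
Context {R : realType}.

Lemma limit_le (I : Type) (G : set_system I) (FG : ProperFilter G) (f : I -> R) (l B : R) :
  f x @[x --> G] --> l -> (\forall x \near G, f x <= B) -> l <= B.
Proof.
move=> fl fB; rewrite leNgt; apply/negP => Bl.
have : \forall x \near G, B < f x by move/cvgr_gt : fl; apply.
by move=> /(filterI fB)/filter_ex[x [/le_lt_trans h /h]]; rewrite ltxx.
Qed.

Lemma limit_ge (I : Type) (G : set_system I) (FG : ProperFilter G) (f : I -> R) (l B : R) :
  f x @[x --> G] --> l -> (\forall x \near G, B <= f x) -> B <= l.
Proof.
move=> fl fB; rewrite leNgt; apply/negP => Bl.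
have : \forall x \near G, f x < B by move/cvgr_lt : fl; apply.
by move=> /(filterI fB)/filter_ex[x [/le_lt_trans h /h]]; rewrite ltxx.
Qed.

Lemma limit_eq (I : Type) (G : set_system I) (FG : ProperFilter G) (f : I -> R) (l l' : R) :
  f x @[x --> G] --> l -> f x @[x --> G] --> l' -> l = l'.
Proof. by move=> h h'; apply: (cvg_unique (norm_hausdorff (V := R)) h h'). Qed.

(** For difference quotients, this turns one-sided information on increments into the sign of a
derivative. *)
Lemma dnbhs0_sign (f : R -> R) (l d : R) : 0 < d -> f t @[t --> 0^'] --> l ->
  ((forall t, 0 < t -> t < d -> 0 <= f t) -> 0 <= l) /\
  ((forall t, t < 0 -> - d < t -> f t <= 0) -> l <= 0).
Proof.
move=> d0 fl; split=> H; rewrite leNgt; apply/negP => l0.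
  have : \forall t \near (0 : R)^', f t < 0 by move/cvgr_lt : fl; apply.
  rewrite /dnbhs /within/= => /nbhs_ballP[e e0 he].
  pose t := Num.min d e / 2.
  have t0 : 0 < t by rewrite divr_gt0// lt_min d0.
  have te : t < Num.min d e by rewrite ltr_pdivrMr// ltr_pMr ?ltr1n// lt_min d0.
  have : f t < 0.
    apply: he; last by rewrite gt_eqF.
    by rewrite /ball/= sub0r normrN gtr0_norm// (lt_le_trans te)// ge_min lexx orbT.
  by rewrite ltNge H// (lt_le_trans te)// ge_min lexx.
have : \forall t \near (0 : R)^', 0 < f t by move/cvgr_gt : fl; apply.
rewrite /dnbhs /within/= => /nbhs_ballP[e e0 he].
pose t := Num.min d e / 2.
have t0 : 0 < t by rewrite divr_gt0// lt_min d0.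
have te : t < Num.min d e by rewrite ltr_pdivrMr// ltr_pMr ?ltr1n// lt_min d0.
have : 0 < f (- t).
  apply: he; last by rewrite oppr_eq0 gt_eqF.
  by rewrite /ball/= sub0r opprK gtr0_norm// (lt_le_trans te)// ge_min lexx orbT.
by rewrite ltNge H ?oppr_lt0// ltrN2 (lt_le_trans te)// ge_min lexx.
Qed.

(** If the limit were positive, the sums of consecutive terms would be unbounded. *)
Lemma zero_energy_limit (f : nat -> R) (g : R) (K : R) :
  f k @[k --> \oo] --> g -> 0 <= g ->
  (forall N M : nat, exists2 S, S <= K & S = \sum_(k < M) f (N + k)%N) -> g = 0.
Proof.
move=> fg g0 H; apply/eqP; rewrite eq_le g0 andbT leNgt; apply/negP => gpos.
have g2 : 0 < g / 2 by rewrite divr_gt0.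
have [N _ HN] : \forall k \near \oo, g / 2 < f k.
  by move/cvgr_gt : fg; apply; rewrite ltr_pdivrMr// ltr_pMr// ltr1n.
pose M := (Num.truncn (K / (g / 2))).+1.
have [T TK ET] := H N M.
have : (g / 2) *+ M <= T.
  rewrite ET -[X in _ *+ X]card_ord -sumr_const; apply: ler_sum => k _.
  by apply: ltW; apply: HN => /=; rewrite leq_addr.
have : K < (g / 2) *+ M by rewrite -mulr_natr mulrC -ltr_pdivrMr// truncnS_gt.
by move=> h1 h2; have := lt_le_trans h1 (le_trans h2 TK); rewrite ltxx.
Qed.

Lemma cvg_EFin0 (f : nat -> R) : (forall i : nat, 0 <= f i) ->
  ((fun i : nat => (f i)%:E) @ \oo --> 0%E) <->
  (forall e, 0 < e -> exists N : nat, forall i : nat, (N <= i)%N -> f i <= e).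
Proof.
move=> f0; split=> [h e e0|h].
  have /cvgrPdist_le/(_ e e0)[N _ HN] : f i @[i --> \oo] --> 0.
    by move/fine_cvgP : h => [].
  by exists N => i Ni; have := HN i Ni; rewrite sub0r normrN ger0_norm.
apply: cvg_EFin; first exact: nearW.
apply/cvgrPdist_le => e /h[N HN]; exists N => // i /= Ni.
by rewrite sub0r normrN ger0_norm// HN.
Qed.

Lemma small_factor (C e : R) : 0 <= C -> 0 < e -> exists2 e1, 0 < e1 & C * e1 <= e.
Proof.
move=> C0 e0; have Cpos : 0 < C + 1 by rewrite ltr_wpDl.
exists (e / (C + 1)); first by rewrite divr_gt0.
by rewrite mulrCA ler_piMr ?(ltW e0)// ler_pdivrMr// mul1r lerDl.
Qed.

End Limits.

(** * Absolutely summable families *)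

Section Rsum.
Context {R : realType} {T : choiceType}.
Implicit Types (E F : set T) (f g h : T -> R).

Definition abs_summable E f : Prop := (\esum_(j in E) `|f j|%:E < +oo)%E.

(** The real number behind [asum], see [asum_rsum]. *)
Definition rsum E f : R :=
  fine (\esum_(j in E) (f^\+ j)%:E - \esum_(j in E) (f^\- j)%:E)%E.

Lemma abs_summable_le E f g : (forall j, E j -> `|f j| <= g j) ->
  abs_summable E g -> abs_summable E f.
Proof.
move=> fg; apply: le_lt_trans; apply: le_esum => j /fg fj.
by rewrite lee_fin (le_trans fj)// ler_norm.
Qed.

Lemma abs_summableD E f g : abs_summable E f -> abs_summable E g ->
  abs_summable E (fun j => f j + g j).
Proof.
move=> sf sg; apply: le_lt_trans (lte_add_pinfty sf sg).
rewrite -esumD; [|by move=> *; rewrite lee_fin..].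
by apply: le_esum => j _; rewrite -EFinD lee_fin ler_normD.
Qed.

Lemma abs_summableN E f : abs_summable E f -> abs_summable E (fun j => - f j).
Proof.
by apply: le_lt_trans; apply: le_esum => j _; rewrite normrN.
Qed.

Lemma abs_summable_norm E f : abs_summable E f -> abs_summable E (fun j => `|f j|).
Proof. by apply: le_lt_trans; apply: le_esum => j _; rewrite normr_id. Qed.

Lemma abs_summable0 E : abs_summable E (fun=> 0).
Proof. by rewrite /abs_summable esum1 ?ltry// => j _; rewrite normr0. Qed.

Lemma abs_summable_sum (I : Type) (r : seq I) (P : pred I) E (F : I -> T -> R) :
  (forall i, P i -> abs_summable E (F i)) ->
  abs_summable E (fun j => \sum_(i <- r | P i) F i j).
Proof.
move=> sF; elim: r => [|i r IH].
  by apply: abs_summable_le (abs_summable0 E) => j _; rewrite big_nil normr0.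
case: (boolP (P i)) => Pi.
  apply: abs_summable_le (abs_summable_norm (abs_summableD (sF _ Pi) IH)) => j _.
  by rewrite big_cons Pi.
apply: abs_summable_le (abs_summable_norm IH) => j _.
by rewrite big_cons (negbTE Pi).
Qed.

Lemma abs_summableZ E f (c : R) : abs_summable E f -> abs_summable E (fun j => c * f j).
Proof.
have H (n : nat) : abs_summable E f -> abs_summable E (fun j => n%:R * f j).
  move=> sf; apply: abs_summable_le (abs_summable_norm
    (@abs_summable_sum _ (iota 0 n) predT E (fun _ => f) (fun _ _ => sf))) => j _.
  by rewrite big_const_seq count_predT size_iota iter_addr_0 mulr_natl.
move=> sf; have [k kc] : exists k : nat, `|c| <= k%:R.
  by exists (Num.truncn `|c|).+1; rewrite ltW// truncnS_gt.
apply: abs_summable_le (abs_summable_norm (H k sf)) => j _.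
by rewrite !normrM ler_wpM2r// (le_trans kc)// ler_norm.
Qed.

Lemma abs_summable_sub E F f : E `<=` F -> abs_summable F f -> abs_summable E f.
Proof.
move=> EF; apply: le_lt_trans; rewrite ge_ereal_sup// => _ [X [fX XE] <-].
by apply: ereal_sup_ubound; exists X => //; split=> //; exact: subset_trans EF.
Qed.

Lemma eq_rsum E f g : (forall j, E j -> f j = g j) -> rsum E f = rsum E g.
Proof.
move=> fg; rewrite /rsum; congr (fine (_ - _)%E);
  by apply: eq_esum => j Ej; rewrite /funrpos /funrneg fg.
Qed.

Lemma esum_fin_num E f : (forall j, E j -> 0 <= f j) -> abs_summable E f ->
  (\esum_(j in E) (f j)%:E)%E \is a fin_num.
Proof.
move=> f0 sf; rewrite ge0_fin_numE; last by apply: esum_ge0 => j /f0.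
by apply: le_lt_trans sf; apply: le_esum => j _; rewrite lee_fin ler_norm.
Qed.

Lemma ge0_rsumE E f : (forall j, E j -> 0 <= f j) ->
  rsum E f = fine (\esum_(j in E) (f j)%:E)%E.
Proof.
move=> f0; rewrite /rsum [X in (_ - X)%E]esum1; last first.
  by move=> j Ej; rewrite /funrneg max_r// oppr_le0 f0.
by rewrite sube0; congr fine; apply: eq_esum => j Ej; rewrite /funrpos max_l// f0.
Qed.

Lemma rsum_diff E f g h : (forall j, E j -> f j = g j - h j) ->
  (forall j, E j -> 0 <= g j) -> (forall j, E j -> 0 <= h j) ->
  abs_summable E g -> abs_summable E h -> rsum E f = rsum E g - rsum E h.
Proof.
move=> fE g0 h0 sg sh; rewrite (ge0_rsumE g0) (ge0_rsumE h0) -fineB ?esum_fin_num//.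
have sg' : summable E (EFin \o g) by apply: le_lt_trans sg; apply: le_esum => j _.
have sh' : summable E (EFin \o h) by apply: le_lt_trans sh; apply: le_esum => j _.
rewrite -(esumB sg' sh')//.
rewrite /rsum; congr (fine (_ - _)%E); apply: eq_esum => j Ej.
  by rewrite /funrpos fE// funeposE /= EFin_max.
by rewrite /funrneg fE// funenegE /= EFin_max.
Qed.

Lemma abs_summable_funrpos E f : abs_summable E f -> abs_summable E (f^\+).
Proof.
apply: le_lt_trans; apply: le_esum => j _; rewrite lee_fin ger0_norm//.
by rewrite /funrpos ge_max ler_norm normr_ge0.
Qed.

Lemma abs_summable_funrneg E f : abs_summable E f -> abs_summable E (f^\-).
Proof.
apply: le_lt_trans; apply: le_esum => j _; rewrite lee_fin ger0_norm ?funrneg_ge0//.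
by rewrite /funrneg ge_max -{1}normrN ler_norm normr_ge0.
Qed.

Lemma funrposnegE f j : f j = f^\+ j - f^\- j.
Proof. by rewrite -[in LHS](funrposBneg f). Qed.

Lemma rsum_posneg E f : abs_summable E f -> rsum E f = rsum E f^\+ - rsum E f^\-.
Proof.
move=> sf; apply: rsum_diff.
- by move=> j _; exact: funrposnegE.
- by [].
- by move=> j _; rewrite funrneg_ge0.
- exact: abs_summable_funrpos.
- exact: abs_summable_funrneg.
Qed.

Lemma ge0_rsumD E f g : (forall j, E j -> 0 <= f j) -> (forall j, E j -> 0 <= g j) ->
  abs_summable E f -> abs_summable E g ->
  rsum E (fun j => f j + g j) = rsum E f + rsum E g.
Proof.
move=> f0 g0 sf sg; rewrite !ge0_rsumE//; last first.
  by move=> j Ej; rewrite addr_ge0 ?f0 ?g0.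
rewrite -fineD ?esum_fin_num// -esumD//.
Qed.

Lemma rsumD E f g : abs_summable E f -> abs_summable E g ->
  rsum E (fun j => f j + g j) = rsum E f + rsum E g.
Proof.
move=> sf sg.
have [sfp sfn] := (abs_summable_funrpos sf, abs_summable_funrneg sf).
have [sgp sgn] := (abs_summable_funrpos sg, abs_summable_funrneg sg).
have n0 (k : T -> R) j : E j -> 0 <= k^\- j by rewrite funrneg_ge0.
rewrite (@rsum_diff E _ (fun j => f^\+ j + g^\+ j) (fun j => f^\- j + g^\- j)).
- rewrite !ge0_rsumD//; try exact: n0.
  by rewrite (rsum_posneg sf) (rsum_posneg sg) opprD addrACA.
- by move=> j _; rewrite {1}funrposnegE [g j]funrposnegE opprD addrACA.
- by move=> j _; rewrite addr_ge0.
- by move=> j _; rewrite addr_ge0// funrneg_ge0.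
- exact: abs_summableD.
- exact: abs_summableD.
Qed.

Lemma rsumN E f : rsum E (fun j => - f j) = - rsum E f.
Proof.
have e1 : (fun j => - f j)^\+ = f^\- by [].
have e2 : (fun j => - f j)^\- = f^\+.
  by apply/funext => j; rewrite /funrneg /funrpos opprK.
rewrite /rsum e1 e2.
set a := (\esum_(j in E) (f^\+ j)%:E)%E; set b := (\esum_(j in E) (f^\- j)%:E)%E.
have : (0 <= a)%E by apply: esum_ge0 => j _; rewrite lee_fin.
have : (0 <= b)%E by apply: esum_ge0 => j _; rewrite lee_fin funrneg_ge0.
by case: a => [a| |]; case: b => [b| |] //= _ _; rewrite ?oppr0// opprB.
Qed.

Lemma rsumB E f g : abs_summable E f -> abs_summable E g ->
  rsum E (fun j => f j - g j) = rsum E f - rsum E g.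
Proof. by move=> sf sg; rewrite (rsumD sf (abs_summableN sg)) rsumN. Qed.

Lemma rsum0 E f : (forall j, E j -> f j = 0) -> rsum E f = 0.
Proof.
move=> f0; rewrite ge0_rsumE; last by move=> j /f0 ->.
by rewrite esum1// => j /f0 ->.
Qed.

Lemma rsum_sum (I : Type) (r : seq I) E (F : I -> T -> R) :
  (forall i, abs_summable E (F i)) ->
  rsum E (fun j => \sum_(i <- r) F i j) = \sum_(i <- r) rsum E (F i).
Proof.
move=> sF; elim: r => [|i r IH].
  by rewrite big_nil rsum0// => j _; rewrite big_nil.
rewrite big_cons -IH -rsumD//; last by apply: abs_summable_sum.
by apply: eq_rsum => j _; rewrite big_cons.
Qed.

Lemma rsum_ge0 E f : (forall j, E j -> 0 <= f j) -> 0 <= rsum E f.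
Proof. by move=> f0; rewrite ge0_rsumE// fine_ge0// esum_ge0. Qed.

Lemma le_rsum E f g : abs_summable E f -> abs_summable E g ->
  (forall j, E j -> f j <= g j) -> rsum E f <= rsum E g.
Proof.
move=> sf sg fg; rewrite -subr_ge0 -rsumB//; apply: rsum_ge0 => j Ej.
by rewrite subr_ge0 fg.
Qed.

Lemma ler_norm_rsum E f : abs_summable E f -> `|rsum E f| <= rsum E (fun j => `|f j|).
Proof.
move=> sf; have sn := abs_summable_norm sf; rewrite ler_norml -rsumN; apply/andP; split.
  by apply: le_rsum => // [|j _]; [exact: abs_summableN|rewrite lerNl -normrN ler_norm].
by apply: le_rsum => // j _; exact: ler_norm.
Qed.

Lemma abs_summable_fset E f : finite_set E -> abs_summable E f.
Proof.
move=> fE; by rewrite /abs_summable esum_fset// fsbig_finite//= sumEFin ltry.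
Qed.

Lemma rsumID E F f : abs_summable E f ->
  rsum E f = rsum (E `&` F) f + rsum (E `&` ~` F) f.
Proof.
move=> sf.
have s1 := abs_summable_sub (@subIsetl _ E F) sf.
have s2 := abs_summable_sub (@subIsetl _ E (~` F)) sf.
have pos g : (forall j, 0 <= g j) -> abs_summable E g ->
   rsum E g = rsum (E `&` F) g + rsum (E `&` ~` F) g.
  move=> g0 sg; rewrite !ge0_rsumE//.
  rewrite (esumID F); last by move=> j _; rewrite lee_fin.
  by rewrite fineD//; apply: esum_fin_num => //; apply: abs_summable_sub sg; exact: subIsetl.
rewrite (rsum_posneg sf) (rsum_posneg s1) (rsum_posneg s2).
rewrite (pos _ _ (abs_summable_funrpos sf)) ?(pos f^\- _ (abs_summable_funrneg sf))//.
by rewrite opprD addrACA.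
Qed.

Lemma abs_summableU E F f : abs_summable E f -> abs_summable F f ->
  abs_summable (E `|` F) f.
Proof.
move=> sE sF; rewrite /abs_summable (esumID E)//.
apply: lte_add_pinfty.
  by apply: abs_summable_sub sE => j [].
by apply: abs_summable_sub sF => j [[]].
Qed.

Lemma rsum_sub E F f : F `<=` E -> (forall j, E j -> ~ F j -> f j = 0) ->
  rsum E f = rsum F f.
Proof.
move=> FE f0; rewrite /rsum; congr (fine (_ - _)%E).
  rewrite (esumID F); last by move=> j _; rewrite lee_fin.
  rewrite (setIidr FE) [X in (_ + X)%E]esum1 ?adde0// => j [Ej nF].
  by rewrite /funrpos f0// maxxx.
rewrite (esumID F); last by move=> j _; rewrite lee_fin funrneg_ge0.
rewrite (setIidr FE) [X in (_ + X)%E]esum1 ?adde0// => j [Ej nF].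
by rewrite /funrneg f0// oppr0 maxxx.
Qed.

Lemma rsum_le_sub E F f : F `<=` E -> (forall j, E j -> 0 <= f j) ->
  abs_summable E f -> rsum F f <= rsum E f.
Proof.
move=> FE f0 sf; rewrite (rsumID F sf) (setIidr FE) lerDl.
by apply: rsum_ge0 => j [/f0].
Qed.

Lemma rsum_fset (r : seq T) f : uniq r ->
  rsum [set` r] f = \sum_(j <- r) f j.
Proof.
move=> ur.
have pos g : (forall j, 0 <= g j) -> rsum [set` r] g = \sum_(j <- r) g j.
  move=> g0; rewrite ge0_rsumE//.
  rewrite esum_fset//; last by move=> j _; rewrite lee_fin.
  by rewrite -fsbig_seq// sumEFin.
have sA g : abs_summable [set` r] g by apply: abs_summable_fset; exact: finite_seq.
by rewrite rsum_posneg// !pos// -sumrB; apply: eq_bigr => j _; rewrite -funrposnegE.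
Qed.

Lemma esum_le_bound E f (M : R) :
  (forall r : seq T, uniq r -> [set` r] `<=` E -> \sum_(j <- r) f j <= M) ->
  (\esum_(j in E) (f j)%:E <= M%:E)%E.
Proof.
move=> H; apply: ge_ereal_sup => _ [X [fX XE] <-].
rewrite fsbig_finite//= sumEFin lee_fin; apply: H; first exact: finmap.fset_uniq.
by move=> j /= jX; apply: XE; move: jX; rewrite (in_fset_set fX) inE.
Qed.

Lemma sum_le_rsum E f (r : seq T) : (forall j, E j -> 0 <= f j) -> abs_summable E f ->
  uniq r -> [set` r] `<=` E -> \sum_(j <- r) f j <= rsum E f.
Proof. by move=> f0 sf ur rE; rewrite -rsum_fset//; exact: rsum_le_sub. Qed.

Lemma rsum_le_bound E f (M : R) : (forall j, E j -> 0 <= f j) ->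
  (forall r : seq T, uniq r -> [set` r] `<=` E -> \sum_(j <- r) f j <= M) ->
  abs_summable E f /\ rsum E f <= M.
Proof.
move=> f0 /esum_le_bound H; have sf : abs_summable E f.
  apply: le_lt_trans (ltry M); apply: le_trans H; apply: le_esum => j Ej.
  by rewrite ger0_norm ?f0.
by split=> //; rewrite ge0_rsumE// -lee_fin fineK ?esum_fin_num.
Qed.

(** For a nonnegative family and a positive factor, partial sums give one inequality; applied to
the inverse factor it gives the other. *)
Lemma rsumZ E f (c : R) : abs_summable E f -> rsum E (fun j => c * f j) = c * rsum E f.
Proof.
have le_pos a g : 0 <= a -> (forall j, 0 <= g j) -> abs_summable E g ->
    rsum E (fun j => a * g j) <= a * rsum E g.
  move=> a0 g0 sg; apply: (rsum_le_bound _ _).2 => [j _|r ur rE]; first exact: mulr_ge0.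
  by rewrite -mulr_sumr ler_wpM2l//; exact: sum_le_rsum.
have eq_pos a g : 0 <= a -> (forall j, 0 <= g j) -> abs_summable E g ->
    rsum E (fun j => a * g j) = a * rsum E g.
  rewrite le_eqVlt => /orP[/eqP <- _ _|a0 g0 sg].
    by rewrite mul0r rsum0// => j _; rewrite mul0r.
  apply/eqP; rewrite eq_le le_pos ?(ltW a0)//=.
  rewrite -ler_pdivlMl//.
  have := @le_pos a^-1 (fun j => a * g j); rewrite invr_ge0 (ltW a0) => /(_ isT).
  have -> : rsum E (fun j => a^-1 * (a * g j)) = rsum E g.
    by apply: eq_rsum => j _; rewrite mulrA mulVf ?mul1r// gt_eqF.
  by apply=> [j|]; [rewrite mulr_ge0// ltW|exact: abs_summableZ].
have eq_gen a : 0 <= a -> abs_summable E f -> rsum E (fun j => a * f j) = a * rsum E f.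
  move=> a0 sf; have sp := abs_summable_funrpos sf; have sn := abs_summable_funrneg sf.
  rewrite (rsum_posneg sf) mulrBr -!eq_pos// -rsumB; last 2 first.
  - exact: abs_summableZ.
  - exact: abs_summableZ.
  by apply: eq_rsum => j _; rewrite -mulrBr -funrposnegE.
move=> sf; have [c0|c0] := leP 0 c; first exact: eq_gen.
have := @eq_gen (- c); rewrite oppr_ge0 (ltW c0) => /(_ isT sf).
rewrite mulNr => /eqP; rewrite -eqr_oppLR => /eqP <-; rewrite -rsumN.
by apply: eq_rsum => j _; rewrite mulNr opprK.
Qed.

(** Finitely many indices carry the whole sum up to e, whatever index set they are completed
to. *)
Lemma rsum_tail E f (e : R) : abs_summable E f -> 0 < e ->
  exists r : seq T, [/\ uniq r, [set` r] `<=` E &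
    forall F, [set` r] `<=` F -> F `<=` E -> rsum (E `&` ~` F) (fun j => `|f j|) <= e].
Proof.
move=> sf e0; have sn := abs_summable_norm sf.
have fin : (\esum_(j in E) `|f j|%:E)%E \is a fin_num by apply: esum_fin_num.
have [x [X [fX XE] xE] xgt] := ub_ereal_sup_adherent e0 fin.
exists (finmap.enum_fset (fset_set X)).
have XX : [set` finmap.enum_fset (fset_set X)] = X by rewrite -[RHS](fset_setK fX).
rewrite XX; split=> //.
move=> F XF FE; apply: (@le_trans _ _ (rsum (E `&` ~` X) (fun j => `|f j|))).
  apply: rsum_le_sub => //; first by apply: setIS; exact: subsetC.
  by apply: abs_summable_sub sn; exact: subIsetl.
have -> : rsum (E `&` ~` X) (fun j => `|f j|) =
   rsum E (fun j => `|f j|) - rsum X (fun j => `|f j|).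
  by rewrite (rsumID X sn) (setIidr XE) addrAC subrr add0r.
rewrite lerBlDr -lerBlDl -lee_fin.
rewrite -[in leRHS]XX rsum_fset ?finmap.fset_uniq//.
have <- : x = (\sum_(j <- finmap.enum_fset (fset_set X)) `|f j|)%:E.
  by rewrite -xE fsbig_finite//= sumEFin.
by apply: le_trans (ltW xgt); rewrite ge0_rsumE// EFinB fineK.
Qed.

(** Outside a finite set of indices the majorant is small, and on a finite set pointwise
convergence is enough; this works along any filter. *)
Lemma rsum_dominated (I : Type) (G : set_system I) (FG : ProperFilter G)
    E (F : I -> T -> R) f g :
  abs_summable E g -> (forall i j, E j -> `|F i j| <= g j) ->
  (forall j, E j -> `|f j| <= g j) ->
  (forall j, E j -> F i j @[i --> G] --> f j) ->
  rsum E (F i) @[i --> G] --> rsum E f.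
Proof.
move=> sg Fg fg Ff; apply/cvgrPdist_le => e e0.
have e3 : 0 < e / 3 by rewrite divr_gt0.
have [r [ur rE /(_ _ (@subset_refl _ _) rE) tl]] := rsum_tail sg e3.
have sF i : abs_summable E (F i) by apply: abs_summable_le sg; exact: Fg.
have sf : abs_summable E f by apply: abs_summable_le sg; exact: fg.
have cr : \sum_(j <- r) F i j @[i --> G] --> \sum_(j <- r) f j.
  rewrite big_seq; under eq_fun do rewrite big_seq.
  by apply: cvg_sumr => j jr; apply: Ff; exact: rE.
move/cvgrPdist_le : cr => /(_ _ e3); apply: filterS => i di.
rewrite (rsumID [set` r] sf) (rsumID [set` r] (sF i)) !(setIidr rE) !rsum_fset//.
have tb h : (forall j, E j -> `|h j| <= g j) -> abs_summable E h ->
   `|rsum (E `&` ~` [set` r]) h| <= e / 3.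
  move=> hg sh; have sh' := abs_summable_sub (@subIsetl _ E (~` [set` r])) sh.
  have sg' := abs_summable_sub (@subIsetl _ E (~` [set` r])) sg.
  apply: (le_trans (ler_norm_rsum sh')); move: tl; apply: le_trans.
  apply: le_rsum; [exact: abs_summable_norm..|].
  by move=> j [Ej _]; rewrite (le_trans (hg j Ej))// ler_norm.
rewrite opprD addrACA (le_trans (ler_normD _ _))//.
have := tb _ fg sf; have := tb _ (Fg i) (sF i) => a b.
have := ler_normB (rsum (E `&` ~` [set` r]) f) (rsum (E `&` ~` [set` r]) (F i)).
move: a b di; lra.
Qed.

End Rsum.

Lemma rsum_reindex (R : realType) (T T' : choiceType) (P : set T) (Q : set T')
    (e : T -> T') (f : T' -> R) : set_bij P Q e -> rsum Q f = rsum P (f \o e).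
Proof. by move=> b; rewrite /rsum !(reindex_esum _ _ _ _ b). Qed.

Lemma abs_summable_reindex (R : realType) (T T' : choiceType) (P : set T) (Q : set T')
    (e : T -> T') (f : T' -> R) : set_bij P Q e ->
  abs_summable P (f \o e) -> abs_summable Q f.
Proof. by move=> b; rewrite /abs_summable (reindex_esum _ _ _ _ b). Qed.

Lemma asum_rsum (R : realType) (n : nat) (E : set (lattice n)) (f : lattice n -> R) :
  abs_summable E f -> asum E f = (rsum E f)%:E.
Proof.
move=> sf; rewrite /rsum fineK// fin_numB; apply/andP; split; apply: esum_fin_num => //.
- exact: abs_summable_funrpos.
- exact: abs_summable_funrneg.
Qed.

(** * The lattice *)

Section Lattice.
Variable n : nat.
Implicit Types (i j : lattice n).

Lemma unit_vecE (k : 'I_n) : unit_vec n k.+1 = delta_mx 0 k.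
Proof. by apply/rowP => j; rewrite !mxE eqxx eqSS. Qed.

Lemma l1normN (i : lattice n) : l1norm (- i) = l1norm i.
Proof. by apply: eq_bigr => k _; rewrite mxE abszN. Qed.

Lemma l1norm_delta (k : 'I_n) : l1norm (delta_mx 0 k : lattice n) = 1%N.
Proof.
rewrite /l1norm (bigD1 k)//= mxE !eqxx/= big1 ?addn0// => j jk.
by rewrite mxE (negbTE jk) andbF.
Qed.

Lemma lattice_coord_le (i : lattice n) (k : 'I_n) : (`|i ord0 k| <= l1norm i)%N.
Proof. by rewrite /l1norm (bigD1 k)//= leq_addr. Qed.

(** Steps along the coordinates in Q lead from i to all points that agree with i off Q. *)
Lemma lattice_ind (Q : pred 'I_n) (P : lattice n -> Prop) i :
  P i ->
  (forall (k : 'I_n) j, Q k -> P j -> P (j + delta_mx 0 k)) ->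
  (forall (k : 'I_n) j, Q k -> P j -> P (j - delta_mx 0 k)) ->
  forall j, (forall k : 'I_n, ~~ Q k -> j 0 k = i 0 k) -> P j.
Proof.
move=> Pi Pp Pm j ji.
have Pz (k : 'I_n) (c : int) j' : Q k -> P j' -> P (j' + c *: delta_mx 0 k).
  move=> Qk; elim: c j' => [|c IH|c IH] j' Pj'; first by rewrite scale0r addr0.
  - have -> : (c.+1%:Z : int) = c%:Z + 1 by lia.
    by rewrite scalerDl scale1r addrA; apply: Pp => //; exact: IH.
  - have -> : (- c.+1%:Z : int) = - c%:Z - 1 by lia.
    by rewrite scalerBl scale1r addrA; apply: Pm => //; exact: IH.
have -> : j = i + \sum_(k < n) (j - i) 0 k *: delta_mx 0 k.
  by rewrite -row_sum_delta addrC subrK.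
suff H (r : seq 'I_n) z : P z -> P (z + \sum_(k <- r) (j - i) 0 k *: delta_mx 0 k).
  exact: H.
elim: r z => [|k r IH] z Pz'; first by rewrite big_nil addr0.
rewrite big_cons addrA; apply: IH; case: (boolP (Q k)) => Qk; first exact: Pz.
by rewrite !mxE ji// subrr scale0r addr0.
Qed.

End Lattice.

(** * Functions of finitely many variables, one coordinate at a time *)

Section Calculus.
Context {R : realType}.

Lemma mvt_derivable (f : R -> R) (a b : R) : (forall x, derivable f x 1) -> a <= b ->
  exists2 c, a <= c <= b & f b - f a = derive1 f c * (b - a).
Proof.
move=> df ab.
have [c] := @MVT_segment R f (derive1 f) a b ab
  (fun x _ => DeriveDef (df x) (esym (derive1E f x)))
  (derivable_within_continuous (fun x _ => df x)).
by rewrite in_itv/= => cab ->; exists c.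
Qed.

Lemma mvt_between (f : R -> R) (a b : R) : (forall x, derivable f x 1) ->
  exists c, [/\ Num.min a b <= c <= Num.max a b, `|c - a| <= `|b - a| &
    f b - f a = derive1 f c * (b - a)].
Proof.
move=> df; have [ab|/ltW ba] := leP a b.
  have [c /andP[ac cb] ->] := mvt_derivable df ab; exists c; rewrite ac cb; split=> //.
  by rewrite !ger0_norm ?subr_ge0// lerD2r.
have [c /andP[ac cb] e] := mvt_derivable df ba; exists c; rewrite ac cb; split=> //.
  by rewrite !ler0_norm ?subr_le0// lerN2 lerD2r.
by rewrite -opprB e -mulrN opprB.
Qed.

Variable T : eqType.
Implicit Types (x y z u : T -> R) (F : (T -> R) -> R) (k : T).

Lemma set_coordK u k (a b : R) : set_coord (set_coord u k a) k b = set_coord u k b.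
Proof. by apply/funext => j; rewrite /set_coord; case: eqP. Qed.

Lemma set_coord_id u k : set_coord u k (u k) = u.
Proof. by apply/funext => j; rewrite /set_coord; case: eqP => // ->. Qed.

Lemma partial_set_coord F k u c :
  partial k F (set_coord u k c) = derive1 (fun t => F (set_coord u k t)) c.
Proof.
rewrite /partial; under eq_fun do rewrite set_coordK.
by rewrite /set_coord eqxx.
Qed.

Lemma derivable_coord F k u : (forall x, has_partial k F x) ->
  forall t, derivable (fun t => F (set_coord u k t)) t 1.
Proof.
move=> dF t; have := dF (set_coord u k t); rewrite /has_partial.
by under eq_fun do rewrite set_coordK; rewrite /set_coord eqxx.
Qed.

Arguments derivable_coord [F k] u _ _.

Definition mix_coords (ks : seq T) x y : T -> R := fun j => if j \in ks then y j else x j.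

Lemma mix_coords_cons k ks x y : mix_coords (k :: ks) x y = set_coord (mix_coords ks x y) k (y k).
Proof.
by apply/funext => j; rewrite /mix_coords /set_coord in_cons; case: eqP => //= ->.
Qed.

Lemma mix_coords_nil x y : mix_coords [::] x y = x. Proof. exact/funext. Qed.

Lemma mix_coords_all ks x y : (forall k, k \in ks) -> mix_coords ks x y = y.
Proof. by move=> h; apply/funext => j; rewrite /mix_coords h. Qed.

(** Move from x to y one coordinate at a time: coordinate k stays, and no other move
increases F. *)
Lemma le_coords F (ks : seq T) k x y : (forall k, k \in ks) ->
  (forall l u, has_partial l F u) ->
  (forall l u, l != k -> partial l F u <= 0) ->
  (forall j, x j <= y j) -> x k = y k -> F y <= F x.
Proof.
move=> allks dF F0 xy xyk; rewrite -(mix_coords_all x y allks) -[in leRHS](mix_coords_nil x y).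
elim: ks {allks} => [//|l ks IH]; apply: le_trans IH; rewrite mix_coords_cons.
rewrite -[in leRHS](set_coord_id (mix_coords ks x y) l).
have h : mix_coords ks x y l <= y l by rewrite /mix_coords; case: ifP.
have [lk|lk] := eqVneq l k.
  suff -> : mix_coords ks x y l = y l by [].
  by rewrite /mix_coords lk xyk if_same.
have [c _ e] := mvt_derivable (derivable_coord (mix_coords ks x y) (dF l)) h.
rewrite -subr_le0 e -partial_set_coord mulr_le0_ge0 ?F0// subr_ge0//.
Qed.

Lemma lt_coords F (ks : seq T) k l x y : (forall k, k \in ks) ->
  (forall l u, has_partial l F u) ->
  (forall l u, l != k -> partial l F u <= 0) ->
  (forall u, partial l F u < 0) ->
  (forall j, x j <= y j) -> x k = y k -> x l < y l -> F y < F x.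
Proof.
move=> allks dF F0 Fl xy xyk xyl.
have h1 : F y <= F (set_coord y l (x l)).
  rewrite -[in leLHS](set_coord_id y l).
  have [c _ e] := mvt_derivable (derivable_coord y (dF l)) (ltW xyl).
  by rewrite -subr_le0 e -partial_set_coord mulr_le0_ge0 ?subr_ge0 ?(ltW (Fl _))// ltW.
have {}h1 : F y < F (set_coord y l (x l)).
  rewrite -[in ltLHS](set_coord_id y l).
  have [c _ e] := mvt_derivable (derivable_coord y (dF l)) (ltW xyl).
  by rewrite -subr_lt0 e -partial_set_coord nmulr_rlt0 ?subr_gt0.
apply: lt_le_trans h1 _; apply: (@le_coords F ks k) => // [j|].
  by rewrite /set_coord; case: eqP => // ->.
by rewrite /set_coord; case: eqP => // ->.
Qed.

(** Write max(x, y) = y + d and x = min(x, y) + d with d >= 0.  Adding d one coordinate at a time,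
each increment of F is at most as large at the higher point, because increments in coordinate
k decrease in the other coordinates. *)
Lemma submodular F (ks : seq T) x y : uniq ks -> (forall k, k \in ks) ->
  (forall k u, has_partial k F u) ->
  (forall k l u, has_partial k (partial l F) u) ->
  (forall k l u, k != l -> partial k (partial l F) u <= 0) ->
  F (fun j => Num.max (x j) (y j)) + F (fun j => Num.min (x j) (y j)) <= F x + F y.
Proof.
move=> uks allks dF ddF F0.
set M := fun j => Num.max (x j) (y j); set m := fun j => Num.min (x j) (y j).
suff H (ls : seq T) : uniq ls -> F (mix_coords ls y M) - F y <= F (mix_coords ls m x) - F m.
  by have := H ks uks; rewrite !mix_coords_all//; lra.
elim: ls => [|k ls IH]; first by rewrite !mix_coords_nil !subrr.
move=> /=/andP[kls uls]; have {}IH := IH uls.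
rewrite !mix_coords_cons.
set Y := mix_coords ls y M in IH *; set Z := mix_coords ls m x in IH *.
have ZY j : Z j <= Y j.
  by rewrite /Z /Y /mix_coords /m /M; case: ifP; rewrite ?le_max ?ge_min lexx ?orbT.
have Yk : Y k = y k by rewrite /Y /mix_coords (negbTE kls).
have Zk : Z k = m k by rewrite /Z /mix_coords (negbTE kls).
have [xy|yx] := leP (x k) (y k).
  have -> : set_coord Y k (M k) = Y.
    by rewrite -[RHS](set_coord_id Y k) Yk /M max_r.
  suff -> : set_coord Z k (x k) = Z by [].
  by rewrite -[RHS](set_coord_id Z k) Zk /m min_l.
have Mk : M k = x k by rewrite /M max_l// ltW.
have mk : m k = y k by rewrite /m min_r// ltW.
pose phi t := F (set_coord Y k t) - F (set_coord Z k t).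
have dY := derivable_coord Y (dF k); have dZ := derivable_coord Z (dF k).
have dphi t : derivable phi t 1 by apply: derivableB.
have [c _] := mvt_derivable dphi (ltW yx).
have -> : derive1 phi c = partial k F (set_coord Y k c) - partial k F (set_coord Z k c).
  by rewrite !partial_set_coord !derive1E deriveB.
have : partial k F (set_coord Y k c) - partial k F (set_coord Z k c) <= 0.
  rewrite subr_le0; apply: (@le_coords _ ks k _ _ allks).
  - by move=> l u; exact: ddF.
  - by move=> l u lk; apply: F0.
  - by move=> j; rewrite /set_coord; case: eqP.
  - by rewrite /set_coord eqxx.
move=> dneg e.
have : phi (x k) - phi (y k) <= 0 by rewrite e mulr_le0_ge0 ?subr_ge0// ltW.
have eY : set_coord Y k (y k) = Y by rewrite -[RHS](set_coord_id Y k) Yk.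
have eZ : set_coord Z k (y k) = Z by rewrite -[RHS](set_coord_id Z k) Zk mk.
rewrite /phi eY eZ Mk.
move: IH; lra.
Qed.

Lemma lipschitz_coords F (ks : seq T) (a b C : R) x y : uniq ks -> (forall k, k \in ks) ->
  (forall k u, has_partial k F u) ->
  (forall k u, (forall j, a <= u j <= b) -> `|partial k F u| <= C) ->
  (forall j, a <= x j <= b) -> (forall j, a <= y j <= b) ->
  `|F y - F x| <= C * \sum_(k <- ks) `|y k - x k|.
Proof.
move=> uks allks dF dC xab yab.
rewrite -{1}(mix_coords_all x y allks) -{1}(mix_coords_nil x y).
elim: ks {allks} uks => [|k ks IH] /=; first by rewrite subrr normr0 big_nil mulr0.
move=> /andP[kks uks]; rewrite mix_coords_cons.
have := IH uks; rewrite mix_coords_nil; set z := mix_coords ks x y => IHz.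
have zk : z k = x k by rewrite /z /mix_coords (negbTE kks).
rewrite big_cons mulrDr -(subrK (F z) (F (set_coord z k (y k)))) -addrA.
rewrite (le_trans (ler_normD _ _))// lerD//.
rewrite -{2}(set_coord_id z k) zk.
have [c [/andP[c1 c2] _ ->]] := @mvt_between (fun t => F (set_coord z k t)) (x k) (y k)
   (derivable_coord z (dF k)).
rewrite normrM ler_wpM2r// -partial_set_coord dC// => j.
have /andP[xa xb] := xab j; have /andP[ya yb] := yab j.
rewrite /set_coord; case: eqP => [jk|_].
  rewrite jk in xa xb ya yb.
  by rewrite (le_trans _ c1) ?le_min ?xa ?ya// (le_trans c2)// ge_max xb yb.
by rewrite /z /mix_coords; case: ifP; rewrite ?xa ?xb ?ya ?yb.
Qed.

End Calculus.

(** * Pointwise compactness *)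

Section Compactness.
Context {R : realType}.

Lemma ultra_cvg (G : set_system nat) (f : nat -> R) (a b : R) :
  UltraFilter G -> (forall L, a <= f L <= b) ->
  exists2 p, a <= p <= b & f L @[L --> G] --> p.
Proof.
move=> UG fab.
have PG : ProperFilter G by exact: ultra_proper.
have fG : (f @ G) `[a, b]%classic.
  by change (G (f @^-1` `[a, b])); apply: filterE => L /=; rewrite in_itv/=.
have [p []] := @segment_compact R a b (f @ G) _ fG.
rewrite /= in_itv/= => pab clp; exists p => //.
apply/cvgrPdist_lt => e e0.
case: (in_ultra_setVsetC [set L | `|p - f L| < e] UG) => [|nA]; first by [].
have nB : (f @ G) [set x | e <= `|p - x|].
  by change (G (f @^-1` [set x | e <= `|p - x|])); apply: filterS nA => L /= /negP;
    rewrite -leNgt.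
have [x [/= Bx]] := clp _ (ball p e) nB (nbhsx_ballx _ _ e0).
by rewrite /ball/= ltNge Bx.
Qed.

(** Along an ultrafilter every bounded real sequence converges, so all coordinates converge at
once and no subsequences have to be extracted. *)
Lemma pointwise_compact (T : Type) (a b : T -> R) (u : nat -> T -> R) :
  (forall L i, a i <= u L i <= b i) ->
  exists G : set_system nat, [/\ ProperFilter G, \oo `<=` G &
    exists2 U, (forall i, a i <= U i <= b i) & forall i, u L i @[L --> G] --> U i].
Proof.
move=> uab; have [G [UG sub]] := ultraFilterLemma (eventually_filter).
exists G; split=> //; first exact: ultra_proper.
have [i|U HU] := choice (_ : forall i, exists p, a i <= p <= b i /\ u L i @[L --> G] --> p).
  by have [p] := ultra_cvg UG (fun L => uab L i); exists p.
by exists U => i; have [] := HU i.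
Qed.

End Compactness.

(** * Admissible potentials *)

Section Ball.
Context (n r : nat).
Notation B := (ball0 n r).

Lemma finite_ball0 : finite_set [set: B].
Proof.
pose h (f : {ffun 'I_n -> 'I_(r + r).+1}) : lattice n := \row_i ((f i)%:Z - r%:Z).
have fin : finite_set (h @` setT) by apply: finite_image; exact: finite_finset.
have -> : [set: B] = (@sval _ _ : B -> lattice n) @^-1` (h @` setT).
  apply/seteqP; split=> // k _ /=.
  exists [ffun i => inord (absz ((val k) ord0 i + r%:Z)%R)] => //.
  apply/rowP => i; rewrite mxE ffunE.
  have kr : (`|(val k) ord0 i| <= r)%N.
    by apply: leq_trans (valP k); exact: lattice_coord_le.
  by rewrite inordK; move: kr; set x := (\val k) ord0 i; move: x => x; lia.
by apply: finite_preimage => // x y _ _; exact: val_inj.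
Qed.

Definition ball_enum : seq B := finmap.enum_fset (fset_set [set: B]).

Lemma mem_ball_enum k : k \in ball_enum.
Proof.
have : k \in [set: B] by rewrite inE.
by rewrite -(in_fset_set finite_ball0).
Qed.

Lemma uniq_ball_enum : uniq ball_enum.
Proof. exact: finmap.fset_uniq. Qed.

Lemma zero_ball : (l1norm (0 : lattice n) <= r)%N.
Proof. by rewrite /l1norm big1// => k _; rewrite mxE. Qed.

Definition ball_zero : B := exist _ 0 zero_ball.

Lemma ball_coord (k : B) i : (`|(val k) ord0 i| <= r)%N.
Proof. by apply: leq_trans (valP k); exact: lattice_coord_le. Qed.

End Ball.

Section Smooth.
Context (R : realType) (n r : nat).
Notation B := (ball0 n r).
Implicit Types (F : (B -> R) -> R) (x y : B -> R).

Lemma C0_cvg F (I : Type) (G : set_system I) (FG : Filter G) (X : I -> B -> R) x :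
  C0 F -> (forall k, X i k @[i --> G] --> x k) -> F (X i) @[i --> G] --> F x.
Proof.
move=> cF Xx.
apply: (@cvg_comp _ {ptws B -> R} _ X F _ (nbhs (x : {ptws B -> R}))); last exact: cF.
by apply/(@pointwise_cvgP (discrete_topology B) R).
Qed.

(** Points of the cube with unbounded values would have a limit point, where F is continuous. *)
Lemma C0_bounded F (a b : R) : C0 F ->
  exists2 C, 0 <= C & forall u, (forall k, a <= u k <= b) -> `|F u| <= C.
Proof.
move=> cF; apply: contrapT => nC.
have [L|u Hu] := choice (_ : forall L : nat, exists u : B -> R,
    (forall k, a <= u k <= b) /\ L%:R < `|F u|).
  apply: contrapT => nu; apply: nC; exists L%:R => // u uab.
  by rewrite leNgt; apply/negP => Lu; apply: nu; exists u.
have [G [PG sub [U Uab uU]]] := pointwise_compact (fun L => (Hu L).1).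
move/cvgrPdist_lt : (C0_cvg PG cF uU) => /(_ 1 ltr01) near1.
have [M ML] : exists M : nat, `|F U| + 1 < M%:R.
  by exists (Num.truncn (`|F U| + 1)).+1; rewrite truncnS_gt.
have GM : G [set L | (M <= L)%N] by apply: sub; exists M.
have [L [/= d1 d2]] := filter_ex (filterI near1 GM).
have := (Hu L).2; apply/negP; rewrite -leNgt.
have : (M%:R : R) <= L%:R by rewrite ler_nat.
have := ler_normB (F U) (F U - F (u L)); rewrite opprB addrC subrK.
move: ML d1; lra.
Qed.

Context (s : (B -> R) -> R) (hs : admissible s).

Lemma s_partial k u : has_partial k s u.
Proof. by have [[_ /(_ k)[]]] := admissible_C2 hs. Qed.

Lemma s_partial_C0 k : C0 (partial k s).
Proof. by have [[_ /(_ k)[]]] := admissible_C2 hs. Qed.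
Arguments s_partial_C0 : clear implicits.

Lemma s_partial2 k l u : has_partial k (partial l s) u.
Proof. by have [_ /(_ l)[_ /(_ k)[]]] := admissible_C2 hs. Qed.

Lemma s_C0 : C0 s.
Proof. by have [[]] := admissible_C2 hs. Qed.

Lemma s_submodular x y :
  s (fun j => Num.max (x j) (y j)) + s (fun j => Num.min (x j) (y j)) <= s x + s y.
Proof.
apply: (@submodular R _ s (ball_enum n r) x y (@uniq_ball_enum n r) (@mem_ball_enum n r)).
- exact: s_partial.
- exact: s_partial2.
- by move=> k l u; apply: (admissible_S3_le0 hs).
Qed.

Lemma s_lipschitz (a b : R) : exists2 C, 0 <= C & forall x y,
  (forall j, a <= x j <= b) -> (forall j, a <= y j <= b) ->
  `|s y - s x| <= C * \sum_(k <- ball_enum n r) `|y k - x k|.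
Proof.
have [C C0 HC] : exists2 C, 0 <= C & forall k, k \in ball_enum n r ->
    forall u, (forall j, a <= u j <= b) -> `|partial k s u| <= C.
  elim: (ball_enum n r) => [|k ks [C C0 HC]]; first by exists 0.
  have [D D0 HD] := @C0_bounded _ a b (s_partial_C0 k).
  exists (C + D) => [|k']; first by rewrite addr_ge0.
  rewrite inE => /orP[/eqP -> u /HD|k'ks u uab]; first by move/le_trans; apply; rewrite lerDr.
  by rewrite (le_trans (HC _ k'ks _ uab))// lerDl.
exists C => // x y xab yab.
apply: (lipschitz_coords (@uniq_ball_enum n r) (@mem_ball_enum n r) (a := a) (b := b)) => //.
  exact: s_partial.
by move=> k u; apply: HC; exact: mem_ball_enum.
Qed.

(** The coordinates in K are raised one after the other.  By the mean value theorem each step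
contributes a partial derivative, at a point that tends to x. *)
Lemma s_dir_derivative (K : pred B) x :
  (s (fun k => x k + (if K k then t else 0)) - s x) / t @[t --> 0^'] -->
  \sum_(k <- ball_enum n r | K k) partial k s x.
Proof.
pose y t : B -> R := fun k => x k + (if K k then t else 0).
suff H (ks : seq B) : uniq ks ->
    (s (mix_coords ks x (y t)) - s x) / t @[t --> 0^'] --> \sum_(k <- ks | K k) partial k s x.
  have := H _ (@uniq_ball_enum n r); apply: cvg_trans; apply: near_eq_cvg.
  by near=> t; rewrite mix_coords_all// => k; exact: mem_ball_enum.
elim: ks => [_|k ks IH /= /andP[kks uks]].
  rewrite big_nil; under eq_fun do rewrite mix_coords_nil subrr mul0r.
  exact: cvg_cst.
rewrite big_cons; have {}IH := IH uks.
pose z t := mix_coords ks x (y t).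
have zk t : z t k = x k by rewrite /z /mix_coords (negbTE kks).
case: ifPn => Kk; last first.
  suff -> : (fun t => (s (mix_coords (k :: ks) x (y t)) - s x) / t) =
            (fun t => (s (mix_coords ks x (y t)) - s x) / t) by [].
  apply/funext => t; have -> // : mix_coords (k :: ks) x (y t) = mix_coords ks x (y t).
  rewrite mix_coords_cons -/(z t) -[RHS](set_coord_id (z t) k) zk.
  by have -> : y t k = x k by rewrite /y (negbTE Kk) addr0.
have [t|c Hc] := choice (_ : forall t, exists c, `|c - x k| <= `|t| /\
    s (set_coord (z t) k (x k + t)) - s (z t) = partial k s (set_coord (z t) k c) * t).
  have [c [_ c1 c2]] := @mvt_between R (fun h => s (set_coord (z t) k h)) (x k) (x k + t)
     (@derivable_coord _ _ s k (z t) (@s_partial k)).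
  have dt : x k + t - x k = t by rewrite addrAC subrr add0r.
  have e0 : set_coord (z t) k (x k) = z t by rewrite -(zk t) set_coord_id.
  rewrite dt in c1 c2; rewrite e0 in c2.
  exists c; split; first exact: c1.
  by rewrite partial_set_coord; exact: c2.
have cz : partial k s (set_coord (z t) k (c t)) @[t --> 0^'] --> partial k s x.
  apply: C0_cvg; first exact: s_partial_C0.
  move=> j; apply/cvgrPdist_le => e e0.
  have : \forall t \near (0:R)^', `|t| <= e.
    apply: nbhs_dnbhs; apply: (filterS _ (nbhsx_ballx _ _ e0)) => t.
    by rewrite /ball/= sub0r normrN => /ltW.
  apply: filterS => t te; rewrite /set_coord; case: eqP => [->|_].
    by rewrite distrC (le_trans (Hc t).1).
  rewrite /z /mix_coords; case: ifP => _; last by rewrite subrr normr0 ltW.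
  rewrite /y; case: ifP => _; last by rewrite addr0 subrr normr0 ltW.
  by rewrite opprD addrA subrr sub0r normrN.
apply: cvg_trans (cvgD cz IH); apply: near_eq_cvg.
have : \forall t \near (0:R)^', t != 0 by exact: nbhs_dnbhs_neq.
apply: filterS => t t0.
rewrite /= mix_coords_cons /y Kk -/(y t) -/(z t).
rewrite -{1}(subrK (s (z t)) (s (set_coord _ _ _))) (Hc t).2 -addrA mulrDl mulfK//.
Unshelve. all: by end_near. Qed.

End Smooth.

(** * The Euler-Lagrange equation and strong comparison *)

Section EulerLagrange.
Context (R : realType) (n r : nat) (s : (ball0 n r -> R) -> R) (hs : admissible s).
Implicit Types (u : config R n) (i j : lattice n).

Definition loc (j : lattice n) (u : config R n) : ball0 n r -> R :=
  fun b => u (val b + j).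

(** The left-hand side of the Euler-Lagrange equation at i, indexed by the offset k = i - j. *)
Definition grad u i := \sum_(k <- ball_enum n r) partial k s (loc (i - val k) u).

Lemma partial_local_potential u i (k : ball0 n r) :
  partial i (local_potential s (i - val k)) u = partial k s (loc (i - val k) u).
Proof.
have e : loc (i - val k) u k = u i by rewrite /loc addrC subrK.
rewrite /partial e; apply: (congr1 (fun f : R -> R => derive1 f (u i))).
apply/funext => t; rewrite /local_potential; congr s; apply/funext => b.
rewrite /translate /set_coord /loc; case: (b =P k) => [->|nb].
  by rewrite addrC subrK eqxx.
case: eqP => // /eqP; rewrite addrCA -subr_eq0 addrAC subrr add0r subr_eq0 => /eqP bk.
by case: nb; apply: val_inj.
Qed.

Lemma euler_lagrangeE u : euler_lagrange s u <-> forall i, grad u i = 0.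
Proof.
suff H i : \sum_(j \in [set j : lattice n | (l1norm (j - i) <= r)%N])
    partial i (local_potential s j) u = grad u i.
  by split=> h i; have := h i; rewrite H.
have b : set_bij [set: ball0 n r] [set j : lattice n | (l1norm (j - i) <= r)%N]
   (fun k => i - val k).
  split.
  - by move=> k _ /=; rewrite addrAC subrr sub0r l1normN (valP k).
  - by move=> k l _ _ /(addrI i) /oppr_inj /val_inj.
  - move=> j /= ji; have ij : (l1norm (i - j) <= r)%N by rewrite -opprB l1normN.
    by exists (exist _ (i - j) ij) => //=; rewrite opprB addrC subrK.
rewrite (reindex_fsbig _ _ _ _ b) fsbig_finite; last exact: finite_ball0.
by apply: eq_bigr => k _; exact: partial_local_potential.
Qed.

Lemma partial_le (k : ball0 n r) (x y : ball0 n r -> R) :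
  (forall j : ball0 n r, x j <= y j) -> x k = y k -> partial k s y <= partial k s x.
Proof.
move=> xy xyk; apply: (le_coords (@mem_ball_enum n r) _ _ xy xyk) => l u.
  exact: s_partial2.
by apply: (admissible_S3_le0 hs).
Qed.

(** At a contact point, every term of the sum decreases with the other values of u. *)
Lemma grad_le u u' i : cle u u' -> u i = u' i -> grad u' i <= grad u i.
Proof.
move=> uu' e; apply: ler_sum => k _; apply: partial_le => [j|]; first exact: uu'.
by rewrite /loc addrC subrK.
Qed.

(** The terms of the two sums are ordered, so if the sums agree then each term does.  The term of
offset k depends strictly on the value at i - k when k is a unit vector. *)
Lemma grad_touch u u' i : cle u u' -> u i = u' i -> grad u' i = grad u i ->
  forall k : ball0 n r, l1norm (val k) = 1%N -> u (i - val k) = u' (i - val k).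
Proof.
move=> uu' e ge k k1; apply/eqP; rewrite eq_le uu'/= leNgt; apply/negP => lt.
have : grad u' i < grad u i; last by rewrite ge ltxx.
have gE (v : config R n) : grad v i = partial k s (loc (i - val k) v) +
    \sum_(l <- ball_enum n r | l != k) partial l s (loc (i - val l) v).
  exact: (bigD1_seq k (mem_ball_enum k) (uniq_ball_enum n r)).
rewrite !gE.
apply: ltr_leD; last first.
  apply: ler_sum => l _; apply: partial_le => [j|]; first exact: uu'.
  by rewrite /loc addrC subrK.
have z0 (v : config R n) : loc (i - val k) v (ball_zero n r) = v (i - val k).
  by rewrite /loc /= add0r.
apply: (@lt_coords _ _ _ (ball_enum n r) k (ball_zero n r)).
- exact: mem_ball_enum.
- by move=> l v; exact: s_partial2.
- by move=> l v; exact: (admissible_S3_le0 hs).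
- by move=> v; exact: (admissible_S3_lt0 hs).
- by move=> j; exact: uu'.
- by rewrite /loc addrC subrK.
- by rewrite !z0.
Qed.

Lemma strong_comparison u u' i : (1 <= r)%N -> cle u u' ->
  (forall i, grad u i = 0) -> (forall i, grad u' i = 0) -> u i = u' i -> u = u'.
Proof.
move=> hr uu' gu gu' e.
have l1 (k : 'I_n) : (l1norm (delta_mx ord0 k : lattice n) <= r)%N by rewrite l1norm_delta.
have l1' (k : 'I_n) : (l1norm (- delta_mx ord0 k : lattice n)%R <= r)%N.
  by rewrite l1normN.
pose unit e h : ball0 n r := exist (fun z : lattice n => is_true (l1norm z <= r)%N) e h.
apply/funext => j; apply: (@lattice_ind n predT (fun j => u j = u' j) i) => //.
- move=> k j' _ ej; have := @grad_touch u u' j' uu' ej _ (unit _ (l1' k)).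
  by rewrite /= opprK gu gu'; apply => //; rewrite l1normN l1norm_delta.
- move=> k j' _ ej; have := @grad_touch u u' j' uu' ej _ (unit _ (l1 k)).
  by rewrite /= gu gu'; apply => //; rewrite l1norm_delta.
Qed.

End EulerLagrange.

(** * Order statistics of finitely many functions *)

Section OrderStatistics.
Context {R : realType}.

(** Insertion in a sorted list, written with minima and maxima so that [insert_fun] can perform it
at all points simultaneously. *)
Fixpoint insert_value (x : R) (l : seq R) : seq R :=
  if l is y :: l' then Num.min x y :: insert_value (Num.max x y) l' else [:: x].

Definition sort_values (l : seq R) := foldr insert_value [::] l.

Lemma path_insert_value a x l : path <=%R a l -> a <= x -> path <=%R a (insert_value x l).
Proof.
elim: l a x => [|y l IH] a x /=; first by move=> _ ->.
move=> /andP[ay yl] ax; rewrite le_min ax ay/=; apply: IH.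
  case: l yl {ay ax} => //= z l /andP[yz ->]; rewrite andbT.
  by rewrite ge_min yz orbT.
by rewrite le_max ge_min lexx.
Qed.

Lemma sorted_insert_value x l : sorted <=%R l -> sorted <=%R (insert_value x l).
Proof.
case: l => //= y l yl; apply: path_insert_value; last by rewrite le_max ge_min lexx.
by case: l yl => //= z l /andP[yz ->]; rewrite andbT ge_min yz orbT.
Qed.

Lemma perm_insert_value x l : perm_eq (insert_value x l) (x :: l).
Proof.
elim: l x => [//|y l IH] x /=; have [xy|yx] := leP x y.
  by rewrite perm_cons IH.
by rewrite (perm_trans (y := y :: x :: l)) ?perm_cons ?IH// (perm_catCA [:: y] [:: x]).
Qed.

Lemma sorted_sort_values l : sorted <=%R (sort_values l).
Proof. by elim: l => //= x l IH; exact: sorted_insert_value. Qed.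

Lemma perm_sort_values l : perm_eq (sort_values l) l.
Proof.
elim: l => //= x l IH; apply: perm_trans (perm_insert_value _ _) _.
by rewrite perm_cons.
Qed.

Lemma eq_sort_values l l' : perm_eq l l' -> sort_values l = sort_values l'.
Proof.
move=> ll'; apply: (@sorted_eq _ <=%R) => //; [exact: le_trans|exact: le_anti|..].
- exact: sorted_sort_values.
- exact: sorted_sort_values.
- rewrite (perm_trans (perm_sort_values l))// (perm_trans ll')// perm_sym.
  exact: perm_sort_values.
Qed.

Lemma le_insert_value x y l k : x <= y ->
  nth 0 (insert_value x l) k <= nth 0 (insert_value y l) k.
Proof.
elim: l x y k => [|z l IH] x y [|k] xy //=.
  by rewrite le_min2.
by apply: IH; rewrite le_max2.
Qed.

Variable T : Type.
Implicit Types (f g : T -> R) (fs gs : seq (T -> R)).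

Definition fmin f g : T -> R := fun i => Num.min (f i) (g i).
Definition fmax f g : T -> R := fun i => Num.max (f i) (g i).

Fixpoint insert_fun f gs :=
  if gs is g :: gs' then fmin f g :: insert_fun (fmax f g) gs' else [:: f].

Definition order_stats fs := foldr insert_fun [::] fs.

Lemma insert_fun_eval f gs i :
  [seq g i | g <- insert_fun f gs] = insert_value (f i) [seq g i | g <- gs].
Proof. by elim: gs f => //= g gs IH f; rewrite IH. Qed.

Lemma order_stats_eval fs i : [seq g i | g <- order_stats fs] = sort_values [seq f i | f <- fs].
Proof. by elim: fs => //= f fs IH; rewrite insert_fun_eval IH. Qed.

Lemma size_order_stats fs : size (order_stats fs) = size fs.
Proof.
elim: fs => //= f fs <-; elim: (order_stats fs) f => //= g gs IH f.
by rewrite IH.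
Qed.

Lemma nth_order_stats d fs k i : (k < size fs)%N ->
  nth d (order_stats fs) k i = nth 0 (sort_values [seq f i | f <- fs]) k.
Proof.
by move=> ks; rewrite -order_stats_eval (nth_map d)// size_order_stats.
Qed.

(** Each comparison replaces two functions by their minimum and their maximum, which does not
increase the sum of the values of a submodular Phi. *)
Lemma order_stats_energy (X : set (T -> R)) (Phi : (T -> R) -> R) fs :
  (forall f g, X f -> X g -> X (fmin f g)) ->
  (forall f g, X f -> X g -> X (fmax f g)) ->
  (forall f g, X f -> X g -> Phi (fmax f g) + Phi (fmin f g) <= Phi f + Phi g) ->
  (forall f, List.In f fs -> X f) ->
  (forall g, List.In g (order_stats fs) -> X g) /\
  \sum_(g <- order_stats fs) Phi g <= \sum_(f <- fs) Phi f.
Proof.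
move=> Xmin Xmax sub.
have ins f gs : X f -> (forall g, List.In g gs -> X g) ->
  (forall g, List.In g (insert_fun f gs) -> X g) /\
  \sum_(g <- insert_fun f gs) Phi g <= Phi f + \sum_(g <- gs) Phi g.
  elim: gs f => [|g gs IH] f Xf Xgs /=.
    by split=> [g [<-|]//|]; rewrite big_seq1 big_nil addr0.
  have Xg : X g by apply: Xgs; left.
  have [h1 h2] := IH (fmax f g) (Xmax _ _ Xf Xg) (fun g' h => Xgs g' (or_intror h)).
  split=> [g' [<-|/h1//]|]; first exact: Xmin.
  rewrite !big_cons; have := sub _ _ Xf Xg; move: h2; lra.
elim: fs => [|f fs IH] Xfs /=; first by rewrite !big_nil.
have [h1 h2] := IH (fun g h => Xfs g (or_intror h)).
have [h3 h4] := ins f _ (Xfs f (or_introl erefl)) h1.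
by split=> //; rewrite big_cons (le_trans h4)// lerD2l.
Qed.

Lemma pigeonhole (Phi : (T -> R) -> R) fs (c : R) : (0 < size fs)%N ->
  \sum_(f <- fs) Phi f <= c *+ size fs ->
  exists2 k, (k < size fs)%N & forall d, Phi (nth d fs k) <= c.
Proof.
elim: fs => //= f fs IH _; rewrite big_cons mulrS => h.
have [fc|cf] := leP (Phi f) c; first by exists 0%N.
case: fs IH h => [|f' fs] IH h; first by move: h; rewrite big_nil mulr0n; lra.
have [//||k ks kc] := IH; first by move: h; lra.
by exists k.+1.
Qed.

Lemma In_nth d fs k : (k < size fs)%N -> List.In (nth d fs k) fs.
Proof.
by elim: fs k => //= f fs IH [|k] h; [left|right; exact: IH].
Qed.

End OrderStatistics.

(** * Configurations of m coordinates and slices *)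

Section Dep.
Context {R : realType} {n : nat}.
Implicit Types (u v w : config R n) (i j : lattice n).

(** The periodicity clause of GammaHat, see [depP], in a form that compares arbitrary points. *)
Definition dep (m : nat) u := forall i i' : lattice n,
  (forall l : 'I_n, (l < m)%N -> i ord0 l = i' ord0 l) -> u i = u i'.

Lemma dep_leq m m' u : (m <= m')%N -> dep m u -> dep m' u.
Proof. by move=> mm' du i i' h; apply: du => l lm; apply: h; exact: leq_trans mm'. Qed.

Lemma depP m u : dep m u <->
  (forall k, (m + 1 <= k <= n)%N -> forall i, u (i + unit_vec n k) = u i).
Proof.
split=> [du k /andP[mk kn] i|per i i' ii'].
  apply: du => l lm; rewrite !mxE; have /negbTE -> : (l.+1 != k) by lia.
  by rewrite addr0.
have uper (k : 'I_n) j : (m <= k)%N -> u (j + delta_mx 0 k) = u j.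
  by move=> mk; rewrite -unit_vecE per//; have := ltn_ord k; lia.
apply/esym; apply: (@lattice_ind n (fun k => (m <= k)%N) (fun j => u j = u i) i) => //.
- by move=> k j mk <-; exact: uper.
- by move=> k j mk <-; rewrite -[in RHS](subrK (delta_mx 0 k) j) uper.
- by move=> k; rewrite -ltnNge => km; rewrite ii'.
Qed.

Lemma tauN_add m (a b : int) u : tauN m a (tauN m b u) = tauN m (a + b) u.
Proof. by apply/funext => i; rewrite /tauN /translate -addrA scalerDl. Qed.

Lemma tauN0 m u : tauN m 0 u = u.
Proof. by apply/funext => i; rewrite /tauN /translate scale0r addr0. Qed.

Lemma dep_tauN p m (a : int) u : dep p u -> dep p (tauN m a u).
Proof. by move=> du i i' h; apply: du => l lm; rewrite !mxE h. Qed.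

Lemma dep_tauN_id p (a : int) u : dep p u -> tauN p.+1 a u = u.
Proof.
move=> du; apply/funext => i; apply: du => l lp; rewrite !mxE.
have /negbTE -> : (l.+1 != p.+1) by lia.
by rewrite mulr0 addr0.
Qed.

Lemma cle_tauN m (a : int) u v : cle u v -> cle (tauN m a u) (tauN m a v).
Proof. by move=> uv i; exact: uv. Qed.

Lemma loc_tauN r m (a : int) u j : loc j (tauN m a u) = loc (r := r) (j + a *: unit_vec n m) u.
Proof. by apply/funext => b; rewrite /loc /tauN /translate addrA. Qed.

End Dep.

Section Slice.
Context {R : realType} {n p : nat} (pn : (p < n)%N).
Notation m := p.+1.
Notation ko := (Ordinal pn).
Implicit Types (f : lattice n -> R) (k j : lattice n).

Definition proj_lt k : lattice n := \row_l (if (l < p)%N then k ord0 l else 0).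

Lemma slice_proj_bij k : set_bij (slice (n := n) m 0) (slice m 0) (fun j => j + proj_lt k).
Proof.
have pl (l : 'I_n) k' : (p <= l)%N -> proj_lt k' ord0 l = 0.
  by move=> h; rewrite mxE ltnNge h.
have cl k' j : slice (n := n) m 0 j -> slice (n := n) m 0 (j + proj_lt k').
  move=> sj l; have [h1 h2] := sj l; split=> h; rewrite mxE pl ?addr0; try lia.
    exact: h1.
  exact: h2.
split.
- by move=> j sj; exact: cl.
- by move=> x y _ _ /addIr.
- move=> j sj; exists (j + proj_lt (- k)); first exact: cl.
  rewrite -addrA (_ : proj_lt (- k) + proj_lt k = 0) ?addr0//.
  by apply/rowP => l; rewrite !mxE; case: ifP; rewrite ?addNr ?addr0.
Qed.

(** For a function of m coordinates, a translation by k moves a slice onto another one, according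
to coordinate m of k, and permutes the points within the slices. *)
Lemma slice_shift f k : dep m f -> forall j,
  (fun j => tauN m (k ord0 ko) f (j + proj_lt k)) j = f (k + j).
Proof.
move=> df j; apply: df => l; rewrite ltnS leq_eqVlt !mxE eqSS => /orP[/eqP lp|lp].
  have -> : l = ko by apply: val_inj.
  by rewrite /= ltnn eqxx mulr1 addr0 addrC.
have /negbTE -> : l != p :> nat by lia.
by rewrite lp mulr0 addr0 addrC.
Qed.

Lemma rsum_slice_shift f k : dep m f ->
  rsum (slice m 0) (fun j => f (k + j)) = rsum (slice m 0) (tauN m (k ord0 ko) f).
Proof.
move=> df; rewrite [RHS](rsum_reindex _ (slice_proj_bij k)).
by apply: eq_rsum => j _; rewrite -(slice_shift k df).
Qed.

Lemma abs_summable_slice_shift f k : dep m f ->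
  abs_summable (slice m 0) (tauN m (k ord0 ko) f) ->
  abs_summable (slice m 0) (fun j => f (k + j)).
Proof.
move=> df; rewrite /abs_summable (reindex_esum _ _ _ _ (slice_proj_bij k)).
by under eq_esum do rewrite (slice_shift k df).
Qed.

Lemma slice_tau_bij (a : int) :
  set_bij (slice (n := n) m 0) (slice m a) (fun j => j + a *: unit_vec n m).
Proof.
have cl b c j : slice (n := n) m b j -> slice (n := n) m (b + c) (j + c *: unit_vec n m).
  move=> sj l; have [h1 h2] := sj l; split=> h; rewrite !mxE.
    by rewrite h1// h eqxx mulr1.
  rewrite h2//; have /negbTE -> : l.+1 != m by lia.
  by rewrite mulr0 addr0.
split.
- by move=> j /(cl _ a); rewrite add0r.
- by move=> x y _ _ /addIr.
- move=> j /(cl _ (- a)); rewrite subrr => h; exists (j + - a *: unit_vec n m) => //.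
  by rewrite -addrA -scalerDl addNr scale0r addr0.
Qed.

End Slice.

(** * Energies of slices *)

Section GoodPair.
Context {R : realType} {n r : nat} (s : (ball0 n r -> R) -> R).
Implicit Types (u v w : config R n).

(** The energy of u relative to v over the slice E^{p+1}_0, which is J_p(u) - c_p for the extended
functional J_p. *)
Definition slice_energy (p : nat) v u : R :=
  rsum (slice p.+1 0) (fun j => local_potential s j u - local_potential s j v).

(** All that the problem at level p + 1 has to know about the pair v < w chosen at level p. *)
Record good_pair (p : nat) v w : Prop := GoodPair {
  gp_lt : clt v w;
  gp_depv : dep p v;
  gp_depw : dep p w;
  gp_bound : exists a b : R, forall i, a <= v i /\ w i <= b;
  gp_sum : abs_summable (slice p.+1 0) (fun j => w j - v j);
  gp_ELv : forall i, grad s v i = 0;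
  gp_ELw : forall i, grad s w i = 0;
  gp_min : forall u, cle v u -> cle u w -> dep p u ->
    0 <= slice_energy p v u /\ (slice_energy p v u = 0 -> u = v \/ u = w);
  gp_w : slice_energy p v w = 0;
  gp_shift : forall k, (1 <= k <= p)%N -> cle w (tauN k 1 v)
}.

End GoodPair.

Section Level.
Context {R : realType} {n r : nat} (hr : (1 <= r)%N).
Context (s : (ball0 n r -> R) -> R) (hs : admissible s).
Context (p : nat) (pn : (p < n)%N) (v w : config R n) (gp : good_pair s p v w).
Notation m := p.+1.
Notation ko := (Ordinal pn).
Notation tau := (tauN m).
Notation E0 := (slice (n := n) m 0).
Notation S := (local_potential s).
Implicit Types (u : config R n) (i j : lattice n) (a : int).

Definition box u : Prop := [/\ cle v u, cle u w & dep m u].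

Lemma boxE : box = GammaHat m v w.
Proof.
by apply/funext => u; apply/propext; split=> -[h1 h2 h3]; split=> //; exact/depP.
Qed.

Lemma vw : cle v w. Proof. by move=> i; apply: ltW; exact: gp_lt gp i. Qed.

Lemma dep_mv : dep m v. Proof. exact: dep_leq (leqnSn p) (gp_depv gp). Qed.
Lemma dep_mw : dep m w. Proof. exact: dep_leq (leqnSn p) (gp_depw gp). Qed.

Lemma box_v : box v. Proof. by split=> //; [exact: vw|exact: dep_mv]. Qed.
Lemma box_w : box w. Proof. by split=> //; [exact: vw|exact: dep_mw]. Qed.

Lemma box_min u u' : box u -> box u' -> box (fmin u u').
Proof.
move=> [h1 h2 h3] [h4 h5 h6]; split=> [i|i|i i' h]; rewrite /fmin.
- by rewrite le_min h1 h4.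
- by rewrite ge_min h2.
- by rewrite (h3 _ _ h) (h6 _ _ h).
Qed.

Lemma box_max u u' : box u -> box u' -> box (fmax u u').
Proof.
move=> [h1 h2 h3] [h4 h5 h6]; split=> [i|i|i i' h]; rewrite /fmax.
- by rewrite le_max h1.
- by rewrite ge_max h2 h5.
- by rewrite (h3 _ _ h) (h6 _ _ h).
Qed.

Lemma tau_v a : tau a v = v. Proof. exact: dep_tauN_id (gp_depv gp). Qed.
Lemma tau_w a : tau a w = w. Proof. exact: dep_tauN_id (gp_depw gp). Qed.

Lemma box_tau a u : box u -> box (tau a u).
Proof.
move=> [h1 h2 h3]; split; last exact: dep_tauN.
  by rewrite -(tau_v a); exact: cle_tauN.
by rewrite -(tau_w a); exact: cle_tauN.
Qed.

Lemma box_dist u u' j : box u -> box u' -> `|u j - u' j| <= w j - v j.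
Proof.
move=> [h1 h2 _] [h3 h4 _]; have := h1 j; have := h2 j; have := h3 j; have := h4 j.
by move=> ? ? ? ?; rewrite ler_norml; apply/andP; split; lra.
Qed.

Lemma box_lipschitz : exists2 C, 0 <= C & forall u u' j, box u -> box u' ->
  `|S j u - S j u'| <= C * \sum_(k <- ball_enum n r) `|u (val k + j) - u' (val k + j)|.
Proof.
have [a [b ab]] := gp_bound gp.
have [C C0 HC] := s_lipschitz hs a b; exists C => // u u' j [h1 h2 _] [h3 h4 _].
have := HC (loc j u') (loc j u); apply => k; apply/andP; split.
- exact: le_trans (ab _).1 (h3 _).
- exact: le_trans (h4 _) (ab _).2.
- exact: le_trans (ab _).1 (h1 _).
- exact: le_trans (h2 _) (ab _).2.
Qed.

Definition lipschitz_constants : set R := [set C : R | 0 <= C /\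
  forall u u' j, box u -> box u' ->
  `|S j u - S j u'| <= C * \sum_(k <- ball_enum n r) `|u (val k + j) - u' (val k + j)|].

(** A Lipschitz constant of s on the range of the box; it is fixed once, so that later constants
can be definitions. *)
Definition lip : R := xget 0 lipschitz_constants.

Lemma lipP : lipschitz_constants lip.
Proof.
have [C C0 HC] := box_lipschitz.
by apply: (@xgetI _ 0 lipschitz_constants C); split.
Qed.

(** It dominates the differences of local potentials of configurations in the box, and its
summability over the slice makes all energies absolutely convergent. *)
Definition majorant j : R := lip * \sum_(k <- ball_enum n r) (w (val k + j) - v (val k + j)).

Lemma majorant_bound u u' j : box u -> box u' -> `|S j u - S j u'| <= majorant j.
Proof.
move=> bu bu'; apply: le_trans (lipP.2 _ _ _ bu bu') _.
rewrite ler_wpM2l ?lipP.1//; apply: ler_sum => k _; exact: box_dist.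
Qed.

Lemma dep_wv : dep m (fun j => w j - v j).
Proof. by move=> i i' h; rewrite (dep_mw h) (dep_mv h). Qed.

Lemma tau_wv a : tau a (fun j => w j - v j) = (fun j => w j - v j).
Proof.
apply: dep_tauN_id => i i' h; rewrite (gp_depw gp h) (gp_depv gp h); reflexivity.
Qed.

Lemma majorant_summable : abs_summable E0 majorant.
Proof.
apply: abs_summableZ; apply: abs_summable_sum => k _.
have := @abs_summable_slice_shift R n p pn (fun j => w j - v j) (val k) dep_wv.
by rewrite tau_wv; apply; exact: gp_sum gp.
Qed.

Lemma S_summable u u' : box u -> box u' -> abs_summable E0 (fun j => S j u - S j u').
Proof.
by move=> bu bu'; apply: abs_summable_le majorant_summable => j _; exact: majorant_bound.
Qed.

Notation energy0 := (slice_energy s p v).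

Lemma energy0B u u' : box u -> box u' ->
  energy0 u - energy0 u' = rsum E0 (fun j => S j u - S j u').
Proof.
move=> bu bu'; rewrite -rsumB; try exact: (S_summable _ box_v).
by apply: eq_rsum => j _; rewrite opprB addrA subrK.
Qed.

Lemma energy0_submodular u u' : box u -> box u' ->
  energy0 (fmax u u') + energy0 (fmin u u') <= energy0 u + energy0 u'.
Proof.
move=> bu bu'; have bM := box_max bu bu'; have bm := box_min bu bu'.
have h1 := S_summable bM box_v; have h2 := S_summable bm box_v.
have h3 := S_summable bu box_v; have h4 := S_summable bu' box_v.
rewrite -!rsumD//; apply: le_rsum; try exact: abs_summableD.
move=> j _; have := s_submodular hs (loc j u) (loc j u').
rewrite -/(S j (fmax u u')) -/(S j (fmin u u')) -/(S j u) -/(S j u').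
lra.
Qed.

(** The l1 distance of two configurations on the slice E^m_a. *)
Definition sdist a u u' : R := rsum E0 (fun j => `|tau a u j - tau a u' j|).

Lemma sdist_summable a u u' : box u -> box u' ->
  abs_summable E0 (fun j => `|tau a u j - tau a u' j|).
Proof.
move=> bu bu'; apply: abs_summable_le (gp_sum gp) => j _.
by rewrite normr_id; apply: box_dist; exact: box_tau.
Qed.

Lemma sdist_ge0 a u u' : 0 <= sdist a u u'.
Proof. by apply: rsum_ge0 => j _. Qed.

Definition gap : R := rsum E0 (fun j => w j - v j).

Lemma sdist_le a u u' : box u -> box u' -> sdist a u u' <= gap.
Proof.
move=> bu bu'; apply: le_rsum; [exact: sdist_summable|exact: gp_sum gp|].
by move=> j _; apply: box_dist; exact: box_tau.
Qed.

Lemma gap_ge0 : 0 <= gap.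
Proof. by apply: le_trans (sdist_ge0 0 v v) (sdist_le _ box_v box_v). Qed.

Lemma sdistC a u u' : sdist a u u' = sdist a u' u.
Proof. by apply: eq_rsum => j _; rewrite distrC. Qed.

Lemma sdist_triangle a u u' u'' : box u -> box u' -> box u'' ->
  sdist a u u'' <= sdist a u u' + sdist a u' u''.
Proof.
move=> b b' b''; rewrite -rsumD; try exact: sdist_summable.
apply: le_rsum; [exact: sdist_summable|by apply: abs_summableD; exact: sdist_summable|].
by move=> j _; exact: ler_distD.
Qed.

Lemma sdist_mono a b u u' u1 u1' : box u -> box u' -> box u1 -> box u1' ->
  (forall j, E0 j -> `|tau a u j - tau a u' j| <= `|tau b u1 j - tau b u1' j|) ->
  sdist a u u' <= sdist b u1 u1'.
Proof. by move=> *; apply: le_rsum => //; exact: sdist_summable. Qed.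

Lemma sdist_eq0 a u u' : (forall j, E0 j -> tau a u j = tau a u' j) -> sdist a u u' = 0.
Proof. by move=> h; apply: rsum0 => j /h ->; rewrite subrr normr0. Qed.

Lemma sdist_tau a b u u' : sdist a (tau b u) (tau b u') = sdist (a + b) u u'.
Proof. by rewrite /sdist !tauN_add. Qed.

Lemma dep_absB u u' : dep m u -> dep m u' -> dep m (fun j => `|u j - u' j|).
Proof. by move=> du du' i i' h; rewrite (du _ _ h) (du' _ _ h). Qed.

Lemma energy0_lip u u' : box u -> box u' ->
  `|energy0 u - energy0 u'| <= lip * \sum_(k <- ball_enum n r) sdist ((val k) ord0 ko) u u'.
Proof.
move=> bu bu'; rewrite energy0B//.
apply: le_trans (ler_norm_rsum (S_summable bu bu')) _.
have sk (k : ball0 n r) : abs_summable E0 (fun j => `|u (val k + j) - u' (val k + j)|).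
  have du : dep m (fun j => `|u j - u' j|) by apply: dep_absB; [case: bu|case: bu'].
  have := @abs_summable_slice_shift R n p pn _ (val k) du.
  by apply; exact: (sdist_summable _ bu bu').
have -> : lip * \sum_(k <- ball_enum n r) sdist ((val k) ord0 ko) u u' =
    rsum E0 (fun j => lip * \sum_(k <- ball_enum n r) `|u (val k + j) - u' (val k + j)|).
  rewrite rsumZ//; last by apply: abs_summable_sum.
  rewrite rsum_sum//; congr (_ * _); apply: eq_bigr => k _.
  rewrite (rsum_slice_shift pn (f := fun j => `|u j - u' j|))//.
  by apply: dep_absB; [case: bu|case: bu'].
apply: le_rsum; first exact: abs_summable_norm (S_summable bu bu').
  by apply: abs_summableZ; apply: abs_summable_sum.
by move=> j _; exact: lipP.2.
Qed.

Lemma energy0_cvg (I : Type) (G : set_system I) (FG : ProperFilter G) (U : I -> config R n) u :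
  (forall x, box (U x)) -> box u -> (forall j, U x j @[x --> G] --> u j) ->
  energy0 (U x) @[x --> G] --> energy0 u.
Proof.
move=> bU bu Uu; apply: (rsum_dominated FG majorant_summable).
- by move=> x j _; exact: majorant_bound (bU x) box_v.
- by move=> j _; exact: majorant_bound bu box_v.
- move=> j _; apply: cvgB; last exact: cvg_cst.
  by apply: (@C0_cvg R n r s I G _ (fun x => loc j (U x)) (loc j u) (s_C0 hs)) => k; exact: Uu.
Qed.

Lemma sdist_cvg (I : Type) (G : set_system I) (FG : ProperFilter G) (U : I -> config R n)
    (a : I -> int) u z : box z ->
  (forall x, box (U x)) -> box u -> (forall j, tau (a x) (U x) j @[x --> G] --> u j) ->
  (forall x, tau x z = z) ->
  sdist (a x) (U x) z @[x --> G] --> sdist 0 u z.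
Proof.
move=> bz bU bu Uu tz; apply: (rsum_dominated FG (gp_sum gp)).
- by move=> x j _; rewrite normr_id; apply: box_dist; exact: box_tau.
- by move=> j _; rewrite normr_id; apply: box_dist; exact: box_tau.
- move=> j _; apply: cvg_norm; rewrite tauN0 tz.
  under eq_fun do rewrite tz.
  by apply: cvgB; [exact: Uu|exact: cvg_cst].
Qed.

(** In the notation of the statement [energy a u] is J_{m,a}(u), and [window q N u] below is
J_{m;q,q+N-1}(u). *)
Definition energy a u : R := energy0 (tau a u).
Definition window (q : int) (N : nat) u : R := \sum_(k < N) energy (q + k%:Z) u.

Lemma energy_tau a b u : energy a (tau b u) = energy (a + b) u.
Proof. by rewrite /energy tauN_add. Qed.

Lemma window_tau q N b u : window q N (tau b u) = window (q + b) N u.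
Proof. by apply: eq_bigr => k _; rewrite energy_tau addrAC. Qed.

Lemma window_cat q N M u : window q (N + M) u = window q N u + window (q + N%:Z) M u.
Proof.
rewrite /window big_split_ord/=; congr (_ + _); apply: eq_bigr => k _.
by congr (energy _ u); rewrite /= PoszD addrA.
Qed.

Lemma window0 q u : window q 0 u = 0. Proof. by rewrite /window big_ord0. Qed.

Definition Klip : R := lip * (size (ball_enum n r))%:R.

Lemma Klip_ge0 : 0 <= Klip.
Proof. by rewrite mulr_ge0// lipP.1. Qed.

Lemma sdist_le_window (a c : int) u u' : (`|c| <= r)%N ->
  sdist (c + a) u u' <= \sum_(h < (r + r).+1) sdist (a + h%:Z - r%:Z) u u'.
Proof.
move=> cr; have hc : (absz (c + r%:Z)%R < (r + r).+1)%N by lia.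
rewrite (bigD1 (Ordinal hc))//=.
have -> : a + (absz (c + r%:Z))%:Z - r%:Z = c + a by lia.
by rewrite lerDl; apply: sumr_ge0 => h _; exact: sdist_ge0.
Qed.

Lemma energy_lip a u u' : box u -> box u' ->
  `|energy a u - energy a u'| <= Klip * \sum_(h < (r + r).+1) sdist (a + h%:Z - r%:Z) u u'.
Proof.
move=> bu bu'; apply: le_trans (energy0_lip (box_tau a bu) (box_tau a bu')) _.
rewrite /Klip -mulrA ler_wpM2l ?lipP.1//.
set T := \sum_(h < _) _.
have -> : (size (ball_enum n r))%:R * T = \sum_(k <- ball_enum n r) T.
  by rewrite big_const_seq count_predT iter_addr_0 mulr_natl.
apply: ler_sum => k _; rewrite sdist_tau; apply: sdist_le_window; exact: ball_coord.
Qed.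

Lemma sum_lt (N a : nat) : (\sum_(k < N) (k < a) <= a)%N.
Proof.
apply: (@leq_trans (minn N a)); last exact: geq_minr.
elim: N => [|N IH]; first by rewrite big_ord0.
rewrite big_ord_recr /=; apply: (@leq_trans (minn N a + (N < a))); first by rewrite leq_add2r.
by case: (ltnP N a); lia.
Qed.

Lemma sum_boundary (N a : nat) : (\sum_(k < N) ((k < a) || (N <= k + a)) <= a + a)%N.
Proof.
apply: (@leq_trans (\sum_(k < N) (k < a) + \sum_(k < N) (k < a))).
  rewrite [X in (_ <= _ + X)%N](reindex_inj rev_ord_inj) -big_split/=.
  apply: leq_sum => k _; have := ltn_ord k; lia.
by rewrite leq_add// sum_lt.
Qed.

(** At most 4 r slices near the two ends of a window matter, and each one is seen from 2 r + 1
slices. *)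
Definition Kdiff : R := Klip * ((r + r).+1 * (r + r + (r + r)))%:R.

Lemma Kdiff_ge0 : 0 <= Kdiff. Proof. by rewrite mulr_ge0// Klip_ge0. Qed.

(** Configurations that agree inside a window have energies that differ through the slices near
its ends only. *)
Lemma window_diff q N u u' (e : R) : box u -> box u' -> 0 <= e ->
  (forall x : int, - r%:Z <= x -> x < N%:Z + r%:Z -> sdist (q + x) u u' <= e) ->
  (forall x : int, r%:Z <= x -> x < N%:Z - r%:Z -> sdist (q + x) u u' = 0) ->
  `|window q N u - window q N u'| <= Kdiff * e.
Proof.
move=> bu bu' e0 de d0; rewrite /window -sumrB.
apply: le_trans (ler_norm_sum _ _ _) _.
apply: (@le_trans _ _ (\sum_(k < N) Klip * \sum_(h < (r + r).+1)
    sdist (q + k%:Z + h%:Z - r%:Z) u u')).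
  by apply: ler_sum => k _; exact: energy_lip.
rewrite -mulr_sumr /Kdiff -mulrA ler_wpM2l ?Klip_ge0// exchange_big/=.
have -> : ((r + r).+1 * (r + r + (r + r)))%:R * e =
    \sum_(h < (r + r).+1) ((r + r + (r + r))%:R * e).
  by rewrite sumr_const card_ord natrM -mulrA mulr_natl.
apply: ler_sum => h _.
apply: (@le_trans _ _ (\sum_(k < N) ((k < r + r)%N || (N <= k + (r + r))%N)%:R * e)).
  apply: ler_sum => k _; have hh := ltn_ord h; have hk := ltn_ord k.
  have -> : q + k%:Z + h%:Z - r%:Z = q + (k%:Z + h%:Z - r%:Z) by lia.
  have [b|nb] := boolP ((k < r + r)%N || (N <= k + (r + r))%N);
    rewrite ?mul1r ?mul0r; first by apply: de; lia.
  by rewrite d0//; lia.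
by rewrite -mulr_suml ler_wpM2r// -natr_sum ler_nat sum_boundary.
Qed.

(** * Lower bounds for the energy of windows *)

Lemma dep_of_tau1 u : dep m u -> tau 1 u = u -> dep p u.
Proof.
move=> du tu; apply/depP => k /andP[pk kn] i.
have [->|kp] := eqVneq k p.+1.
  by rewrite -[in RHS]tu /tauN /translate scale1r.
by move/depP : du => -> //; lia.
Qed.

Lemma perm_cycle (f : int -> R) (N : nat) : f N%:Z = f 0 ->
  perm_eq [seq f k%:Z | k <- iota 1 N] [seq f k%:Z | k <- iota 0 N].
Proof.
case: N => // N fN; rewrite -{1}[N.+1]addn1 iotaD map_cat perm_catC /=.
by rewrite add1n fN.
Qed.

(** The unit shift permutes the list of the N shifts of u, so the order statistics of the list are
invariant under it.  They have nonnegative energy since the pair is good, and the energies of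
the shifts have at least the same sum. *)
Lemma periodic_energy_ge0 N u : box u -> tau N%:Z u = u -> 0 <= window 0 N u.
Proof.
move=> bu tu.
pose fs := [seq tau k%:Z u | k <- iota 0 N].
have sz : size fs = N by rewrite size_map size_iota.
have bfs f : List.In f fs -> box f.
  rewrite /fs; elim: (iota 0 N) => //= k ks IH [<-|/IH//]; exact: box_tau.
have [bgs en] := order_stats_energy box_min box_max energy0_submodular bfs.
have -> : window 0 N u = \sum_(f <- fs) energy0 f.
  rewrite big_map (_ : iota 0 N = index_iota 0 N) ?/index_iota ?subn0//.
  rewrite -[in RHS](subn0 N) -/(index_iota 0 N) big_mkord.
  by apply: eq_bigr => k _; rewrite add0r.
apply: le_trans en; rewrite (big_nth v) big_mkord; apply: sumr_ge0 => k _.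
set g := nth v (order_stats fs) k.
have kN : (k < size fs)%N by move: (ltn_ord k); rewrite [X in (_ < X)%N]size_order_stats.
have bg : box g by apply: bgs; apply: In_nth.
suff tg : tau 1 g = g.
  have [g1 g2 g3] := bg.
  by have [] := gp_min gp g1 g2 (dep_of_tau1 g3 tg).
apply/funext => i; rewrite /tauN /translate /g !nth_order_stats//; congr (nth 0 _ k).
apply: eq_sort_values.
have e1 x : [seq f x | f <- fs] = [seq u (x + k%:Z *: unit_vec n m) | k <- iota 0 N].
  by rewrite /fs -map_comp.
rewrite !e1.
have -> : [seq u (i + 1 *: unit_vec n m + k%:Z *: unit_vec n m) | k <- iota 0 N] =
    [seq u (i + k%:Z *: unit_vec n m) | k <- iota 1 N].
  rewrite -[1%N]/(1 + 0)%N iotaDl -map_comp; apply: eq_map => h /=.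
  by rewrite -addrA -scalerDl -PoszD.
apply: (perm_cycle (f := fun c : int => u (i + c *: unit_vec n m))).
by rewrite scale0r addr0 -[in RHS]tu.
Qed.

Definition periodic_extension (q : int) (N : nat) u : config R n := fun i =>
  u (i + (q + ((i ord0 ko - q)%R %% N%:Z)%Z - i ord0 ko) *: unit_vec n m).

Lemma unit_vec_coord_ko (a : int) i : (i + a *: unit_vec n m) ord0 ko = i ord0 ko + a.
Proof. by rewrite !mxE /= eqxx mulr1. Qed.

Lemma slice_ko a j : slice m a j -> j ord0 ko = a.
Proof. by move=> /(_ ko)[h _]; exact: h. Qed.

Lemma dep_p_shift (c : int) u i : dep p u -> u (i + c *: unit_vec n m) = u i.
Proof. by move=> du; rewrite -[in RHS](dep_tauN_id c du). Qed.

Lemma box_periodic_extension q N u : box u -> box (periodic_extension q N u).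
Proof.
move=> [h1 h2 h3]; split=> [i|i|i i' ii'].
- rewrite /periodic_extension; set c := (X in X *: _).
  by rewrite -[leLHS](dep_p_shift c i (gp_depv gp)); exact: h1.
- rewrite /periodic_extension; set c := (X in X *: _).
  by rewrite -[leRHS](dep_p_shift c i (gp_depw gp)); exact: h2.
- rewrite /periodic_extension; have -> : i ord0 ko = i' ord0 ko by exact: ii'.
  by apply: h3 => l lm; rewrite mxE ii'// [in RHS]mxE.
Qed.

Lemma periodic_extension_slice q N u x j : E0 j ->
  tau (q + x) (periodic_extension q N u) j = tau (q + (x %% N%:Z)%Z) u j.
Proof.
move=> /slice_ko j0; rewrite /tauN /translate /periodic_extension unit_vec_coord_ko j0 add0r.
rewrite -addrA -scalerDl; congr (u (j + _ *: _)).
rewrite [in (q + x - q)%R]addrAC subrr add0r; lia.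
Qed.

Lemma tau_periodic_extension q N u : tau N%:Z (periodic_extension q N u) = periodic_extension q N u.
Proof.
apply/funext => i; rewrite /tauN /translate /periodic_extension unit_vec_coord_ko -addrA -scalerDl.
have -> : ((i ord0 ko + N%:Z - q)%R %% N%:Z)%Z = ((i ord0 ko - q)%R %% N%:Z)%Z.
  by rewrite addrAC modzDr.
congr (u (i + _ *: _)); lia.
Qed.

(** Replace u outside the window by its periodic extension.  Near the ends of the window both are
close to z, which is constant in direction m, and the extension has nonnegative energy. *)
Lemma window_lower_bound q N u z (e : R) : box u -> box z -> dep p z -> 0 <= e ->
  (forall x : int, - r%:Z <= x -> x < N%:Z + r%:Z -> sdist (q + x) u z <= e) ->
  - (Kdiff * (e + e)) <= window q N u.
Proof.
move=> bu bz dz e0 de; case: N de => [|N] de.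
  by rewrite window0 oppr_le0 mulr_ge0 ?Kdiff_ge0// addr_ge0.
set t := periodic_extension q N.+1 u.
have bt : box t by exact: box_periodic_extension.
have Jt : 0 <= window q N.+1 t.
  rewrite -[q]add0r -window_tau; apply: periodic_energy_ge0; first exact: box_tau.
  by rewrite tauN_add addrC -tauN_add tau_periodic_extension.
have dmod (x : int) : 0 <= ((x %% N.+1%:Z)%Z) /\ ((x %% N.+1%:Z)%Z) < N.+1%:Z.
  by split; [apply: modz_ge0|apply: ltz_pmod].
have := @window_diff q N.+1 u t (e + e) bu bt.
move=> /(_ (addr_ge0 e0 e0)) H.
have {}H : `|window q N.+1 u - window q N.+1 t| <= Kdiff * (e + e).
  apply: H => x x1 x2.
    apply: le_trans (sdist_triangle _ bu bz bt) _; apply: lerD; first exact: de.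
    have [m1 m2] := dmod x.
    apply: (@le_trans _ _ (sdist (q + (x %% N.+1%:Z)%Z) u z)); last by apply: de; lia.
    rewrite sdistC; apply: sdist_mono => // j Ej.
    by rewrite /t periodic_extension_slice// !(dep_tauN_id _ dz).
  apply: sdist_eq0 => j Ej; rewrite /t periodic_extension_slice// modz_small//; lia.
by move: H; rewrite ler_norml => /andP[]; move: Jt; lra.
Qed.

Definition Ktail : R := Kdiff + Kdiff.

Lemma Ktail_ge0 : 0 <= Ktail. Proof. by rewrite addr_ge0// Kdiff_ge0. Qed.

Lemma window_ge_v q N u (e : R) : box u -> 0 <= e ->
  (forall x : int, q - r%:Z <= x -> x < q + N%:Z + r%:Z -> sdist x u v <= e) ->
  - (Ktail * e) <= window q N u.
Proof.
move=> bu e0 de; rewrite mulrDl -mulrDr.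
by apply: (window_lower_bound bu box_v (gp_depv gp) e0) => x x1 x2; apply: de; lia.
Qed.

Lemma window_ge_w q N u (e : R) : box u -> 0 <= e ->
  (forall x : int, q - r%:Z <= x -> x < q + N%:Z + r%:Z -> sdist x u w <= e) ->
  - (Ktail * e) <= window q N u.
Proof.
move=> bu e0 de; rewrite mulrDl -mulrDr.
by apply: (window_lower_bound bu box_w (gp_depw gp) e0) => x x1 x2; apply: de; lia.
Qed.

Lemma window_ge q N u : box u -> - (Ktail * gap) <= window q N u.
Proof.
move=> bu; apply: window_ge_v => // [|x _ _]; first exact: gap_ge0.
exact: sdist_le bu box_v.
Qed.

(** In the notation of the statement, J_{m;-a,b}(u). *)
Definition central (a b : nat) u : R := window (- a%:Z) (a + b).+1 u.

Lemma Jpartial_real (c : R) u (a b : nat) : box u ->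
  Jpartial s m c%:E v (- a%:Z) b%:Z u = (central a b u)%:E.
Proof.
move=> bu; rewrite /Jpartial /central /window.
have -> : absz (b%:Z - - a%:Z) = (a + b)%N by lia.
rewrite big_mkord -sumEFin; apply: eq_bigr => k _.
rewrite /Jslice /Jext asum_rsum; last exact: (S_summable (box_tau _ bu) box_v).
by rewrite -EFinD addrAC subrr add0r.
Qed.

(** * The functional as a limit of windows *)

Section JBounds.
Variables (c : R) (u : config R n).
Hypothesis bu : box u.

Lemma JE : J s m c%:E v u =
  ereal_sup [set ereal_inf ((fun a : nat * nat => (central a.1 a.2 u)%:E) @` V) |
     V in filter_prod \oo \oo].
Proof.
rewrite /J limf_einfE; congr ereal_sup.
suff -> : (fun a : nat * nat => Jpartial s m c%:E v (- a.1%:Z) a.2%:Z u) =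
  (fun a : nat * nat => (central a.1 a.2 u)%:E) by [].
by apply/funext => a; apply: (Jpartial_real _ _ _ bu).
Qed.

Lemma J_ge (B : R) :
  (exists N : nat, forall a b : nat, (N <= a)%N -> (N <= b)%N -> B <= central a b u) ->
  (B%:E <= J s m c%:E v u)%E.
Proof.
move=> [N H]; rewrite JE.
pose V : set (nat * nat) := [set x | (N <= x.1)%N /\ (N <= x.2)%N].
have FV : filter_prod \oo \oo V.
  exists ([set k | (N <= k)%N], [set k | (N <= k)%N]); first by split; exists N.
  by move=> x [].
apply: le_trans (ereal_sup_ubound _); last by exists V.
by apply: le_ereal_inf_tmp => _ [x [x1 x2] <-]; rewrite lee_fin; exact: H.
Qed.

Lemma J_le (B : R) :
  (forall N : nat, exists a b : nat, [/\ (N <= a)%N, (N <= b)%N & central a b u <= B]) ->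
  (J s m c%:E v u <= B%:E)%E.
Proof.
move=> H; rewrite JE; apply: ge_ereal_sup => _ [V [[P Q] [[N1 _ NP] [N2 _ NQ]] PQV] <-].
have [a [b [Na Nb WB]]] := H (maxn N1 N2).
apply: (@le_trans _ _ (central a b u)%:E); last by rewrite lee_fin.
apply: ereal_inf_lbound; exists (a, b) => //; apply: PQV; split; rewrite /=.
  by apply: NP => /=; rewrite (leq_trans _ Na)// leq_maxl.
by apply: NQ => /=; rewrite (leq_trans _ Nb)// leq_maxr.
Qed.

End JBounds.

Definition tail_v u := forall e : R, 0 < e ->
  exists N : nat, forall x : int, x <= - N%:Z -> sdist x u v <= e.
Definition tail_w u := forall e : R, 0 < e ->
  exists N : nat, forall x : int, N%:Z <= x -> sdist x u w <= e.

Lemma l1norm_on_slice a u z : box u -> box z ->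
  l1norm_on (slice m a) (fun j => u j - z j) = (sdist a u z)%:E.
Proof.
move=> bu bz; rewrite /l1norm_on (reindex_esum _ _ _ _ (slice_tau_bij pn a)).
by rewrite /sdist ge0_rsumE// fineK//; apply: esum_fin_num => //; exact: sdist_summable.
Qed.

Lemma GammaP u : Gamma m v w u <-> [/\ box u, tail_v u & tail_w u].
Proof.
have E1 : box u -> (fun i : nat => l1norm_on (slice m (- i%:Z)) (fun j => u j - v j)) =
    (fun i : nat => (sdist (- i%:Z) u v)%:E).
  by move=> bu; apply/funext => i; rewrite (l1norm_on_slice _ bu box_v).
have E2 : box u -> (fun i : nat => l1norm_on (slice m i%:Z) (fun j => u j - w j)) =
    (fun i : nat => (sdist i%:Z u w)%:E).
  by move=> bu; apply/funext => i; rewrite (l1norm_on_slice _ bu box_w).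
rewrite /Gamma -boxE; split=> [[bu]|[bu tv tw]].
  rewrite E1// E2// => /(cvg_EFin0 (fun i : nat => sdist_ge0 _ _ _)) tv.
  move=> /(cvg_EFin0 (fun i : nat => sdist_ge0 _ _ _)) tw; split=> // e e0.
    have [N HN] := tv e e0; exists N => x xN.
    by have -> : x = - (absz x)%:Z by [lia|]; apply: HN; lia.
  have [N HN] := tw e e0; exists N => x xN.
  by have -> : x = (absz x)%:Z by [lia|]; apply: HN; lia.
split; rewrite ?E1 ?E2//; apply/(cvg_EFin0 (fun i : nat => sdist_ge0 _ _ _)) => e e0.
  have [N HN] := tv e e0; exists N => i iN; apply: HN; lia.
have [N HN] := tw e e0; exists N => i iN; apply: HN; lia.
Qed.

Lemma central_split u (a b a' b' : nat) : (a <= a')%N -> (b <= b')%N ->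
  central a' b' u = window (- a'%:Z) (a' - a) u + central a b u + window (b.+1)%:Z (b' - b) u.
Proof.
move=> aa bb; rewrite /central.
have -> : (a' + b').+1 = (a' - a + ((a + b).+1 + (b' - b)))%N by lia.
have e1 : - a'%:Z + (a' - a)%N%:Z = - a%:Z by lia.
have e2 : - a%:Z + (a + b).+1%:Z = b.+1%:Z by lia.
by rewrite !window_cat e1 e2 addrA.
Qed.

(** A larger window has two more parts, in which u is close to v or to w, and whose energies are
therefore almost nonnegative. *)
Lemma central_almost_nondecreasing u : box u -> tail_v u -> tail_w u ->
  forall e : R, 0 < e -> exists N : nat, forall a b a' b' : nat,
  (N <= a <= a')%N -> (N <= b <= b')%N -> central a b u - e <= central a' b' u.
Proof.
move=> bu tv tw e e0; have [e1 e10 Ce] := small_factor Ktail_ge0 (divr_gt0 e0 (ltr0n R 2)).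
have [N1 H1] := tv e1 e10; have [N2 H2] := tw e1 e10.
exists (N1 + N2 + r)%N => a b a' b' /andP[Na aa] /andP[Nb bb].
rewrite (central_split u aa bb).
have h1 : - (Ktail * e1) <= window (- a'%:Z) (a' - a) u.
  by apply: window_ge_v => // [|x _ x2]; [exact: ltW|apply: H1; lia].
have h2 : - (Ktail * e1) <= window (b.+1)%:Z (b' - b) u.
  by apply: window_ge_w => // [|x x1 _]; [exact: ltW|apply: H2; lia].
move: Ce h1 h2; lra.
Qed.

Lemma central_le_J (c : R) u : box u -> tail_v u -> tail_w u ->
  forall e : R, 0 < e -> exists N : nat, forall a b : nat, (N <= a)%N -> (N <= b)%N ->
  ((central a b u - e)%:E <= J s m c%:E v u)%E.
Proof.
move=> bu tv tw e e0; have [N HN] := central_almost_nondecreasing bu tv tw e0.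
exists N => a b Na Nb; apply: J_ge => //; exists (maxn a b) => a' b' a1 b1.
by apply: HN; lia.
Qed.

Lemma J_ge_central (c B : R) u : box u -> (B%:E <= J s m c%:E v u)%E ->
  forall e : R, 0 < e -> exists N : nat, forall a b : nat, (N <= a)%N -> (N <= b)%N ->
  B - e <= central a b u.
Proof.
move=> bu HB e e0; apply: contrapT => nH.
have : (J s m c%:E v u <= (B - e)%:E)%E.
  apply: J_le => // N; apply: contrapT => nab; apply: nH; exists N => a b Na Nb.
  by rewrite leNgt; apply/negP => /ltW Wab; apply: nab; exists a, b.
by move=> /(le_trans HB); rewrite lee_fin; lra.
Qed.

Lemma J_lower (c : R) u : box u -> ((- (Ktail * gap))%:E <= J s m c%:E v u)%E.
Proof. by move=> bu; apply: J_ge => //; exists 0%N => a b _ _; exact: window_ge. Qed.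

Definition slab (q : int) (N : nat) : set (lattice n) :=
  [set j : lattice n | (forall l : 'I_n, (p < l)%N -> j ord0 l = 0) /\
     q <= j ord0 ko < q + N%:Z].

Lemma slab_rsum q (f : lattice n -> R) N :
  (forall k : nat, (k < N)%N -> abs_summable (slice m (q + k%:Z)) f) ->
  abs_summable (slab q N) f /\
  rsum (slab q N) f = \sum_(k < N) rsum (slice m (q + k%:Z)) f.
Proof.
elim: N => [_|N IH sN].
  have e0 : slab q 0 = set0.
    by apply/seteqP; split=> // j [_ h]; exfalso; lia.
  by rewrite e0 big_ord0 rsum0//; split=> //; apply: abs_summable_fset; exact: finite_set0.
have [k kN|s1 e1] := IH; first by apply: sN; lia.
have U : slab q N.+1 = slab q N `|` slice m (q + N%:Z).
  apply/seteqP; split=> j.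
    move=> [h1 h2]; have [jN|jN] := eqVneq (j ord0 ko) (q + N%:Z); [right|left].
      by move=> l; split=> [[lp]|lp]; [have -> : l = ko by exact: val_inj|apply: h1].
    by split=> //; lia.
  case=> [[h1 h2]|h]; first by split=> //; lia.
  split=> [l lp|]; first by have [_] := h l; apply.
  by rewrite (slice_ko h); lia.
have sS : abs_summable (slab q N.+1) f by rewrite U; apply: abs_summableU => //; exact: sN.
split=> //; rewrite big_ord_recr/= -e1 (rsumID (slab q N) sS) U.
congr (_ + _); congr (rsum _ f); apply/seteqP; split=> j /=.
- by case.
- by move=> h; split=> //; left.
- by case=> -[].
- by move=> h; split; [right|case=> _; rewrite (slice_ko h); lia].
Qed.

Lemma S_tau a u j : S j (tau a u) = S (j + a *: unit_vec n m) u.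
Proof. by rewrite /local_potential; congr s; exact: (@loc_tauN R n r m a u j). Qed.

Lemma energy_diff a u u' : box u -> box u' ->
  abs_summable (slice m a) (fun j => S j u - S j u') /\
  energy a u - energy a u' = rsum (slice m a) (fun j => S j u - S j u').
Proof.
move=> bu bu'; have b1 := box_tau a bu; have b2 := box_tau a bu'.
have sS := S_summable b1 b2; split.
  apply: (abs_summable_reindex (slice_tau_bij pn a)).
  by apply: abs_summable_le (abs_summable_norm sS) => j _; rewrite /= !S_tau.
rewrite (rsum_reindex _ (slice_tau_bij pn a)) /energy energy0B//.
by apply: eq_rsum => j _; rewrite !S_tau.
Qed.

Lemma window_diff_slab q N u u' : box u -> box u' ->
  abs_summable (slab q N) (fun j => S j u - S j u') /\
  window q N u - window q N u' = rsum (slab q N) (fun j => S j u - S j u').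
Proof.
move=> bu bu'.
have [sS e] := @slab_rsum q (fun j => S j u - S j u') N (fun k _ => (energy_diff _ bu bu').1).
split=> //; rewrite e /window -sumrB; apply: eq_bigr => k _; exact: (energy_diff _ bu bu').2.
Qed.

Lemma gap_gt0 : 0 < gap.
Proof.
have h0 : E0 0 by move=> l; rewrite mxE.
have pos j : E0 j -> 0 <= w j - v j by move=> _; rewrite subr_ge0; exact: vw.
have sub : [set` [:: 0 : lattice n]] `<=` E0 by move=> j /=; rewrite inE => /eqP ->.
have := @sum_le_rsum R _ E0 _ [:: 0] pos (gp_sum gp) isT sub.
rewrite big_seq1; apply: lt_le_trans.
by rewrite subr_gt0; exact: gp_lt gp 0.
Qed.

Lemma sdist_vw a : sdist a v w = gap.
Proof.
apply: eq_rsum => j _; rewrite tau_v tau_w distrC ger0_norm// subr_ge0; exact: vw.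
Qed.

Lemma window_submodular q N u u' : box u -> box u' ->
  window q N (fmax u u') + window q N (fmin u u') <= window q N u + window q N u'.
Proof.
move=> bu bu'; rewrite /window -!big_split; apply: ler_sum => k _.
exact: (energy0_submodular (box_tau _ bu) (box_tau _ bu')).
Qed.

(** * Minimisers are ordered solutions *)

Section Minimisers.
Variables c cm : R.
Notation J := (J s m c%:E v).
Hypothesis cm_min : forall u, Gamma m v w u -> (cm%:E <= J u)%E.

Definition minimiser u := Gamma m v w u /\ J u = cm%:E.

Lemma minimiser_central u : minimiser u -> forall e : R, 0 < e -> exists N : nat,
  forall a b : nat, (N <= a)%N -> (N <= b)%N -> `|central a b u - cm| <= e.
Proof.
move=> [/GammaP[bu tv tw] Ju] e e0.
have [N1 H1] := central_le_J c bu tv tw e0.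
have := @J_ge_central c cm u bu; rewrite Ju => /(_ (lexx _) e e0)[N2 H2].
exists (N1 + N2)%N => a b Na Nb.
have := H1 a b; rewrite Ju lee_fin => /(_ _ _) h1.
have {}h1 : central a b u - e <= cm by apply: h1; lia.
have h2 : cm - e <= central a b u by apply: H2; lia.
by rewrite ler_norml; apply/andP; split; lra.
Qed.

Lemma minimiser_of_central u : Gamma m v w u ->
  (forall e : R, 0 < e -> exists N : nat,
    forall a b : nat, (N <= a)%N -> (N <= b)%N -> central a b u <= cm + e) -> minimiser u.
Proof.
move=> Gu H; split=> //; apply/eqP; rewrite eq_le cm_min// andbT.
apply/lee_addgt0Pr => e e0; have [N HN] := H e e0.
have [bu _ _] := (GammaP u).1 Gu.
rewrite -EFinD; apply: J_le => // N'; exists (N + N')%N, (N + N')%N.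
by split; [lia|lia|apply: HN; lia].
Qed.

Lemma sdist_le_add (a : int) u u1 u2 z : box u -> box u1 -> box u2 -> box z ->
  (forall j : lattice n, `|u j - z j| <= `|u1 j - z j| + `|u2 j - z j|) ->
  sdist a u z <= sdist a u1 z + sdist a u2 z.
Proof.
move=> b b1 b2 bz h; rewrite -rsumD; try exact: sdist_summable.
apply: le_rsum; [exact: sdist_summable|by apply: abs_summableD; exact: sdist_summable|].
by move=> j _; exact: h.
Qed.

Lemma Gamma_max_min u u' : Gamma m v w u -> Gamma m v w u' ->
  Gamma m v w (fmax u u') /\ Gamma m v w (fmin u u').
Proof.
move=> /GammaP[b tv tw] /GammaP[b' tv' tw'].
have bM := box_max b b'; have bm := box_min b b'.
have hM z j : `|fmax u u' j - z j| <= `|u j - z j| + `|u' j - z j|.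
  rewrite /fmax; case: (leP (u j) (u' j)) => _; rewrite ?lerDl ?lerDr//.
have hm z j : `|fmin u u' j - z j| <= `|u j - z j| + `|u' j - z j|.
  rewrite /fmin; case: (leP (u j) (u' j)) => _; rewrite ?lerDl ?lerDr//.
have H1 f : box f -> (forall z j, `|f j - z j| <= `|u j - z j| + `|u' j - z j|) -> tail_v f.
  move=> bf hf e e0; have e2 : 0 < e / 2 by rewrite divr_gt0.
  have [N1 H1] := tv _ e2; have [N2 H2] := tv' _ e2; exists (N1 + N2)%N => x xN.
  apply: le_trans (sdist_le_add x bf b b' box_v (hf v)) _.
  have h1 : sdist x u v <= e / 2 by apply: H1; lia.
  have h2 : sdist x u' v <= e / 2 by apply: H2; lia.
  lra.
have H2 f : box f -> (forall z j, `|f j - z j| <= `|u j - z j| + `|u' j - z j|) -> tail_w f.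
  move=> bf hf e e0; have e2 : 0 < e / 2 by rewrite divr_gt0.
  have [N1 H1'] := tw _ e2; have [N2 H2] := tw' _ e2; exists (N1 + N2)%N => x xN.
  apply: le_trans (sdist_le_add x bf b b' box_w (hf w)) _.
  have h1 : sdist x u w <= e / 2 by apply: H1'; lia.
  have h2 : sdist x u' w <= e / 2 by apply: H2; lia.
  lra.
by split; apply/GammaP; split=> //; [exact: H1|exact: H2|exact: H1|exact: H2].
Qed.

(** Submodularity holds on every window, and neither the maximum nor the minimum can have less
than the minimal energy. *)
Lemma minimiser_max_min u u' : minimiser u -> minimiser u' ->
  minimiser (fmax u u') /\ minimiser (fmin u u').
Proof.
move=> mu mu'; have [GM Gm] := Gamma_max_min mu.1 mu'.1.
have [bu _ _] := (GammaP u).1 mu.1; have [bu' _ _] := (GammaP u').1 mu'.1.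
have [bM _ _] := (GammaP _).1 GM; have [bm _ _] := (GammaP _).1 Gm.
have key e : 0 < e -> exists N : nat, forall a b : nat, (N <= a)%N -> (N <= b)%N ->
    central a b (fmax u u') <= cm + e /\ central a b (fmin u u') <= cm + e.
  move=> e0; have e3 : 0 < e / 3 by rewrite divr_gt0.
  have [N1 H1] := minimiser_central mu e3; have [N2 H2] := minimiser_central mu' e3.
  have [N3 H3] := J_ge_central bM (cm_min GM) e3; have [N4 H4] := J_ge_central bm (cm_min Gm) e3.
  exists (N1 + N2 + N3 + N4)%N => a b Na Nb.
  have : central a b (fmax u u') + central a b (fmin u u') <= central a b u + central a b u'.
    exact: window_submodular.
  have : `|central a b u - cm| <= e / 3 by apply: H1; lia.
  have : `|central a b u' - cm| <= e / 3 by apply: H2; lia.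
  have : cm - e / 3 <= central a b (fmax u u') by apply: H3; lia.
  have : cm - e / 3 <= central a b (fmin u u') by apply: H4; lia.
  by rewrite !ler_norml => ? ? /andP[? ?] /andP[? ?] ?; split; lra.
by split; apply: minimiser_of_central => // e /key[N HN]; exists N => a b Na Nb;
  have [] := HN a b Na Nb.
Qed.

Section Perturbation.
Variables (U : config R n) (mU : minimiser U) (i0 : lattice n).

Let bU : box U. Proof. by have [] := (GammaP U).1 mU.1. Qed.

Definition fibre i : bool := [forall l : 'I_n, (l < m)%N ==> (i ord0 l == i0 ord0 l)].

Lemma fibreP i : reflect (forall l : 'I_n, (l < m)%N -> i ord0 l = i0 ord0 l) (fibre i).
Proof.
apply: (iffP forallP) => h l; first by move=> lm; apply/eqP; exact: (implyP (h l)).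
by apply/implyP => lm; apply/eqP; exact: h.
Qed.

(** A variation of U at i0 must stay constant in the coordinates beyond m, hence it changes U on the
whole fibre of i0. *)
Definition perturb (t : R) : config R n := fun i => U i + (if fibre i then t else 0).

Lemma box_perturb t : v i0 <= U i0 + t -> U i0 + t <= w i0 -> box (perturb t).
Proof.
move=> vt tw; have [h1 h2 h3] := bU; split=> [i|i|i i' ii'].
- rewrite /perturb; case: (fibreP i) => [ho|_]; last by rewrite addr0.
  by rewrite (dep_mv (i' := i0))// (h3 i i0).
- rewrite /perturb; case: (fibreP i) => [ho|_]; last by rewrite addr0.
  by rewrite (dep_mw (i' := i0))// (h3 i i0).
- have -> : perturb t i = U i + (if fibre i' then t else 0); last by rewrite (h3 _ _ ii').
  rewrite /perturb; have -> // : fibre i = fibre i'.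
  by apply: eq_forallb => l; case: (boolP (l < m)%N) => //= lm; rewrite ii'.
Qed.

Lemma perturb_far t x j : E0 j -> x != i0 ord0 ko -> tau x (perturb t) j = tau x U j.
Proof.
move=> Ej xi; rewrite /tauN /translate /perturb; case: fibreP => [ho|_]; last by rewrite addr0.
have := ho ko (ltnSn p); rewrite unit_vec_coord_ko (slice_ko Ej) add0r => e.
by rewrite e eqxx in xi.
Qed.

Lemma Gamma_perturb t : box (perturb t) -> Gamma m v w (perturb t).
Proof.
move=> bt; have [_ tv tw] := (GammaP U).1 mU.1.
apply/GammaP; split=> // e e0.
  have [N HN] := tv e e0; exists (N + absz (i0 ord0 ko) + 1)%N => x xN.
  apply: (@le_trans _ _ (sdist x U v)); last by apply: HN; lia.
  by apply: (sdist_mono bt box_v bU box_v) => j Ej; rewrite perturb_far//; lia.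
have [N HN] := tw e e0; exists (N + absz (i0 ord0 ko) + 1)%N => x xN.
apply: (@le_trans _ _ (sdist x U w)); last by apply: HN; lia.
by apply: (sdist_mono bt box_w bU box_w) => j Ej; rewrite perturb_far//; lia.
Qed.

Definition foot (k : lattice n) : lattice n :=
  \row_l (if (l < m)%N then i0 ord0 l - k ord0 l else 0).

Definition feet : seq (lattice n) := undup [seq foot (val k) | k <- ball_enum n r].

(** Hence each offset contributes exactly one local potential to the variation of the energy along
the fibre. *)
Lemma foot_unique (k j : lattice n) : (forall l : 'I_n, (p < l)%N -> j ord0 l = 0) ->
  fibre (k + j) = (j == foot k).
Proof.
move=> j0; apply/fibreP/eqP => [ho|-> l lm].
  apply/rowP => l; rewrite mxE; case: ltnP => lm; last exact: j0.
  by rewrite -(ho l lm) mxE addrAC subrr add0r.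
by rewrite !mxE lm addrC subrK.
Qed.

Lemma feet0 j : j \in feet -> forall l : 'I_n, (p < l)%N -> j ord0 l = 0.
Proof.
rewrite mem_undup => /mapP[k _ ->] l lp; rewrite mxE ltnS leqNgt lp//.
Qed.

Definition Delta (t : R) : R := \sum_(j <- feet) (S j (perturb t) - S j U).

Lemma S_perturb t j : S j (perturb t) =
  s (fun k => loc j U k + (if fibre (val k + j) then t else 0)).
Proof. by []. Qed.

Lemma central_perturb t : box (perturb t) -> exists N : nat, forall a b : nat,
  (N <= a)%N -> (N <= b)%N -> central a b (perturb t) - central a b U = Delta t.
Proof.
move=> bt; exists (absz (i0 ord0 ko) + r)%N => a b Na Nb.
rewrite /central; have [sS ->] := window_diff_slab (- a%:Z) (a + b).+1 bt bU.
rewrite /Delta -rsum_fset ?undup_uniq//; apply: rsum_sub.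
  move=> j /= jf; split; first exact: feet0.
  move: jf; rewrite mem_undup => /mapP[k _ ->]; rewrite mxE ltnSn.
  have := ball_coord k ko; move: ((val k) ord0 ko) (i0 ord0 ko) Na Nb => x y; lia.
move=> j [j0 _] jF; apply/eqP; rewrite subr_eq0 S_perturb; apply/eqP; congr s.
apply/funext => k; rewrite foot_unique//; case: eqP => [e|_]; last by rewrite addr0.
case: jF; rewrite /= mem_undup; apply/mapP; exists k => //; exact: mem_ball_enum.
Qed.

Lemma Delta_ge0 t : box (perturb t) -> 0 <= Delta t.
Proof.
move=> bt; apply/ler_addgt0Pr => e e0; have e2 : 0 < e / 2 by rewrite divr_gt0.
have [N1 H1] := central_perturb bt; have [N2 H2] := minimiser_central mU e2.
have [N3 H3] := J_ge_central bt (cm_min (Gamma_perturb bt)) e2.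
pose N := (N1 + N2 + N3)%N.
have : central N N (perturb t) - central N N U = Delta t by apply: H1; rewrite /N; lia.
have : `|central N N U - cm| <= e / 2 by apply: H2; rewrite /N; lia.
have : cm - e / 2 <= central N N (perturb t) by apply: H3; rewrite /N; lia.
by rewrite ler_norml => ? /andP[? ?] ?; lra.
Qed.

(** The fibre is seen once through each offset, so the derivative of the sum over the feet is the
Euler-Lagrange sum at i0. *)
Lemma Delta_derivative : Delta t / t @[t --> 0^'] --> grad s U i0.
Proof.
have -> : (fun t => Delta t / t) =
    (fun t => \sum_(j <- feet) ((S j (perturb t) - S j U) / t)).
  by apply/funext => t; rewrite mulr_suml.
have -> : grad s U i0 = \sum_(j <- feet)
    \sum_(k <- ball_enum n r | fibre (val k + j)) partial k s (loc j U).
  rewrite [RHS](exchange_big_dep xpredT)//=; apply: eq_bigr => k _.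
  rewrite big_seq_cond (eq_bigl (fun j => (j \in feet) && (j == foot (val k)))); last first.
    by move=> j; case: (boolP (j \in feet)) => //= jf; rewrite foot_unique//; exact: feet0.
  rewrite -big_seq_cond -big_filter.
  have fk : foot (val k) \in feet.
    by rewrite mem_undup; apply/mapP; exists k => //; exact: mem_ball_enum.
  rewrite filter_pred1_uniq ?undup_uniq// big_seq1.
  congr (partial k s _); apply/funext => b; rewrite /loc.
  have [_ _ dU] := bU; apply: dU => l lm; rewrite !mxE lm.
  by case: ltnP lm => // _ _; rewrite ?mxE.
apply: cvg_sumr => j _.
exact: (@s_dir_derivative R n r s hs (fun k : ball0 n r => fibre (val k + j)) (loc j U)).
Qed.

(** Below w the variable U(i0) may be raised, which gives one inequality; at a contact with w the
same inequality follows by comparison with the solution w.  The other one is symmetric, with v. *)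
Lemma grad_minimiser : grad s U i0 = 0.
Proof.
have [h1 h2 h3] := bU.
apply/eqP; rewrite eq_le; apply/andP; split.
  have : (v i0 == U i0) || (v i0 < U i0) by rewrite -le_eqVlt; exact: h1.
  move=> /orP[/eqP vU|vU].
    by rewrite -(gp_ELv gp i0); apply: grad_le.
  have d0 : 0 < U i0 - v i0 by rewrite subr_gt0.
  apply: (dnbhs0_sign d0 Delta_derivative).2 => t t0 td.
  apply: mulr_ge0_le0; last by rewrite invr_le0 ltW.
  by apply: Delta_ge0; apply: box_perturb; have := h2 i0; lra.
have : (U i0 == w i0) || (U i0 < w i0) by rewrite -le_eqVlt; exact: h2.
move=> /orP[/eqP Uw|Uw].
  by rewrite -(gp_ELw gp i0); apply: grad_le.
have d0 : 0 < w i0 - U i0 by rewrite subr_gt0.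
apply: (dnbhs0_sign d0 Delta_derivative).1 => t t0 td.
apply: mulr_ge0; last by rewrite invr_ge0 ltW.
by apply: Delta_ge0; apply: box_perturb; have := h1 i0; lra.
Qed.

End Perturbation.

(** The minimum of u and u' is a minimiser that touches u or u' at the origin, so it is equal to one
of the two. *)
Lemma minimiser_ordered u u' : minimiser u -> minimiser u' ->
  [\/ clt u u', u = u' | clt u' u].
Proof.
move=> mu mu'; have [_ mm] := minimiser_max_min mu mu'.
have le1 : cle (fmin u u') u by move=> i; rewrite /fmin ge_min lexx.
have le2 : cle (fmin u u') u' by move=> i; rewrite /fmin ge_min lexx orbT.
have strict z z' : minimiser z -> minimiser z' -> cle z z' -> z <> z' -> clt z z'.
  move=> mz mz' zz' ne i; rewrite lt_neqAle zz' andbT; apply/eqP => e; apply: ne.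
  by apply: (strong_comparison hs hr zz' (grad_minimiser mz) (grad_minimiser mz') e).
have [e|ne] := pselect (u = u'); first by constructor 2.
have [uu'|uu'] := leP (u 0) (u' 0).
  have e0 : fmin u u' 0 = u 0 by rewrite /fmin min_l.
  have e := strong_comparison hs hr le1 (grad_minimiser mm) (grad_minimiser mu) e0.
  by constructor 1; apply: strict => // i; rewrite -e.
have e0 : fmin u u' 0 = u' 0 by rewrite /fmin min_r// ltW.
have e := strong_comparison hs hr le2 (grad_minimiser mm) (grad_minimiser mu') e0.
by constructor 3; apply: strict => // [i|]; [rewrite -e|exact: nesym].
Qed.

Lemma minimiser_lt_w u : minimiser u -> clt u w.
Proof.
move=> mu i; have [[_ uw _] tv _] := (GammaP u).1 mu.1.
rewrite lt_neqAle uw andbT; apply/eqP => e.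
have uE := strong_comparison hs hr uw (grad_minimiser mu) (gp_ELw gp) e.
have [N HN] := tv (gap / 2) (divr_gt0 gap_gt0 (ltr0n R 2)).
have := HN (- N%:Z) (lexx _); rewrite uE sdistC sdist_vw; have := gap_gt0; lra.
Qed.

(** If u decreased, slice 0 would be at most as far from v as slices far to the left, and at most as
far from w as slices far to the right; it would be equal to both. *)
Lemma Gamma_not_decreasing u : Gamma m v w u -> ~ cle (tau 1 u) u.
Proof.
move=> /GammaP[bu tv tw] dec.
have decn (k : nat) : cle (tau k%:Z u) u.
  elim: k => [|k IH] i; first by rewrite tauN0.
  have -> : (k.+1%:Z : int) = k%:Z + 1 by lia.
  by rewrite -tauN_add; apply: le_trans (IH i); exact: (@cle_tauN R n m k%:Z _ _ dec i).
have incn (k : nat) : cle u (tau (- k%:Z) u).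
  move=> i; have := @cle_tauN R n m (- k%:Z) _ _ (decn k) i.
  by rewrite tauN_add addNr tauN0.
have e3 : 0 < gap / 3 by rewrite divr_gt0// gap_gt0.
have [N1 H1] := tv _ e3; have [N2 H2] := tw _ e3; have [vu uw _] := bu.
have h1 : sdist 0 u v <= gap / 3.
  apply: le_trans (H1 (- N1%:Z) (lexx _)); apply: (sdist_mono bu box_v bu box_v) => j _.
  have := incn N1 j; have := vu j; rewrite !tau_v tauN0 => ? ?.
  by rewrite !ger0_norm; lra.
have h2 : sdist 0 u w <= gap / 3.
  apply: le_trans (H2 N2%:Z (lexx _)); apply: (sdist_mono bu box_w bu box_w) => j _.
  have := decn N2 j; have := uw j; rewrite !tau_w tauN0 => ? ?.
  by rewrite !ler0_norm; lra.
have := sdist_triangle 0 box_v bu box_w; rewrite sdist_vw (sdistC 0 v u).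
have := gap_gt0; lra.
Qed.

Lemma minimiser_tau1 u : minimiser u -> minimiser (tau 1 u).
Proof.
move=> mu; have [bu tv tw] := (GammaP u).1 mu.1.
have bt := box_tau 1 bu.
have Gt : Gamma m v w (tau 1 u).
  apply/GammaP; split=> // e e0.
    have [N HN] := tv e e0; exists N.+1 => x xN.
    by rewrite -(tau_v 1) sdist_tau; apply: HN; lia.
  have [N HN] := tw e e0; exists N => x xN.
  by rewrite -(tau_w 1) sdist_tau; apply: HN; lia.
apply: minimiser_of_central => // e e0; have [N HN] := minimiser_central mu e0.
exists N.+1 => a b Na Nb.
have -> : central a b (tau 1 u) = central a.-1 b.+1 u.
  rewrite /central window_tau; have -> : - a%:Z + 1 = - (a.-1)%:Z by lia.
  by congr (window _ _ u); lia.
have : `|central a.-1 b.+1 u - cm| <= e by apply: HN; lia.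
by rewrite ler_norml => /andP[_]; rewrite lerBlDl.
Qed.

Lemma minimiser_monotone u : minimiser u -> clt u (tau 1 u).
Proof.
move=> mu; have nd := Gamma_not_decreasing mu.1.
case: (minimiser_ordered mu (minimiser_tau1 mu)) => // [e|lt]; exfalso; apply: nd.
  by rewrite -e.
by move=> i; apply: ltW.
Qed.

(** In direction m this is [minimiser_monotone]; in the other directions the shift of v is already
above w. *)
Lemma minimiser_shift u k : minimiser u -> (1 <= k <= m)%N -> clt u (tauN k 1 u).
Proof.
move=> mu /andP[k1]; rewrite leq_eqVlt => /orP[/eqP ->|km]; first exact: minimiser_monotone.
move=> i; apply: lt_le_trans (minimiser_lt_w mu i) _.
have [[vu _ _] _ _] := (GammaP u).1 mu.1.
have kp : (1 <= k <= p)%N by rewrite k1.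
exact: le_trans (gp_shift gp kp i) (@cle_tauN R n k 1 _ _ vu i).
Qed.

End Minimisers.

(** * Existence of minimisers *)

Section Existence.
Variable c : R.
Notation J := (J s m c%:E v).

(** For these configurations J is the energy of any sufficiently large window, see
[transition_J]. *)
Definition transition (a b : int) u := [/\ box u,
  forall i, i ord0 ko < a -> u i = v i & forall i, b <= i ord0 ko -> u i = w i].

Lemma energy_v a : energy a v = 0.
Proof. by rewrite /energy tau_v; apply: rsum0 => j _; rewrite subrr. Qed.

Lemma energy_w a : energy a w = 0.
Proof. by rewrite /energy tau_w; exact: gp_w gp. Qed.

Lemma tau_coord a u j : E0 j -> (j + a *: unit_vec n m) ord0 ko = a.
Proof. by move=> Ej; rewrite unit_vec_coord_ko (slice_ko Ej) add0r. Qed.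

Lemma tau_eq_slice (a : int) u z : box z -> dep p z ->
  (forall i, i ord0 ko = a -> u i = z i) -> forall j, E0 j -> tau a u j = z j.
Proof.
move=> bz dz h j Ej; rewrite -[RHS](dep_p_shift a j dz) /tauN /translate h//.
exact: tau_coord.
Qed.

Lemma energy_local a u z : box u -> box z -> dep p z ->
  (forall i, a - r%:Z <= i ord0 ko -> i ord0 ko <= a + r%:Z -> u i = z i) ->
  energy a u = energy a z.
Proof.
move=> bu bz dz h; apply/eqP; rewrite -subr_eq0 -normr_le0.
apply: le_trans (energy_lip a bu bz) _; rewrite big1 ?mulr0// => k _.
apply: sdist_eq0 => j Ej; rewrite (dep_tauN_id _ dz).
by apply: (tau_eq_slice bz dz) => // i ei; have kn := ltn_ord k; apply: h; lia.
Qed.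

Lemma transition_energy_left a b u x : transition a b u -> x + r%:Z < a -> energy x u = 0.
Proof.
move=> [bu ua ub] xa; rewrite -(energy_v x); apply: (energy_local bu box_v (gp_depv gp)).
by move=> i _ ix; apply: ua; lia.
Qed.

Lemma transition_energy_right a b u x : transition a b u -> b <= x - r%:Z -> energy x u = 0.
Proof.
move=> [bu ua ub] xb; rewrite -(energy_w x); apply: (energy_local bu box_w (gp_depw gp)).
by move=> i ix _; apply: ub; lia.
Qed.

Lemma transition_window a b u q N n1 n2 : transition a b u ->
  q + r%:Z <= a -> b + r%:Z <= q + N%:Z ->
  window (q - n1%:Z) (n1 + (N + n2)) u = window q N u.
Proof.
move=> cu qa bq; rewrite !window_cat.
have -> : window (q - n1%:Z) n1 u = 0.
  by apply: big1 => k _; have := ltn_ord k => kn; apply: (transition_energy_left cu); lia.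
have -> : window (q - n1%:Z + n1%:Z + N%:Z) n2 u = 0.
  by apply: big1 => k _; apply: (transition_energy_right cu); lia.
by rewrite add0r addr0 subrK.
Qed.

Lemma transition_J a b u q N : transition a b u -> q + r%:Z <= a -> b + r%:Z <= q + N%:Z ->
  J u = (window q N u)%:E.
Proof.
move=> cu qa bq; have [bu _ _] := cu.
have WE (x y : nat) : (absz q + absz (q + N%:Z)%R <= x)%N ->
    (absz q + absz (q + N%:Z)%R <= y)%N -> central x y u = window q N u.
  move=> hx hy.
  rewrite -(transition_window (absz (q + x%:Z)%R) (absz (y.+1%:Z - q - N%:Z)%R) cu qa bq).
  by rewrite /central; congr (window _ _ u); lia.
apply/eqP; rewrite eq_le; apply/andP; split.
  apply: J_le => // M; exists (M + (absz q + absz (q + N%:Z)%R))%N.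
  exists (M + (absz q + absz (q + N%:Z)%R))%N.
  by split; [lia|lia|rewrite WE//; lia].
apply: J_ge => //; exists (absz q + absz (q + N%:Z)%R)%N => x y hx hy.
by rewrite WE.
Qed.

Lemma transition_split a b u q N : transition a b u -> exists n1 n2 : nat,
  J u = (window (q - n1%:Z) n1 u + window q N u + window (q + N%:Z) n2 u)%:E.
Proof.
move=> cu; pose n1 := absz (q - a + r%:Z)%R; pose n2 := absz (b + r%:Z - q - N%:Z)%R.
exists n1, n2; rewrite (transition_J (q := q - n1%:Z) (N := (n1 + (N + n2))%N) cu).
- by rewrite !window_cat addrA subrK.
- by rewrite /n1; lia.
- by rewrite /n2; lia.
Qed.

Lemma transition_Gamma a b u : transition a b u -> Gamma m v w u.
Proof.
move=> [bu ua ub]; apply/GammaP; split=> // e e0.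
  exists (absz a).+1 => x xa; rewrite sdist_eq0 ?(ltW e0)// => j Ej; rewrite tau_v.
  by apply: (tau_eq_slice box_v (gp_depv gp)) => // i ix; apply: ua; lia.
exists (absz b) => x xb; rewrite sdist_eq0 ?(ltW e0)// => j Ej; rewrite tau_w.
by apply: (tau_eq_slice box_w (gp_depw gp)) => // i ix; apply: ub; lia.
Qed.

Definition cut (P Q : int) u : config R n := fun i =>
  if i ord0 ko < P then v i else if i ord0 ko < Q then u i else w i.

Lemma transition_cut P Q u : P <= Q -> box u -> transition P Q (cut P Q u).
Proof.
move=> PQ [h1 h2 h3]; split.
- split=> [i|i|i i' ii'].
  + by rewrite /cut; case: ifP => // _; case: ifP => // _; exact: vw.
  + by rewrite /cut; case: ifP => [_|_]; [exact: vw|case: ifP].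
  + rewrite /cut; have -> : i ord0 ko = i' ord0 ko by exact: ii'.
    by rewrite (h3 _ _ ii') (dep_mv ii') (dep_mw ii').
- by move=> i iP; rewrite /cut iP.
- by move=> i iQ; rewrite /cut ltNge (le_trans PQ iQ)/= ltNge iQ.
Qed.

(** The cut is made where u is close to v or to w, so the energy of the window hardly changes. *)
Lemma cut_near u (B e : R) : Gamma m v w u -> (J u < B%:E)%E -> 0 < e ->
  exists P Q u', [/\ P <= Q, transition P Q u' & (J u' <= (B + e)%:E)%E].
Proof.
move=> /GammaP[bu tv tw] JB e0.
have [e1 e10 Ce] := small_factor Kdiff_ge0 e0.
have [N1 H1] := tv e1 e10; have [N2 H2] := tw e1 e10.
have [a [b [Na Nb WB]]] : exists a b : nat, [/\ (N1 + N2 + r + r < a)%N,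
    (N1 + N2 + r + r < b)%N & central a b u < B].
  apply: contrapT => nab; move: JB; apply/negP; rewrite -leNgt.
  apply: J_ge => //; exists (N1 + N2 + r + r).+1 => a b Na Nb.
  by rewrite leNgt; apply/negP => Wab; apply: nab; exists a, b.
(* With a margin of r at both ends, the cut configuration has no energy outside the window. *)
pose P : int := - a%:Z + r%:Z; pose Q : int := b%:Z + 1 - r%:Z.
have PQ : P <= Q by rewrite /P /Q; lia.
have cl := transition_cut PQ bu; have [bc cv cw] := cl.
exists P, Q, (cut P Q u); split=> //.
rewrite (transition_J (q := - a%:Z) (N := (a + b).+1) cl);
  [|by rewrite /P; lia|by rewrite /Q; lia].
rewrite lee_fin.
have mid x : P <= x -> x < Q -> sdist x u (cut P Q u) = 0.
  move=> x1 x2; apply: sdist_eq0 => j Ej; rewrite /tauN /translate /cut tau_coord//.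
  by rewrite ltNge x1/= x2.
have : `|window (- a%:Z) (a + b).+1 u - window (- a%:Z) (a + b).+1 (cut P Q u)| <= Kdiff * e1.
  apply: window_diff => // [|x x1 x2|x x1 x2]; first exact: ltW.
    have [xP|Px] := ltP (- a%:Z + x) P.
      apply: (@le_trans _ _ (sdist (- a%:Z + x) u v)); last first.
        by apply: H1; move: xP; rewrite /P; lia.
      apply: (sdist_mono bu bc bu box_v) => j Ej; rewrite tau_v.
      rewrite [X in _ - X](tau_eq_slice box_v (gp_depv gp) _ Ej)// => i ix.
      by apply: cv; lia.
    have [xQ|Qx] := ltP (- a%:Z + x) Q; first by rewrite mid// ltW.
    apply: (@le_trans _ _ (sdist (- a%:Z + x) u w)); last first.
      by apply: H2; move: Qx; rewrite /Q; lia.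
    apply: (sdist_mono bu bc bu box_w) => j Ej; rewrite tau_w.
    rewrite [X in _ - X](tau_eq_slice box_w (gp_depw gp) _ Ej)// => i ix.
    by apply: cw; lia.
  by apply: mid; rewrite /P /Q; lia.
rewrite -/(central a b u) ler_norml => /andP[]; move: Ce WB; lra.
Qed.

Definition monotone u := cle u (tau 1 u).

Lemma transition_tau a b (x : int) u : transition a b u -> transition (a - x) (b - x) (tau x u).
Proof.
move=> [bu ua ub]; split; first exact: box_tau.
- move=> i ia; rewrite /tauN /translate ua ?unit_vec_coord_ko; last by lia.
  exact: dep_p_shift (gp_depv gp).
- move=> i ib; rewrite /tauN /translate ub ?unit_vec_coord_ko; last by lia.
  exact: dep_p_shift (gp_depw gp).
Qed.

Lemma transition_widen a b a' b' u : a' <= a -> b <= b' -> transition a b u -> transition a' b' u.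
Proof. by move=> aa bb [bu ua ub]; split=> // i h; [apply: ua|apply: ub]; lia. Qed.

Lemma J_tau_transition a b x u : transition a b u -> J (tau x u) = J u.
Proof.
move=> cu; pose q := - (absz a + absz x + r)%N%:Z.
pose N := (absz a + absz x + r + r + absz b + absz x + absz x)%N.
rewrite (transition_J (q := q) (N := N) (transition_tau x cu));
  [|rewrite /q; lia|rewrite /q /N; lia].
by rewrite window_tau; apply/esym; apply: (transition_J cu); rewrite /q /N; lia.
Qed.

(** Let H = b - a.  Passing to the next point in direction m replaces u(i) by u(i + (H + 1) e_m) in
the list of the shifts of u by 0, ..., H.  The new value is not smaller, since one of the two
points lies outside of the transition, so all order statistics are monotone.  The sum of their
energies is at most (H + 1) J(u), so one of them has at most the energy of u. *)
Lemma monotone_rearrangement a b u : a <= b -> transition a b u ->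
  exists a' u', [/\ transition a' b u', monotone u' & (J u' <= J u)%E].
Proof.
move=> ab cu; have [bu ua ub] := cu.
pose H := absz (b - a)%R.
pose fs := [seq tau h%:Z u | h <- iota 0 H.+1].
have sz : size fs = H.+1 by rewrite size_map size_iota.
pose a' := a - H%:Z.
have cfs f : List.In f fs -> transition a' b f.
  have sub : forall h, h \in iota 0 H.+1 -> transition a' b (tau h%:Z u).
    move=> h; rewrite mem_iota add0n => /andP[_ hH].
    by apply: transition_widen (transition_tau h%:Z cu); rewrite /a'; lia.
  rewrite /fs; elim: (iota 0 H.+1) sub => //= h ks IH sub [<-|].
    by apply: sub; rewrite inE eqxx.
  by apply: IH => k kks; apply: sub; rewrite inE kks orbT.
have bfs f : List.In f fs -> box f by move=> /cfs[].
(* This window contains the transitions of all shifts in the list, with a margin of r. *)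
pose q := a' - r%:Z; pose N := absz (b + r%:Z - q)%R.
have [bgs en] := order_stats_energy box_min box_max (@window_submodular q N) bfs.
have Efs : \sum_(f <- fs) window q N f = window q N u *+ size (order_stats fs).
  rewrite size_order_stats sz /fs big_map -[H.+1]subn0 -/(index_iota 0 H.+1) big_mkord.
  rewrite -[X in _ *+ X]card_ord -sumr_const; apply: eq_bigr => h _.
  have := ltn_ord h => hH; apply: EFin_inj; rewrite window_tau.
  rewrite -(transition_J (q := q + h%:Z) (N := N) cu);
    [|rewrite /q /a'; lia|rewrite /q /N /a'; lia].
  by rewrite -(transition_J (q := q) (N := N) cu)//; rewrite /q /N /a'; lia.
rewrite Efs in en.
have [|k kN Jk] := pigeonhole _ en; first by rewrite size_order_stats sz.
have kf : (k < size fs)%N by rewrite -size_order_stats.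
set g := nth v (order_stats fs) k.
have vals i : exists2 f, List.In f fs & g i = f i.
  have : g i \in [seq f i | f <- fs].
    rewrite /g nth_order_stats// -(perm_mem (perm_sort_values _)) mem_nth//.
    by rewrite (perm_size (perm_sort_values _)) size_map.
  elim: (fs) => //= f l IH; rewrite inE => /orP[/eqP ->|/IH[f' f'l ->]].
    by exists f => //; left.
  by exists f' => //; right.
have cg : transition a' b g.
  split; first by apply: bgs; apply: In_nth.
    by move=> i ia; have [f /cfs[_ fa _] ->] := vals i; exact: fa.
  by move=> i ib; have [f /cfs[_ _ fb] ->] := vals i; exact: fb.
exists a', g; split; first exact: cg; last first.
  rewrite (transition_J (q := q) (N := N) cg); [|rewrite /q; lia|rewrite /q /N; lia].
  rewrite (transition_J (q := q) (N := N) cu); [|rewrite /q /a'; lia|rewrite /q /N /a'; lia].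
  by rewrite lee_fin; exact: Jk.
move=> i; rewrite /tauN /translate /g !nth_order_stats//.
have e1 x : [seq f x | f <- fs] = [seq u (x + h%:Z *: unit_vec n m) | h <- iota 0 H.+1].
  by rewrite /fs -map_comp.
rewrite !e1.
set l := [seq u (i + h%:Z *: unit_vec n m) | h <- iota 1 H].
have -> : [seq u (i + h%:Z *: unit_vec n m) | h <- iota 0 H.+1] =
    u (i + 0%:Z *: unit_vec n m) :: l by [].
have -> : [seq u (i + 1 *: unit_vec n m + h%:Z *: unit_vec n m) | h <- iota 0 H.+1] =
    rcons l (u (i + H.+1%:Z *: unit_vec n m)).
  rewrite -map_rcons.
  have <- : iota 1 H.+1 = rcons (iota 1 H) H.+1.
    by rewrite -{1}[H.+1]addn1 iotaD cats1 add1n.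
  rewrite -[1%N]/(1 + 0)%N iotaDl -map_comp; apply: eq_map => h /=.
  by rewrite -addrA -scalerDl -PoszD.
have -> : sort_values (rcons l (u (i + H.+1%:Z *: unit_vec n m))) =
    insert_value (u (i + H.+1%:Z *: unit_vec n m)) (sort_values l).
  transitivity (sort_values (u (i + H.+1%:Z *: unit_vec n m) :: l)) => //.
  by apply: eq_sort_values; rewrite perm_rcons.
(* Both lists are obtained from l by the insertion of one value. *)
apply: le_insert_value; rewrite scale0r addr0.
have [vu uw _] := bu.
have [ia|ai] := ltP (i ord0 ko) a.
  rewrite ua// -(dep_p_shift H.+1%:Z i (gp_depv gp)); exact: vu.
rewrite [leRHS]ub; first by rewrite (dep_p_shift _ _ (gp_depw gp)); exact: uw.
by rewrite unit_vec_coord_ko /H; lia.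
Qed.

Lemma dep_v0 (x : int) : v (x *: unit_vec n m) = v 0.
Proof. by rewrite -[x *: _]add0r (dep_p_shift _ _ (gp_depv gp)). Qed.
Lemma dep_w0 (x : int) : w (x *: unit_vec n m) = w 0.
Proof. by rewrite -[x *: _]add0r (dep_p_shift _ _ (gp_depw gp)). Qed.

Lemma zero_coord_ko (x : int) : (x *: unit_vec n m) ord0 ko = x.
Proof. by rewrite -[x *: _]add0r unit_vec_coord_ko mxE add0r. Qed.

(** This singles out the translate of u that crosses the level th between - e_m and 0. *)
Lemma crossing a b u (th : R) : transition a b u -> v 0 < th -> th < w 0 ->
  exists x : int, th <= u (x *: unit_vec n m) /\ u ((x - 1) *: unit_vec n m) < th.
Proof.
move=> [bu ua ub] vt tw.
have lo x : x < a -> u (x *: unit_vec n m) < th.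
  by move=> xa; rewrite ua ?zero_coord_ko// dep_v0.
have hi x : b <= x -> th <= u (x *: unit_vec n m).
  by move=> xb; rewrite ub ?zero_coord_ko// dep_w0 ltW.
pose P (k : nat) := th <= u ((a - 1 + k%:Z) *: unit_vec n m).
have exP : exists k, P k by exists (absz b + absz a + 1)%N; apply: hi; lia.
case: (ex_minnP exP) => k Pk mink; exists (a - 1 + k%:Z); split=> //.
case: k Pk mink => [|k] Pk mink; first by apply: lo; lia.
rewrite ltNge; apply/negP => h.
have e : a - 1 + k.+1%:Z - 1 = a - 1 + k%:Z by lia.
by rewrite e in h; have := mink k h; rewrite ltnn.
Qed.

Lemma near_minimal (th B e : R) u : v 0 < th -> th < w 0 -> Gamma m v w u ->
  (J u < B%:E)%E -> 0 < e ->
  exists a b u', [/\ transition a b u', monotone u', (J u' <= (B + e)%:E)%E &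
    th <= u' 0 /\ u' (- unit_vec n m) < th].
Proof.
move=> vt tw Gu JB e0.
have [P [Q [u1 [PQ c1 J1]]]] := cut_near Gu JB e0.
have [P' [u2 [c2 m2 J2]]] := monotone_rearrangement PQ c1.
have [x [x1 x2]] := crossing c2 vt tw.
exists (P' - x), (Q - x), (tau x u2); split.
- exact: transition_tau.
- rewrite /monotone tauN_add addrC -tauN_add; exact: (@cle_tauN R n m x _ _ m2).
- by rewrite (J_tau_transition x c2); exact: le_trans J2 J1.
- rewrite /tauN /translate add0r; split; first exact: x1.
  have -> : - unit_vec n m + x *: unit_vec n m = (x - 1) *: unit_vec n m.
    by rewrite scalerBl scale1r addrC.
  exact: x2.
Qed.

Lemma transition_step : transition 0 0 (cut 0 0 v).
Proof. by apply: transition_cut => //; exact: box_v. Qed.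

Lemma infimum_finite : exists cm : R,
  ereal_inf [set J u | u in Gamma m v w] = cm%:E.
Proof.
set I := ereal_inf _.
have lo : ((- (Ktail * gap))%:E <= I)%E.
  by apply: le_ereal_inf_tmp => _ [u /GammaP[bu _ _] <-]; exact: J_lower.
have hi : (I <= (window (- r%:Z) (r + r) (cut 0 0 v))%:E)%E.
  rewrite -(transition_J transition_step); [|by lia|by lia].
  by apply: ereal_inf_lbound; exists (cut 0 0 v) => //; exact: transition_Gamma transition_step.
exists (fine I); rewrite fineK// fin_numElt.
by rewrite (lt_le_trans (ltNyr _) lo) (le_lt_trans hi (ltry _)).
Qed.

Lemma monotone_le u : monotone u -> forall (x : int) (k : nat), cle (tau x u) (tau (x + k%:Z) u).
Proof.
move=> mu x; elim=> [|k IH] i; first by rewrite addr0.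
apply: le_trans (IH i) _; have := @cle_tauN R n m (x + k%:Z) _ _ mu i.
by rewrite tauN_add; congr (_ <= tau _ u i); lia.
Qed.

Lemma monotone_sdist_v u x y : box u -> monotone u -> x <= y -> sdist x u v <= sdist y u v.
Proof.
move=> bu mu xy; apply: (sdist_mono bu box_v bu box_v) => j _; rewrite !tau_v.
have := monotone_le mu x (absz (y - x)%R) j; have -> : x + (absz (y - x)%R)%:Z = y by lia.
have [vx _ _] := box_tau x bu; have [vy _ _] := box_tau y bu.
have := vx j; have := vy j => ? ? ?.
by rewrite !ger0_norm; lra.
Qed.

Lemma monotone_sdist_w u x y : box u -> monotone u -> x <= y -> sdist y u w <= sdist x u w.
Proof.
move=> bu mu xy; apply: (sdist_mono bu box_w bu box_w) => j _; rewrite !tau_w.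
have := monotone_le mu x (absz (y - x)%R) j; have -> : x + (absz (y - x)%R)%:Z = y by lia.
have [_ wx _] := box_tau x bu; have [_ wy _] := box_tau y bu.
have := wx j; have := wy j => ? ? ?.
by rewrite !ler0_norm; lra.
Qed.

Lemma dep_limit (I : Type) (G : set_system I) (FG : ProperFilter G) (X : I -> config R n) u :
  (forall x, dep m (X x)) -> (forall i, X x i @[x --> G] --> u i) -> dep m u.
Proof.
move=> dX Xu i i' ii'; apply: (limit_eq FG (Xu i)).
have := Xu i'; under eq_fun do rewrite -(dX _ _ _ ii'); exact.
Qed.

Lemma box_limit (I : Type) (G : set_system I) (FG : ProperFilter G) (X : I -> config R n) u :
  (forall x, box (X x)) -> (forall i, X x i @[x --> G] --> u i) -> box u.
Proof.
move=> bX Xu; split; last by apply: (dep_limit FG _ Xu) => x; have [] := bX x.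
- by move=> i; apply: (limit_ge FG (Xu i)); apply: nearW => x; have [] := bX x.
- by move=> i; apply: (limit_le FG (Xu i)); apply: nearW => x; have [] := bX x.
Qed.

Lemma window_cvg (I : Type) (G : set_system I) (FG : ProperFilter G) (X : I -> config R n) u q N :
  (forall x, box (X x)) -> (forall i, X x i @[x --> G] --> u i) ->
  window q N (X x) @[x --> G] --> window q N u.
Proof.
move=> bX Xu; apply: cvg_sumr => k _; apply: (energy0_cvg FG).
- by move=> x; exact: box_tau.
- exact: box_tau (box_limit FG bX Xu).
- by move=> j; exact: Xu.
Qed.

(** The energies of the slices tend to the energy of z, and their sums are bounded above. *)
Lemma periodic_limit_extremal u z (f : nat -> int) (K : R) : box u -> box z ->
  dep p z -> (forall i, tau (f k) u i @[k --> \oo] --> z i) ->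
  (forall N M : nat, exists2 S, S <= K & S = \sum_(k < M) energy (f (N + k)%N) u) ->
  z = v \/ z = w.
Proof.
move=> bu bz dz uz HK; have [z1 z2 _] := bz.
have [D0z] := gp_min gp z1 z2 dz; apply.
apply: (@zero_energy_limit R (fun k => energy (f k) u) _ K) => //.
by apply: (energy0_cvg (G := \oo)) => // k; exact: box_tau.
Qed.

Section Limit.
Variables (cm th : R) (U : config R n).
Hypotheses (bU : box U) (mU : monotone U).
Hypotheses (vth : v 0 < th) (thw : th < w 0).
Hypotheses (U0 : th <= U 0) (U1 : U (- unit_vec n m) <= th).
Variable K : R.
Hypothesis UK : forall q N, window q N U <= K.

(** The limit exists by monotonicity and is invariant under the shift, so it is v or w; the value
at 0 excludes v. *)
Lemma monotone_limit_right : forall i, tau k%:Z U i @[k --> \oo] --> w i.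
Proof.
have nd i : nondecreasing_seq (fun k : nat => tau k%:Z U i).
  apply/nondecreasing_seqP => k; have := monotone_le mU k%:Z 1 i.
  by congr (_ <= tau _ U i); lia.
have ub i (k : nat) : tau k%:Z U i <= w i by have [_ h _] := box_tau k%:Z bU; exact: h.
have cv i : cvg (tau k%:Z U i @[k --> \oo]).
  apply: (nondecreasing_is_cvgn (nd i)); exists (w i) => _ [k _ <-]; exact: ub.
pose Z : config R n := fun i => lim (tau k%:Z U i @[k --> \oo]).
have UZ i : tau k%:Z U i @[k --> \oo] --> Z i by exact: cv.
have bZ : box Z.
  by apply: (box_limit (X := fun k : nat => tau k%:Z U) _ _ UZ) => k; exact: box_tau.
have tZ : tau 1 Z = Z.
  apply/funext => i; apply: (@limit_eq R nat \oo _ (fun k : nat => tau k.+1%:Z U i)).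
    have := UZ (i + 1 *: unit_vec n m); apply: cvg_trans; apply: near_eq_cvg.
    apply: nearW => k; rewrite /tauN /translate -addrA -scalerDl.
    by congr (U (i + _ *: _)); lia.
  by have := UZ i; rewrite -(cvg_shiftS (fun k : nat => tau k%:Z U i)).
have dZ : dep p Z by apply: dep_of_tau1 => //; case: bZ.
have [] := @periodic_limit_extremal U Z (fun k => k%:Z) K bU bZ dZ UZ.
- move=> N M; by exists (window N%:Z M U).
- move=> Zv; have : U 0 <= Z 0.
    apply: (@limit_ge R nat \oo _ _ _ _ (UZ 0)); apply: nearW => k.
    by have := monotone_le mU 0 k 0; rewrite tauN0 add0r.
  by rewrite Zv; move: vth U0; lra.
- by move=> <-.
Qed.

Lemma monotone_limit_left : forall i, tau (- k%:Z) U i @[k --> \oo] --> v i.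
Proof.
have nd i : nonincreasing_seq (fun k : nat => tau (- k%:Z) U i).
  apply/nonincreasing_seqP => k; have := monotone_le mU (- k.+1%:Z) 1 i.
  by congr (_ <= tau _ U i); lia.
have lb i (k : nat) : v i <= tau (- k%:Z) U i by have [h _ _] := box_tau (- k%:Z) bU; exact: h.
have cv i : cvg (tau (- k%:Z) U i @[k --> \oo]).
  apply: (nonincreasing_is_cvgn (nd i)); exists (v i) => _ [k _ <-]; exact: lb.
pose Z : config R n := fun i => lim (tau (- k%:Z) U i @[k --> \oo]).
have UZ i : tau (- k%:Z) U i @[k --> \oo] --> Z i by exact: cv.
have bZ : box Z.
  by apply: (box_limit (X := fun k : nat => tau (- k%:Z) U) _ _ UZ) => k; exact: box_tau.
have tZ : tau 1 Z = Z.
  apply/funext => i; apply: (@limit_eq R nat \oo _ (fun k : nat => tau (- k%:Z) U i)) => //.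
  have := UZ (i + 1 *: unit_vec n m).
  rewrite -(cvg_shiftS (fun k : nat => tau (- k%:Z) U (i + 1 *: unit_vec n m))).
  apply: cvg_trans; apply: near_eq_cvg.
  apply: nearW => k; rewrite /= /tauN /translate -addrA -scalerDl.
  by congr (U (i + _ *: _)); lia.
have dZ : dep p Z by apply: dep_of_tau1 => //; case: bZ.
have [] := @periodic_limit_extremal U Z (fun k => - k%:Z) K bU bZ dZ UZ.
(* The slices - N, ..., - (N + M) + 1 in reverse order form a window. *)
- move=> N M; exists (window (- (N + M)%N%:Z + 1) M U) => //.
  rewrite /window (reindex_inj rev_ord_inj)/=; apply: eq_bigr => k _.
  by congr (energy _ U); have := ltn_ord k; lia.
- by move=> <-.
- move=> Zw; have : Z 0 <= U (- unit_vec n m).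
    apply: (@limit_le R nat \oo _ _ _ _ (UZ 0)); exists 1%N => // k /= k1.
    have := monotone_le mU (- k%:Z) k.-1 0; rewrite {2}/tauN /translate add0r.
    have -> : - k%:Z + k.-1%:Z = -1 by lia.
    by rewrite scaleN1r.
  by rewrite Zw; move: thw U1; lra.
Qed.

Lemma monotone_Gamma : Gamma m v w U.
Proof.
apply/GammaP; split=> // e e0.
  have := @sdist_cvg nat \oo eventually_filter (fun=> U) (fun k : nat => - k%:Z) v v
    box_v (fun=> bU) box_v
    monotone_limit_left (fun k => tau_v _).
  rewrite sdist_eq0// => /cvgrPdist_le/(_ e e0)[N _ HN]; exists N => x xN.
  have := HN (absz x); rewrite /= sub0r normrN ger0_norm ?sdist_ge0//.
  have -> : - (absz x)%:Z = x by lia.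
  by apply; lia.
have := @sdist_cvg nat \oo eventually_filter (fun=> U) (fun k : nat => k%:Z) w w
  box_w (fun=> bU) box_w
  monotone_limit_right (fun k => tau_w _).
rewrite sdist_eq0// => /cvgrPdist_le/(_ e e0)[N _ HN]; exists N => x xN.
have := HN (absz x); rewrite /= sub0r normrN ger0_norm ?sdist_ge0//.
have -> : (absz x)%:Z = x by lia.
by apply; lia.
Qed.

End Limit.

(** For a minimising sequence of monotone transitions, the energy of a fixed window is the total
energy minus those of two tails.  By monotonicity a tail is close to v, or to w, as soon as its
first slice is, so its energy is almost nonnegative, uniformly along the sequence. *)
Lemma minimiser_exists (cm : R) :
  ereal_inf [set J u | u in Gamma m v w] = cm%:E ->
  exists U, Gamma m v w U /\ J U = cm%:E.
Proof.
move=> infE.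
have cm_min u : Gamma m v w u -> (cm%:E <= J u)%E.
  by move=> Gu; rewrite -infE; apply: ereal_inf_lbound; exists u.
have near_inf d : 0 < d -> exists u, Gamma m v w u /\ (J u < (cm + d)%:E)%E.
  move=> d0; apply: contrapT => nu.
  have : ((cm + d)%:E <= cm%:E)%E.
    rewrite -infE; apply: le_ereal_inf_tmp => _ [u Gu <-].
    by rewrite leNgt; apply/negP => Ju; apply: nu; exists u.
  by rewrite lee_fin; lra.
(* Any level strictly between v and w serves to fix the translation. *)
pose th := (v 0 + w 0) / 2.
have vw0 : v 0 < w 0 by exact: gp_lt gp 0.
have vth : v 0 < th by rewrite /th; lra.
have thw : th < w 0 by rewrite /th; lra.
pose d (L : nat) : R := L.+1%:R^-1.
have d0 L : 0 < d L by rewrite invr_gt0.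
have d1 L : d L <= 1 by rewrite invf_le1// ler1n.
have dsmall e : 0 < e -> \forall L \near \oo, d L <= e.
  move=> e0; exists (Num.truncn e^-1) => // L /= hL.
  rewrite /d -[leRHS]invrK lef_pV2 ?posrE ?invr_gt0//.
  have := truncnS_gt e^-1; have : ((Num.truncn e^-1).+1%:R : R) <= L.+1%:R by rewrite ler_nat.
  by move=> ? ?; lra.
have [L|u Hu] := choice (_ : forall L : nat, exists u : config R n, exists a b : int,
    [/\ transition a b u, monotone u, (J u <= (cm + 2 * d L)%:E)%E &
      th <= u 0 /\ u (- unit_vec n m) < th]).
  have [u [Gu Ju]] := near_inf _ (d0 L).
  have [a [b [u' [h1 h2 h3 h4]]]] := near_minimal vth thw Gu Ju (d0 L).
  exists u', a, b; split=> //.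
  by have -> : cm + 2 * d L = cm + d L + d L by lra.
have bu L : box (u L) by have [a [b [[]]]] := Hu L.
have mu L : monotone (u L) by have [a [b []]] := Hu L.
have [G [PG sub [U Uvw uU]]] : exists G : set_system nat, [/\ ProperFilter G, \oo `<=` G &
    exists2 U : config R n, (forall i, v i <= U i <= w i) & forall i, u L i @[L --> G] --> U i].
  by apply: pointwise_compact => L i; have [h1 h2 _] := bu L; rewrite h1 h2.
have bU : box U by exact: (box_limit PG bu uU).
have mU : monotone U.
  move=> i; rewrite -subr_ge0; apply: (limit_ge PG (cvgB (uU _) (uU i))).
  by apply: nearW => L; rewrite /= subr_ge0; exact: mu.
have U0 : th <= U 0.
  by apply: (limit_ge PG (uU 0)); apply: nearW => L; have [a [b [_ _ _ []]]] := Hu L.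
have U1 : U (- unit_vec n m) <= th.
  apply: (limit_le PG (uU _)); apply: nearW => L.
  by have [a [b [_ _ _ [_ /ltW]]]] := Hu L.
(* The energy of a window is the total energy minus the energies of the two tails. *)
have split_le L q N (A : R) : (forall n1 : nat, - A <= window (q - n1%:Z) n1 (u L)) ->
    (forall n2 : nat, - A <= window (q + N%:Z) n2 (u L)) ->
    window q N (u L) <= cm + 2 * d L + 2 * A.
  move=> hl hr'; have [a [b [cl _ Ju _]]] := Hu L.
  have [n1 [n2 E]] := transition_split q N cl.
  by move: Ju; rewrite E lee_fin; have := hl n1; have := hr' n2; lra.
have UK q N : window q N U <= cm + 2 + 2 * (Ktail * gap).
  have h := @window_cvg nat G PG u U q N bu uU.
  apply: (@limit_le R nat G PG _ _ _ h); apply: nearW => L.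
  have := split_le L q N (Ktail * gap) (fun n1 => window_ge _ _ (bu L))
    (fun n2 => window_ge _ _ (bu L)).
  by have := d1 L; lra.
have GU := monotone_Gamma bU mU vth thw U0 U1 UK.
exists U; split=> //; apply/eqP; rewrite eq_le cm_min// andbT.
apply/lee_addgt0Pr => e e0; rewrite -EFinD.
have [_ tv tw] := (GammaP U).1 GU.
have e4 : 0 < e / 4 by rewrite divr_gt0.
have [e2 e20 Ce] := small_factor Ktail_ge0 e4.
have e22 : 0 < e2 / 2 by rewrite divr_gt0.
have [N1 H1] := tv _ e22; have [N2 H2] := tw _ e22.
apply: J_le => // M.
have [a [Ma N1a N2a]] : exists a : nat, [/\ (M <= a)%N, (N1 + r <= a)%N & (N2 + r <= a)%N].
  by exists (M + N1 + N2 + r)%N; split; clear; lia.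
have lowa : - a%:Z + r%:Z <= - N1%:Z by clear -N1a; lia.
have higha : N2%:Z <= a%:Z - r%:Z by clear -N2a; lia.
exists a, a; split; [exact: Ma|exact: Ma|].
have nearv : \forall L \near G, sdist (- a%:Z + r%:Z) (u L) v <= e2.
  have := @sdist_cvg nat G PG u (fun=> - a%:Z + r%:Z) (tau (- a%:Z + r%:Z) U) v
    box_v bu (box_tau _ bU) (fun j => uU _) (fun=> tau_v _).
  have -> : sdist 0 (tau (- a%:Z + r%:Z) U) v = sdist (- a%:Z + r%:Z) U v.
    by rewrite -{1}(tau_v (- a%:Z + r%:Z)) sdist_tau add0r.
  move/cvgr_le; apply.
  have : sdist (- a%:Z + r%:Z) U v <= e2 / 2 by exact: H1.
  by move: e20; lra.
have nearw : \forall L \near G, sdist (a%:Z - r%:Z) (u L) w <= e2.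
  have := @sdist_cvg nat G PG u (fun=> a%:Z - r%:Z) (tau (a%:Z - r%:Z) U) w
    box_w bu (box_tau _ bU) (fun j => uU _) (fun=> tau_w _).
  have -> : sdist 0 (tau (a%:Z - r%:Z) U) w = sdist (a%:Z - r%:Z) U w.
    by rewrite -{1}(tau_w (a%:Z - r%:Z)) sdist_tau add0r.
  move/cvgr_le; apply.
  have : sdist (a%:Z - r%:Z) U w <= e2 / 2 by exact: H2.
  by move: e20; lra.
have neard : \forall L \near G, d L <= e / 4 by apply: sub; exact: dsmall.
apply: (@limit_le R nat G PG _ _ _ (@window_cvg nat G PG u U _ _ bu uU)).
apply: filterS (filterI neard (filterI nearv nearw)) => L [dL [lv lw]].
have hl n1 : - (Ktail * e2) <= window (- a%:Z - n1%:Z) n1 (u L).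
  apply: window_ge_v => // [|x _ x2]; first exact: ltW.
  have xa : x <= - a%:Z + r%:Z by clear -x2; lia.
  exact: le_trans (monotone_sdist_v (bu L) (mu L) xa) lv.
have hr' n2 : - (Ktail * e2) <= window (- a%:Z + (a + a).+1%:Z) n2 (u L).
  apply: window_ge_w => // [|x x1 _]; first exact: ltW.
  have ax : a%:Z - r%:Z <= x by clear -x1; lia.
  exact: le_trans (monotone_sdist_w (bu L) (mu L) ax) lw.
have := split_le L _ _ _ hl hr'; move: Ce dL; lra.
Qed.

End Existence.

(** * From one level to the next *)

Section NextLevel.
Variables (c cm : R) (pn' : (p.+1 < n)%N) (v' w' : config R n).
Notation J := (J s m c%:E v).
Notation minimiser := (minimiser c cm).
Hypothesis cm_min : forall u, Gamma m v w u -> (cm%:E <= J u)%E.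
Hypotheses (mv : minimiser v') (mw : minimiser w') (vw' : clt v' w').
Hypothesis no_between : forall u, minimiser u -> cle v' u -> cle u w' -> u = v' \/ u = w'.

Let bv : box v'. Proof. by have [] := (GammaP v').1 mv.1. Qed.
Let bw : box w'. Proof. by have [] := (GammaP w').1 mw.1. Qed.

(** The shift of v' is a minimiser above v', and it does not lie strictly between v' and w'. *)
Lemma adjacent_shift : cle w' (tau 1 v').
Proof.
have mt := minimiser_tau1 cm_min mv.
have lt1 := minimiser_monotone cm_min mv.
case: (minimiser_ordered cm_min mw mt) => [h i|-> //|h]; first exact: ltW.
have [e|e] := no_between mt (fun i => ltW (lt1 i)) (fun i => ltW (h i)).
  by have := lt1 0; rewrite e ltxx.
by have := h 0; rewrite e ltxx.
Qed.

Lemma slice_next j : slice (n := n) m.+1 0 j <-> (forall l : 'I_n, (p < l)%N -> j ord0 l = 0).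
Proof.
split=> [sj l|h l]; last by split=> [[lm]|lm]; apply: h; lia.
rewrite leq_eqVlt => /orP[/eqP e|lp]; first by have [h _] := sj l; apply: h; rewrite -e.
by have [_ h] := sj l; apply: h.
Qed.

Lemma seq_coord_bound (rr : seq (lattice n)) :
  exists A : nat, forall j, j \in rr -> (absz (j ord0 ko) <= A)%N.
Proof.
exists (\max_(j <- rr) absz (j ord0 ko))%N => j jr.
by apply: (leq_bigmax_seq (F := fun j : lattice n => absz (j ord0 ko))).
Qed.

(** By [adjacent_shift] the sum of w' - v' over consecutive slices is bounded by a telescoping sum,
with value at most the sum of w - v over one slice. *)
Lemma gap_summable : abs_summable (slice m.+1 0) (fun j => w' j - v' j).
Proof.
apply: (rsum_le_bound (M := gap) _ _).1 => [j _|rr ur rE].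
  by rewrite subr_ge0 ltW.
have [A HA] := seq_coord_bound rr.
pose q : int := - A%:Z; pose N := (A + A).+1.
pose g x j := tau (x + 1) v' j - tau x v' j.
have sg x : abs_summable E0 (g x).
  apply: abs_summable_le (gp_sum gp) => j _; exact: box_dist (box_tau _ bv) (box_tau _ bv).
have dwv x j : tau x (fun i => w' i - v' i) j = tau x w' j - tau x v' j by [].
have sE x : abs_summable E0 (tau x (fun i => w' i - v' i)).
  apply: abs_summable_le (gp_sum gp) => j _; rewrite dwv.
  exact: box_dist (box_tau _ bw) (box_tau _ bv).
have ss x : abs_summable (slice m x) (fun j => w' j - v' j).
  apply: (abs_summable_reindex (slice_tau_bij pn x)); exact: sE.
have [sS E] := @slab_rsum q (fun j => w' j - v' j) N (fun k _ => ss _).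
have rS : [set` rr] `<=` slab q N.
  move=> j jr; split; first by apply/slice_next; exact: rE.
  have := HA j jr.
  by rewrite /q /N; lia.
apply: le_trans (sum_le_rsum (E := slab q N) _ sS ur rS) _.
  by move=> j _; rewrite subr_ge0 ltW.
rewrite E; apply: (@le_trans _ _ (\sum_(k < N) rsum E0 (g (q + k%:Z)))).
  apply: ler_sum => k _; rewrite (rsum_reindex _ (slice_tau_bij pn _)).
  apply: le_rsum => // [|j _]; first exact: sE.
  rewrite /g lerB// -(tauN_add m (q + k%:Z) 1).
  exact: (@cle_tauN R n m (q + k%:Z) _ _ adjacent_shift j).
rewrite -(rsum_sum _ (fun k : 'I_N => sg (q + k%:Z))).
have T j : \sum_(k < N) g (q + k%:Z) j = tau (q + N%:Z) v' j - tau q v' j.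
  rewrite -(big_mkord xpredT (fun k => g (q + k%:Z) j)).
  rewrite (eq_bigr (fun k => tau (q + k.+1%:Z) v' j - tau (q + k%:Z) v' j)).
    by rewrite telescope_sumr// addr0.
  by move=> k _; rewrite /g; congr (tau _ v' j - _); lia.
rewrite (eq_rsum (fun j _ => T j)); apply: le_rsum; [|exact: gp_sum gp|].
  apply: abs_summable_le (gp_sum gp) => j _; exact: box_dist (box_tau _ bv) (box_tau _ bv).
move=> j _; apply: le_trans (ler_norm _) _.
exact: box_dist (box_tau _ bv) (box_tau _ bv).
Qed.

Lemma box_between u : cle v' u -> cle u w' -> dep m u -> box u.
Proof.
have [h1 _ _] := bv; have [_ h2 _] := bw => vu uw du.
by split=> // i; [exact: le_trans (h1 i) (vu i)|exact: le_trans (uw i) (h2 i)].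
Qed.

Lemma Gamma_between u : cle v' u -> cle u w' -> dep m u -> Gamma m v w u.
Proof.
move=> vu uw du; have bu := box_between vu uw du.
have [_ _ tw] := (GammaP v').1 mv.1; have [_ tv _] := (GammaP w').1 mw.1.
apply/GammaP; split=> // e e0.
  have [N HN] := tv e e0; exists N => x xN; apply: le_trans (HN x xN).
  apply: (sdist_mono bu box_v bw box_v) => j _; rewrite !tau_v.
  have [h1 _ _] := box_tau x bu; have := h1 j.
  have := @cle_tauN R n m x _ _ uw j => ? ?.
  by rewrite !ger0_norm; lra.
have [N HN] := tw e e0; exists N => x xN; apply: le_trans (HN x xN).
apply: (sdist_mono bu box_w bv box_w) => j _; rewrite !tau_w.
have [_ h1 _] := box_tau x bu; have := h1 j.
have := @cle_tauN R n m x _ _ vu j => ? ?.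
by rewrite !ler0_norm; lra.
Qed.

Lemma gap_energy_summable u : cle v' u -> cle u w' -> dep m u ->
  abs_summable (slice m.+1 0) (fun j => S j u - S j v').
Proof.
move=> vu uw du; have bu := box_between vu uw du.
have dgap : dep m (fun j => w' j - v' j).
  by have [_ _ d1] := bv; have [_ _ d2] := bw => i i' ii'; rewrite (d1 _ _ ii') (d2 _ _ ii').
have sk (k : ball0 n r) : abs_summable (slice m.+1 0) (fun j => w' (val k + j) - v' (val k + j)).
  have := @abs_summable_slice_shift R n p.+1 pn' (fun j => w' j - v' j) (val k).
  rewrite (dep_tauN_id _ dgap); apply; last exact: gap_summable.
  exact: dep_leq (leqnSn m) dgap.
apply: (@abs_summable_le R _ _ _ (fun j => lip * \sum_(k <- ball_enum n r)
    (w' (val k + j) - v' (val k + j)))); last first.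
  by apply: abs_summableZ; apply: abs_summable_sum => k _; exact: sk.
move=> j _; apply: le_trans (lipP.2 _ _ _ bu bv) _; rewrite ler_wpM2l ?lipP.1//.
apply: ler_sum => k _; have := vu (val k + j); have := uw (val k + j) => ? ?.
by rewrite ger0_norm; lra.
Qed.

Lemma central_gap_limit u : cle v' u -> cle u w' -> dep m u ->
  forall e : R, 0 < e -> exists N : nat, forall a b : nat, (N <= a)%N -> (N <= b)%N ->
  `|central a b u - central a b v' - slice_energy s m v' u| <= e.
Proof.
move=> vu uw du e e0; have bu := box_between vu uw du.
have sS := gap_energy_summable vu uw du.
have [rr [ur rE tl]] := rsum_tail sS e0.
have [A HA] := seq_coord_bound rr.
exists A => a b Aa Ab; set F := slab (- a%:Z) (a + b).+1.
have FE : F `<=` slice m.+1 0 by move=> j [h _]; apply/slice_next.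
have rF : [set` rr] `<=` F.
  move=> j jr; split; first by apply/slice_next; exact: rE.
  have := HA j jr.
  lia.
have [sF ->] := window_diff_slab (- a%:Z) (a + b).+1 bu bv.
rewrite /slice_energy (rsumID F sS) (setIidr FE) opprD addrA subrr add0r normrN.
apply: le_trans (ler_norm_rsum _) (tl F rF FE).
by apply: abs_summable_sub sS; exact: subIsetl.
Qed.

(** Along growing windows the difference of the energies of u and v' tends to the energy of u
relative to v' over E^{m+1}_0. *)
Lemma gap_energy u : cle v' u -> cle u w' -> dep m u ->
  0 <= slice_energy s m v' u /\ (slice_energy s m v' u = 0 <-> minimiser u).
Proof.
move=> vu uw du; have Gu := Gamma_between vu uw du; have bu := box_between vu uw du.
have lower e : 0 < e -> - e <= slice_energy s m v' u.
  move=> e0; have e3 : 0 < e / 3 by rewrite divr_gt0.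
  have [N1 H1] := central_gap_limit vu uw du e3; have [N2 H2] := minimiser_central mv e3.
  have [N3 H3] := J_ge_central bu (cm_min Gu) e3.
  pose N := (N1 + N2 + N3)%N.
  have : `|central N N u - central N N v' - slice_energy s m v' u| <= e / 3.
    by apply: H1; rewrite /N; lia.
  have : `|central N N v' - cm| <= e / 3 by apply: H2; rewrite /N; lia.
  have : cm - e / 3 <= central N N u by apply: H3; rewrite /N; lia.
  by rewrite !ler_norml => ? /andP[? ?] /andP[? ?]; lra.
have ge0 : 0 <= slice_energy s m v' u.
  by apply/ler_addgt0Pr => e e0; have := lower e e0; lra.
split; first exact: ge0.
split=> [z|mu].
  apply: (minimiser_of_central cm_min Gu) => e e0; have e2 : 0 < e / 2 by rewrite divr_gt0.
  have [N1 H1] := central_gap_limit vu uw du e2; have [N2 H2] := minimiser_central mv e2.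
  exists (N1 + N2)%N => a b Na Nb.
  have : `|central a b u - central a b v' - slice_energy s m v' u| <= e / 2 by apply: H1; lia.
  have : `|central a b v' - cm| <= e / 2 by apply: H2; lia.
  by rewrite z !ler_norml => /andP[? ?] /andP[? ?]; lra.
apply/eqP; rewrite eq_le ge0 andbT; apply/ler_addgt0Pr => e e0; rewrite add0r.
have e3 : 0 < e / 3 by rewrite divr_gt0.
have [N1 H1] := central_gap_limit vu uw du e3; have [N2 H2] := minimiser_central mv e3.
have [N3 H3] := minimiser_central mu e3.
pose N := (N1 + N2 + N3)%N.
have : `|central N N u - central N N v' - slice_energy s m v' u| <= e / 3.
    by apply: H1; rewrite /N; lia.
have : `|central N N v' - cm| <= e / 3 by apply: H2; rewrite /N; lia.
have : `|central N N u - cm| <= e / 3 by apply: H3; rewrite /N; lia.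
by rewrite !ler_norml => /andP[? ?] /andP[? ?] /andP[? ?]; lra.
Qed.

Lemma next_good_pair : good_pair s m v' w'.
Proof.
have [v1 v2 dv] := bv; have [w1 w2 dw] := bw; have vw1 : cle v' w' by move=> i; exact: ltW.
have refl (z : config R n) : cle z z by move=> i.
split=> //.
- have [a [b ab]] := gp_bound gp; exists a, b => i; split.
    exact: le_trans (ab i).1 (v1 i).
  exact: le_trans (w2 i) (ab i).2.
- exact: gap_summable.
- by move=> i; exact: (grad_minimiser cm_min mv).
- by move=> i; exact: (grad_minimiser cm_min mw).
- move=> u vu uw du; have [h1 h2] := gap_energy vu uw du; split=> // /h2 mu.
  exact: no_between.
- by apply/(gap_energy vw1 (refl _) dw).2.
- move=> k /andP[k1]; rewrite leq_eqVlt => /orP[/eqP ->|km]; first exact: adjacent_shift.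
  have kp : (1 <= k <= p)%N by rewrite k1.
  move=> i; apply: le_trans (w2 i) _; apply: le_trans (gp_shift gp kp i) _.
  exact: (@cle_tauN R n k 1 _ _ v1 i).
Qed.

End NextLevel.

Theorem minimisers_structure (c cm : R) (M := [set u | Gamma m v w u /\ J s m c%:E v u = cm%:E]) :
  ereal_inf [set J s m c%:E v u | u in Gamma m v w] = cm%:E ->
  [/\ exists U, M U, ordered M, forall U, M U -> euler_lagrange s U &
      forall U, M U -> forall k : nat, (1 <= k <= m)%N -> clt U (tauN k 1 U)].
Proof.
move=> infE; have cm_min u : Gamma m v w u -> (cm%:E <= J s m c%:E v u)%E.
  by move=> Gu; rewrite -infE; apply: ereal_inf_lbound; exists u.
split.
- exact: minimiser_exists infE.
- by move=> u u' mu mu'; exact: (minimiser_ordered cm_min mu mu').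
- by move=> U mU; apply/euler_lagrangeE => i; exact: (grad_minimiser cm_min mU).
- by move=> U mU k km; exact: (minimiser_shift cm_min mU km).
Qed.

Theorem adjacent_good_pair (c cm : R) v' w'
    (M := [set u | Gamma m v w u /\ J s m c%:E v u = cm%:E]) : (p.+1 < n)%N ->
  ereal_inf [set J s m c%:E v u | u in Gamma m v w] = cm%:E ->
  adjacent M v' w' -> good_pair s m v' w'.
Proof.
move=> pn' infE [mv mw vw' nb].
have cm_min u : Gamma m v w u -> (cm%:E <= J s m c%:E v u)%E.
  by move=> Gu; rewrite -infE; apply: ereal_inf_lbound; exists u.
apply: (next_good_pair pn' cm_min mv mw vw') => u mu vu uw.
have [->|ne] := pselect (u = v'); first by left.
have [->|ne'] := pselect (u = w'); first by right.
by case: nb; exists u.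
Qed.

End Level.

(** Constants that minimise s along the diagonal are critical in the diagonal direction, and for
constants the Euler-Lagrange sum is the diagonal derivative of s. *)
(** * The ground level and the induction *)

Lemma ground_good_pair (R : realType) (n r : nat) (s : (ball0 n r -> R) -> R) v w :
  (0 < n)%N -> admissible s -> adjacent (M0 s) v w -> good_pair s 0 v w.
Proof.
move=> n0 hs [[Gv Jv] [Gw Jw] vw nb].
have dG (u : config R n) : Gamma0 u <-> dep 0 u.
  by split=> [G|/depP h] => [|k kn]; [apply/depP => k kn; exact: G|exact: h].
have dv : dep 0 v by exact/dG.
have dw : dep 0 w by exact/dG.
have const (u : config R n) i : dep 0 u -> u i = u 0 by move=> du; exact: du.
have J0_min (u : config R n) : dep 0 u -> local_potential s 0 v <= local_potential s 0 u.
  move=> /dG Gu; rewrite -lee_fin -/(J0 s v) Jv; apply: ereal_inf_lbound.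
  by exists u.
have slice1 : slice (n := n) 1 0 = [set` [:: 0 : lattice n]].
  apply/seteqP; split=> j /=; rewrite inE.
    move=> sj; apply/eqP/rowP => l; rewrite mxE; have [h1 h2] := sj l.
    by case: (posnP l) => [l0|l0]; [apply: h1; rewrite l0|apply: h2].
  by move=> /eqP -> l; rewrite mxE.
have energy u : slice_energy s 0 v u = local_potential s 0 u - local_potential s 0 v.
  by rewrite /slice_energy slice1 rsum_fset// big_seq1.
have el (u : config R n) : dep 0 u -> J0 s u = c0 s -> forall i, grad s u i = 0.
  move=> du Ju i.
  have lE j : loc (r := r) j u = fun=> u 0 by apply/funext => b; rewrite /loc const.
  have gE : grad s u i = \sum_(k <- ball_enum n r) partial k s (fun=> u 0).
    by apply: eq_bigr => k _; rewrite lE.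
  have der := @s_dir_derivative R n r s hs predT (fun=> u 0).
  have mn t : 0 <= s (fun=> u 0 + t) - s (fun=> u 0).
    rewrite subr_ge0 -lee_fin.
    have <- : J0 s u = (s (fun=> u 0))%:E.
      by rewrite /J0 /local_potential; congr (s _)%:E; exact: lE.
    rewrite Ju; apply: ereal_inf_lbound; exists (fun=> u 0 + t) => //.
  rewrite /= in der; have [h1 h2] := dnbhs0_sign ltr01 der.
  apply/eqP; rewrite gE eq_le; apply/andP; split.
    apply: h2 => t t0 _; apply: mulr_ge0_le0; first exact: mn.
    by rewrite invr_le0 ltW.
  apply: h1 => t t0 _; apply: mulr_ge0; first exact: mn.
  by rewrite invr_ge0 ltW.
split=> //.
- by exists (v 0), (w 0) => i; rewrite (const v i dv) (const w i dw).
- by rewrite slice1; apply: abs_summable_fset; exact: finite_seq.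
- exact: el.
- exact: el.
- move=> u vu uw du; rewrite energy subr_ge0; split; first exact: J0_min.
  move=> /eqP; rewrite subr_eq0 => /eqP e.
  have Mu : M0 s u by split; [exact/dG|rewrite -Jv /J0 e].
  have [->|ne] := pselect (u = v); first by left.
  have [->|ne'] := pselect (u = w); first by right.
  by case: nb; exists u.
- rewrite energy; apply/eqP; rewrite subr_eq0; apply/eqP.
  by have := Jw; rewrite -Jv => -[].
- by move=> k; lia.
Qed.

Section Chain.
Context (R : realType) (n r l : nat) (hr : (1 <= r)%N) (ln : (l < n)%N).
Context (s : (ball0 n r -> R) -> R) (hs : admissible s) (v w : nat -> config R n).
Hypothesis hvw : forall i : nat, (i <= l)%N -> adjacent (M s v w i) (v i) (w i).

Lemma M_succ i (c cm : R) : c_ s v w i = c%:E -> c_ s v w i.+1 = cm%:E ->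
  M s v w i.+1 = [set u | Gamma i.+1 (v i) (w i) u /\ J s i.+1 c%:E (v i) u = cm%:E].
Proof. by move=> cE cmE; rewrite /M cmE cE. Qed.

Lemma good_pair_levels i : (i <= l)%N ->
  good_pair s i (v i) (w i) /\ exists c : R, c_ s v w i = c%:E.
Proof.
elim: i => [_|i IH il].
  have adj := hvw (leq0n l); split; first by apply: (ground_good_pair _ hs adj); lia.
  by have [[_ Jv] _ _ _] := adj; exists (local_potential s 0 (v 0%N)); rewrite /= -Jv.
have [gp [c cE]] := IH (ltnW il).
have pn : (i < n)%N by lia.
have [cm infE] := infimum_finite hr hs pn gp c.
have cmE : c_ s v w i.+1 = cm%:E by rewrite /= cE.
split; last by exists cm.
apply: (adjacent_good_pair hr hs pn gp (c := c) (cm := cm)); [by lia|exact: infE|].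
by rewrite -(M_succ cE cmE); exact: hvw.
Qed.

Lemma top_level :
  [/\ exists U, M s v w l.+1 U, ordered (M s v w l.+1),
      forall U, M s v w l.+1 U -> euler_lagrange s U &
      forall U, M s v w l.+1 U ->
        forall k : nat, (1 <= k <= l.+1)%N -> clt U (tauN k 1 U)].
Proof.
have [gp [c cE]] := good_pair_levels (leqnn l).
have [cm infE] := infimum_finite hr hs ln gp c.
have cmE : c_ s v w l.+1 = cm%:E by rewrite /= cE.
rewrite (M_succ cE cmE); exact: (minimisers_structure hr hs ln gp infE).
Qed.

End Chain.

Local Close Scope ring_scope.
Local Close Scope classical_set_scope.

Theorem theorem5p1 (R : realType) (n r l : nat) (hn : (2 <= n)%N)
    (hr : (1 <= r)%N) (hl : (1 <= l <= n - 1)%N)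
    (s : (ball0 n r -> R) -> R) (hs : admissible s)
    (v w : nat -> config R n)
    (hvw : forall i : nat, (i <= l)%N -> adjacent (M s v w i) (v i) (w i)) :
  [/\ exists U, M s v w l.+1 U /\ euler_lagrange s U,
      ordered (M s v w l.+1),
      forall U, M s v w l.+1 U -> euler_lagrange s U &
      forall U, M s v w l.+1 U ->
        forall k : nat, (1 <= k <= l.+1)%N -> clt U (tauN k 1 U)].
Proof.
have ln : (l < n)%N by lia.
have [[U MU] ord el mon] := top_level hr ln hs hvw.
by split; [exists U; split; [exact: MU|exact: el]|exact: ord|exact: el|exact: mon].
Qed.
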